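(* Let $\{\Phi_N\}_{N\ge1}$, $\Phi_N:\mathbb R^N\to\mathbb R$, be convex functions possessing third derivatives that are bounded on every compact set, and let $\{\Gamma_N\}_{N\ge1}$, $\Gamma_N\subset\mathbb R^N$, be convex domains whose boundaries consist of finitely many (possibly $N$-dependent in number) smooth pieces. Assume: (i) for every $R_1>0$ there is a constant $C_0>0$ independent of $N$ such that $\frac{d^2}{dt^2}\Phi_N(\mathbf J+t\mathbf e)\big|_{t=0}\ge C_0$ for every unit vector $\mathbf e\in\mathbb R^N$ and every $\mathbf J$ with $|\mathbf J|\le N^{1/2}R_1$; (ii) there are $N$-independent constants $C_1>0$, $R>0$ such that $\Phi_N(\mathbf J)\ge C_1(\mathbf J,\mathbf J)$ whenever $(\mathbf J,\mathbf J)>NR^2$; (iii) for every $U>U_{\min}$, where $U_{\min}:=\min_{\mathbf J\in\Gamma_N}N^{-1}\Phi_N(\mathbf J)$, one has $|\nabla\Phi_N(\mathbf J)|\le N^{1/2}C_2(U)$ for all $\mathbf J\in\tilde\Omega_N(U)$, with $C_2(U)>0$ independent of $N$ and continuous in $U$; (iv) there is a finite $N$-independent $C_3$ with $f_N(\Phi_N)\ge -C_3$. Then, with $U_*:=\frac1N\langle\Phi_N\rangle_{\Phi_N}$, $$|f_N(\Phi_N)-f_N^*(U_* )|\le O\Big(\frac{\log N}{N}\Big),$$ and for every unit vector $\mathbf e\in\mathbb R^N$ and every natural $p$, $$\langle(\dot{\mathbf J},\mathbf e)^p\rangle_{\Phi_N}\le C(p),$$ where $\dot J_i:=J_i-\langle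 J_i\rangle_{\Phi_N}$ and $C(p)>0$ does not depend on $N$.
   Context: Gibbs measure and free energy on $\Gamma_N$: $\Sigma_N(\Phi_N):=\int_{\Gamma_N}e^{-\Phi_N(\mathbf J)}d\mathbf J$, $\langle F\rangle_{\Phi_N}:=\Sigma_N^{-1}\int_{\Gamma_N}F(\mathbf J)e^{-\Phi_N(\mathbf J)}d\mathbf J$, $f_N(\Phi_N):=\frac1N\log\Sigma_N(\Phi_N)$. Level sets: $\tilde\Omega_N(U):=\{\mathbf J:\Phi_N(\mathbf J)\le NU\}$; $\tilde{\mathcal D}_N(U)$ is the boundary of $\tilde\Omega_N(U)$ and $\mathcal D_N(U):=\tilde{\mathcal D}_N(U)\cap\Gamma_N$. Define $f_N^*(U):=\frac1N\log\int_{\mathbf J\in\mathcal D_N(U)}e^{-NU}\,dS_{\mathbf J}$, where $dS$ is the $(N-1)$-dimensional surface (Lebesgue) measure on $\mathcal D_N(U)$. $(\cdot,\cdot)$ is the Euclidean inner product. *)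

(* Defs.v *)
From HB Require Import structures.
From mathcomp Require Import all_boot all_order all_algebra.
From mathcomp Require Import all_classical all_reals all_analysis.
Set Implicit Arguments. Unset Strict Implicit. Unset Printing Implicit Defensive.
Import Order.TTheory GRing.Theory Num.Theory.
Import numFieldNormedType.Exports.
Local Open Scope classical_set_scope.
Local Open Scope ring_scope.

Section Defs.
Variable R : realType.

Definition dotp n (u v : 'rV[R]_n) : R := \sum_(i < n) u ord0 i * v ord0 i.
Definition enorm n (v : 'rV[R]_n) : R := Num.sqrt (dotp v v).

(* Lebesgue integral over R^n of a nonnegative extended-real function,
   as the iterated one-dimensional Lebesgue integral (Tonelli). *)
Fixpoint iint (n : nat) : ('rV[R]_n -> \bar R) -> \bar R :=
  match n with
  | 0 => fun f => f 0
  | n'.+1 => fun f =>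
      (\int[@lebesgue_measure R]_(x in setT)
         iint (fun v : 'rV[R]_n' => f (row_mx (\row_(j < 1) x) v)))%E
  end.

Definition gint n (G : set 'rV[R]_n) (F : 'rV[R]_n -> R) : R :=
  fine (iint (fun J => (Num.max (\1_G J * F J) 0)%:E))
  - fine (iint (fun J => (Num.max (- (\1_G J * F J)) 0)%:E)).

Definition Sigma n (G : set 'rV[R]_n) (Phi : 'rV[R]_n -> R) : R :=
  gint G (fun J => expR (- Phi J)).
Definition gavg n (G : set 'rV[R]_n) (Phi : 'rV[R]_n -> R) (F : 'rV[R]_n -> R) : R :=
  (Sigma G Phi)^-1 * gint G (fun J => F J * expR (- Phi J)).
Definition free_energy n (G : set 'rV[R]_n) (Phi : 'rV[R]_n -> R) : R :=
  ln (Sigma G Phi) / n%:R.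

Definition ball_vol (k : nat) : R :=
  fine (iint (fun v : 'rV[R]_k => (\1_[set w | enorm w <= 1] v)%:E)).

Definition ediam n (C : set 'rV[R]_n) : \bar R :=
  ereal_sup [set (enorm (x - y))%:E | x in C & y in C].

Definition hterm n (k : nat) (C : set 'rV[R]_n) : \bar R :=
  if `[< C = set0 >] then 0%E
  else (ball_vol k * (fine (ediam C) / 2) ^+ k)%:E.

(* k-dimensional Hausdorff measure (normalized so that it agrees with Lebesgue
   measure on k-dimensional planes) *)
Definition hausdorff_delta n (k : nat) (d : R) (A : set 'rV[R]_n) : \bar R :=
  ereal_inf [set (\sum_(0 <= i <oo) hterm k (C i))%E |
             C in [set C : nat -> set 'rV[R]_n |
                    A `<=` \bigcup_i C i /\ forall i, (ediam (C i) <= d%:E)%E]].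
Definition hausdorff n (k : nat) (A : set 'rV[R]_n) : \bar R :=
  ereal_sup [set hausdorff_delta k d A | d in [set d : R | 0 < d]].

Definition tOmega n (Phi : 'rV[R]_n -> R) (U : R) : set 'rV[R]_n :=
  [set J | Phi J <= n%:R * U].
Definition bdry n (A : set 'rV[R]_n) : set 'rV[R]_n :=
  closure A `\` interior A.
Definition Dset n (G : set 'rV[R]_n) (Phi : 'rV[R]_n -> R) (U : R) : set 'rV[R]_n :=
  bdry (tOmega Phi U) `&` G.

(* f_N^*(U) = (1/N) log \int_{D_N(U)} e^{-NU} dS *)
Definition fstar n (G : set 'rV[R]_n) (Phi : 'rV[R]_n -> R) (U : R) : R :=
  ln (fine ((expR (- (n%:R * U)))%:E * hausdorff n.-1 (Dset G Phi U)))%E / n%:R.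

Fixpoint iterD n (ds : seq 'rV[R]_n) (f : 'rV[R]_n -> R) : 'rV[R]_n -> R :=
  match ds with
  | [::] => f
  | d :: ds' => fun x => 'D_d (iterD ds' f) x
  end.

Definition grad n (f : 'rV[R]_n -> R) (x : 'rV[R]_n) : 'rV[R]_n :=
  \row_(i < n) 'D_(delta_mx 0 i) f x.

Definition convex_fun n (f : 'rV[R]_n -> R) : Prop :=
  forall (x y : 'rV[R]_n) (t : R), 0 <= t <= 1 ->
    f (t *: x + (1 - t) *: y) <= t * f x + (1 - t) * f y.

Definition convex_set n (A : set 'rV[R]_n) : Prop :=
  forall (x y : 'rV[R]_n) (t : R), A x -> A y -> 0 <= t <= 1 ->
    A (t *: x + (1 - t) *: y).

Definition third_derivs_bounded n (f : 'rV[R]_n -> R) : Prop :=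
  (forall (ds : seq 'rV[R]_n) x, (size ds <= 2)%N -> differentiable (iterD ds f) x) /\
  (forall K : set 'rV[R]_n, compact K -> exists M : R,
     forall x e1 e2 e3, K x -> enorm e1 = 1 -> enorm e2 = 1 -> enorm e3 = 1 ->
       `|iterD [:: e1; e2; e3] f x| <= M).

Definition smooth_fun n (g : 'rV[R]_n -> R) : Prop :=
  forall (ds : seq 'rV[R]_n) x, differentiable (iterD ds g) x.

(* convex domain (nonempty open convex set) whose boundary consists of
   finitely many smooth pieces: it is covered by finitely many smooth
   regular hypersurfaces {g_k = 0} *)
Definition convex_domain_pw_smooth n (G : set 'rV[R]_n) : Prop :=
  [/\ G !=set0, open G, convex_set G &
      exists (m : nat) (g : 'I_m -> 'rV[R]_n -> R),
        (forall k, smooth_fun (g k)) /\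
        (forall k x, g k x = 0 -> grad (g k) x != 0) /\
        bdry G `<=` \bigcup_(k in setT) [set x | g k x = 0]].

End Defs.

(* Main.v *)
Require Import Defs.
From HB Require Import structures.
From mathcomp Require Import all_boot all_order all_algebra.
From mathcomp Require Import all_classical all_reals all_analysis.
From mathcomp Require Import measurable_realfun.
From mathcomp Require Import ring lra.
Import Order.TTheory GRing.Theory Num.Theory.
Import numFieldNormedType.Exports.
Local Open Scope classical_set_scope.
Local Open Scope ring_scope.
Set Implicit Arguments. Unset Strict Implicit. Unset Printing Implicit Defensive.

(* By the Prekopa-Leindler inequality the volume V(v) of {Phi <= v} in Gamma is log-concave in v. At the mean energy c the
   upper and the lower fluctuations of Phi balance, and log-concavity then forces V(c + 1) - V(c), V(c) and e^c Sigma to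
   agree up to factors polynomial in N. The area A of the level surface {Phi = c} is in turn compared with V(c). From
   above: coverings by balls that are efficient up to a polynomial factor exist, so A is controlled by the volume of a
   thin slab around the surface. From below: the cone from an inner point over any covering of the surface contains
   {c < Phi <= c + 1}, and by the isodiametric inequality its volume is controlled by the Hausdorff sum of the covering.
   Both comparisons lose polynomial factors only, because c exceeds the minimum of Phi by a multiple of N: otherwise
   strong convexity would confine half of the mass to a set too small for the lower bound on the free energy.
   The moments are bounded through <e^(J,e)> <e^-(J,e)>, which does not depend on the centring: inside a ball of radius
   of order sqrt N this product is bounded by Prekopa-Leindler with the gain from strong convexity at midpoints, and
   outside the Gaussian tail is negligible against Sigma. *)

(** * Lebesgue measure on row vectors *)

(** After (1/n) log, a factor bounded by a power of [n] costs O(log n / n), whereas a factor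
    exponential in [n] would be fatal. This rules out coverings by maximal separated sets, which
    lose 2^n, and it is why sets are dilated or contracted only by ratios 1 + O(1/n), which change
    volumes by bounded factors. The balance at c is used through q = V(c + 1) / V(c). If q is too
    close to 1, there is too little volume above c to balance the energies below it. Otherwise
    either q is below e by a definite margin and the energies above c are summable, or q is nearly e
    or larger and those below c are controlled; the balance carries either bound to the other side.
    Assumptions (i) and (iii) give constants only once a radius or an energy is fixed, so the order
    of choices matters. The quadratic growth and the free energy bound give U with c + n <= n U;
    (iii) at U gives a gradient bound L; L bounds Phi below by a multiple of -n; this bounds the
    radius of the level sets; only then does (i) supply C0 on that radius, and C0 gives the gap
    between c and the minimum. *)

HB.instance Definition _ (R : realType) (m n : nat) :=
  @isMeasurable.Build (sigma_display (@open 'M[R]_(m, n))) 'M[R]_(m, n)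
    <<s @open 'M[R]_(m, n) >>
    (@sigma_algebra0 _ setT _) (@sigma_algebraC _ _)
    (@sigma_algebra_bigcup _ setT _).

Section borel_matrices.
Context {R : realType}.

Lemma open_measurable_mx m n (A : set 'M[R]_(m, n)) : open A -> measurable A.
Proof. by move=> oA; apply: sub_sigma_algebra. Qed.

Lemma closed_measurable_mx m n (A : set 'M[R]_(m, n)) : closed A -> measurable A.
Proof. by move=> cA; rewrite -[A]setCK; apply: measurableC; apply: open_measurable_mx; exact: closed_openC. Qed.

Lemma continuous_measurable_mx m n (f : 'M[R]_(m, n) -> R) :
  continuous f -> measurable_fun setT f.
Proof.
move=> cf; apply: (measurability _ (RGenOpens.measurableE R)).
move=> _ [_ [a [b ->]] <-]; rewrite setTI; apply: open_measurable_mx.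
by apply: open_comp; [move=> + _; exact: cf|exact: interval_open].
Qed.

Lemma continuous_mx_measurable_mx m n p q (f : 'M[R]_(m, n) -> 'M[R]_(p, q)) :
  continuous f -> measurable_fun setT f.
Proof.
move=> cf; apply: (measurability (@open 'M[R]_(p, q)) (erefl _)).
by move=> _ [U oU <-]; rewrite setTI; apply: open_measurable_mx; apply: open_comp.
Qed.

Lemma rat_approx_rV n (v : 'rV[R]_n) (e : R) : 0 < e ->
  exists w : 'rV[rat]_n, ball (map_mx ratr w : 'rV[R]_n) e v.
Proof.
move=> e0.
have /choice[w Hw] (i : 'I_n) : exists q : rat, `|v ord0 i - ratr q| < e.
  have [q] := @rat_in_itvoo R (v ord0 i - e) (v ord0 i + e) ltac:(lra).
  rewrite in_itv/= => /andP[h1 h2]; exists q; rewrite ltr_norml; apply/andP; split; lra.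
exists (\row_i w i); split => // i j; rewrite !mxE ord1 /ball/= distrC.
exact: Hw.
Qed.

Notation RT := (measurableTypeR R).

Definition rowcons n (p : RT * 'rV[R]_n) : 'rV[R]_n.+1 :=
  row_mx (\row_(j < 1) p.1) p.2.

Lemma rowcons_ball n (p q : RT * 'rV[R]_n) e : ball p e q -> ball (rowcons p) e (rowcons q).
Proof.
move=> [/= h1 [e0 h2]]; split => // i j; rewrite /rowcons !mxE.
by case: splitP => k _; rewrite ?mxE.
Qed.

Lemma ball_continuous (K : numFieldType) (T U : pseudoMetricType K) (f : T -> U) :
  (forall p e, 0 < e -> exists2 d, 0 < d & forall q, ball p d q -> ball (f p) e (f q)) ->
  continuous f.
Proof.
move=> H p; apply/cvg_ballP => e e0; have [d d0 h] := H p e e0.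
by apply/nbhs_ballP; exists d.
Qed.

Lemma rowcons_continuous n : continuous (@rowcons n).
Proof.
apply: ball_continuous => p e e0; exists e => // q; exact: rowcons_ball.
Qed.

(** Balls with rational centres and radii form a countable base, so an open set is a countable union
    of measurable rectangles. Borel sets of the product topology thus belong to the product
    sigma-algebra, which is what makes [rowcons] measurable. *)
Lemma open_measurable_prod n (U : set (RT * 'rV[R]_n)) : open U -> measurable U.
Proof.
move=> oU.
pose I := (rat * 'rV[rat]_n * rat)%type.
pose B (k : I) : set (RT * 'rV[R]_n) :=
  ball (ratr k.1.1 : R) (ratr k.2 : R) `*` ball (map_mx ratr k.1.2 : 'rV[R]_n) (ratr k.2 : R).
have -> : U = \bigcup_(k in [set k | B k `<=` U]) B k.
  apply/seteqP; split => [x Ux|x [k kU /kU]//].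
  have /nbhs_ballP[e/= e0 eU] : nbhs x U by apply: open_nbhs_nbhs.
  have [r] := @rat_in_itvoo R 0 (e / 2) ltac:(lra).
  rewrite in_itv/= => /andP[r0 re].
  have [q] := @rat_in_itvoo R (x.1 - ratr r) (x.1 + ratr r) ltac:(lra).
  rewrite in_itv/= => /andP[q0 qe].
  have [w hw] := rat_approx_rV x.2 r0.
  have hq : ball (ratr q : R) (ratr r) x.1 by rewrite /ball/= ltr_norml; apply/andP; split; lra.
  exists (q, w, r) => //= y [/= y1 y2]; apply: eU; split.
    by apply: (@le_ball _ _ _ (ratr r + ratr r)); [lra|apply: ball_triangle; [exact: ball_sym hq|]].
  by apply: (@le_ball _ _ _ (ratr r + ratr r)); [lra|apply: ball_triangle; [exact: ball_sym hw|]].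
rewrite bigcup_mkcond; apply: countable_bigcupT_measurable => [|k].
  exact: countableP.
case: ifP => _; last exact: measurable0.
apply: measurableX; first by apply: open_measurable; exact: ball_open.
case: (ltP 0 (ratr k.2 : R)) => h; last first.
  rewrite (_ : ball _ _ = set0); first exact: measurable0.
  by apply/seteqP; split => // y [] h2; lra.
by apply: open_measurable_mx; exact: ball_open.
Qed.

Lemma measurable_rowcons n : measurable_fun setT (@rowcons n).
Proof.
apply: (measurability (@open 'rV[R]_n.+1) (erefl _)).
move=> _ [U oU <-]; rewrite setTI; apply: open_measurable_prod.
by apply: open_comp => // ? _; exact: rowcons_continuous.
Qed.

Definition rowhd n (v : 'rV[R]_n.+1) : R := v ord0 ord0.

Definition rowtl n (v : 'rV[R]_n.+1) : 'rV[R]_n := \row_i v ord0 (lift ord0 i).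

Lemma rowhd_cons n (p : RT * 'rV[R]_n) : rowhd (rowcons p) = p.1.
Proof.
by rewrite /rowhd /rowcons mxE; case: splitP => j //= ij; rewrite mxE.
Qed.

Lemma rowtl_cons n (p : RT * 'rV[R]_n) : rowtl (rowcons p) = p.2.
Proof.
apply/rowP => i; rewrite /rowtl /rowcons !mxE; case: splitP => j ij.
  by move: ij; rewrite /= /bump /= => ij; have := ltn_ord j; rewrite -ij.
by congr (_ _ _); apply/val_inj; move: ij; rewrite /= /bump /= !add1n => -[].
Qed.

Lemma measurable_rowsplit n : measurable_fun setT (fun v : 'rV[R]_n.+1 => (rowhd v : RT, rowtl v)).
Proof.
apply/measurable_fun_pairP; split; first by apply: continuous_measurable_mx; exact: coord_continuous.
apply: continuous_mx_measurable_mx; apply: ball_continuous => v e e0.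
by exists e => // w [_ h]; split => // i j; rewrite !mxE; exact: h.
Qed.

End borel_matrices.

Section lebesgue_affine.
Context {R : realType}.
Let mu := @lebesgue_measure R.
Notation RT := (measurableTypeR R).

(** Both sides are measures in [A] that agree on half-open intervals, and these determine Lebesgue
    measure. *)
Lemma lebesgue_affine (a b : R) (A : set RT) : 0 < a -> measurable A ->
  mu A = (a%:E * mu ((fun x => a * x + b)%R @^-1` A))%E.
Proof.
move=> a0 mA.
have mT : measurable_fun setT (fun x : RT => a * x + b : RT).
  apply: continuous_measurable_fun => x.
  by apply: cvgD; [apply: cvgM; [exact: cvg_cst|exact: cvg_id]|exact: cvg_cst].
pose T := (fun x : RT => a * x + b : RT).
pose nu := mscale (NngNum (ltW a0)) (measure_function_pushforward__canonical__measure_function_Measure mu mT).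
apply: (@lebesgue_measure_unique R nu) => // X [[u v] /= uv <-].
rewrite /nu /mscale /= /pushforward.
rewrite (_ : _ @^-1` _ = `]((u - b) / a), ((v - b) / a)]%classic); last first.
  apply/seteqP; split => x /=; rewrite !in_itv/= ltr_pdivrMr// ler_pdivlMr// => /andP[h1 h2];
    apply/andP; split; lra.
rewrite !lebesgue_measure_itv/= !lte_fin.
have -> : ((u - b) / a < (v - b) / a) = (u < v).
  by rewrite ltr_pM2r ?invr_gt0// ltrD2r.
case: ifP => _; last by rewrite mule0.
by rewrite -EFinD -EFinM; congr (_%:E); field; exact: lt0r_neq0.
Qed.

Lemma integral_affine (a b : R) (f : RT -> \bar R) : 0 < a -> measurable_fun setT f ->
  (forall x, 0 <= f x)%E ->
  (\int[mu]_x f x = a%:E * \int[mu]_x f (a * x + b)%R)%E.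
Proof.
move=> a0 mf f0.
have mT : measurable_fun setT (fun x : RT => a * x + b : RT).
  apply: continuous_measurable_fun => x.
  by apply: cvgD; [apply: cvgM; [exact: cvg_cst|exact: cvg_id]|exact: cvg_cst].
pose T := (fun x : RT => a * x + b : RT).
pose nu := mscale (NngNum (ltW a0)) (measure_function_pushforward__canonical__measure_function_Measure mu mT).
have -> : (\int[mu]_x f x = \int[nu]_x f x)%E.
  by apply: eq_measure_integral => A mA _; rewrite /nu /mscale /pushforward /=; exact: lebesgue_affine.
rewrite ge0_integral_mscale//=; congr (_ * _)%E.
by rewrite (ge0_integral_pushforward mT)//.
Qed.

End lebesgue_affine.

Section lebesgue_measure_rV.
Context {R : realType}.
Notation RT := (measurableTypeR R).
Let mu : {sigma_finite_measure set RT -> \bar R} := @lebesgue_measure R.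

(** An exhaustion of the product by finite rectangles is carried over by splitting off the first
    coordinate. Sigma-finiteness has to be propagated along the recursion because Tonelli is applied
    again in the next dimension. *)
Lemma push_rowcons_sigma_finite n (m : {sigma_finite_measure set 'rV[R]_n -> \bar R}) :
  sigma_finite setT (pushforward (mu \x m)%E (@rowcons R n)).
Proof.
have [F FT Fm] : sigma_finite setT (mu \x m)%E.
  have /sigma_finiteP[F [TF ndF Foo]] := sigma_finiteT mu.
  have /sigma_finiteP[G [TG ndG Goo]] := sigma_finiteT m.
  exists (fun k => F k `*` G k).
    rewrite -setXTT TF TG predeqE => -[x y]; split; last by move=> [k _ []/= ? ?]; split; exists k.
    move=> [/= [i _ Fnx] [j _ Gky]]; exists (maxn i j) => //; split.
    - by move: x Fnx; exact/subsetPset/ndF/leq_maxl.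
    - by move: y Gky; exact/subsetPset/ndG/leq_maxr.
  move=> k; have [? ?] := Foo k; have [? ?] := Goo k.
  split; first exact: measurableX.
  by rewrite product_measure1E// lte_mul_pinfty// ge0_fin_numE.
pose S (v : 'rV[R]_n.+1) := (rowhd v : RT, rowtl v).
have FE k : @rowcons R n @^-1` (S @^-1` F k) = F k.
  by apply/seteqP; split => -[x v] /=; rewrite /S /= rowhd_cons rowtl_cons.
exists (fun k => S @^-1` F k).
  by rewrite -preimage_bigcup -FT preimage_setT.
move=> k; have [mF Ffin] := Fm k; split; last by rewrite /pushforward FE.
by rewrite -[X in measurable X]setTI; exact: measurable_rowsplit.
Qed.

Section push.
Variables (n : nat) (m : {sigma_finite_measure set 'rV[R]_n -> \bar R}).

Definition push_rowcons := pushforward (mu \x m)%E (@rowcons R n).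

HB.instance Definition _ := Measure.copy push_rowcons
  (measure_function_pushforward__canonical__measure_function_Measure (mu \x m)%E (@measurable_rowcons R n)).

HB.instance Definition _ := Measure_isSigmaFinite.Build _ _ _ push_rowcons
  (push_rowcons_sigma_finite m).

End push.

(** The recursion copies that of [iint], so that the iterated integral is an integral for this
    measure by one use of Tonelli per coordinate. In dimension 0 it is the unit mass at the only
    point, as in [iint]. *)
Fixpoint lebn n : {sigma_finite_measure set 'rV[R]_n -> \bar R} :=
  match n with
  | 0 => [the {sigma_finite_measure set 'rV[R]_0 -> \bar R} of dirac (0 : 'rV[R]_0)]
  | n'.+1 => [the sigma_finite_measure _ _ of push_rowcons (lebn n')]
  end.

Lemma lebn_cons n (f : 'rV[R]_n.+1 -> \bar R) : measurable_fun setT f ->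
  (forall x, 0 <= f x)%E ->
  (\int[lebn n.+1]_v f v = \int[mu]_x \int[lebn n]_v f (rowcons (x, v)))%E.
Proof.
move=> mf f0.
rewrite [LHS](ge0_integral_pushforward (@measurable_rowcons R n) (mu \x lebn n)%E)//.
rewrite preimage_setT fubini_tonelli1//=.
by apply: measurableT_comp => //; exact: measurable_rowcons.
Qed.

Lemma measurable_section n (f : 'rV[R]_n.+1 -> \bar R) (x : R) :
  measurable_fun setT f -> measurable_fun setT (fun v => f (rowcons (x, v))).
Proof.
move=> mf; apply: measurableT_comp => //.
apply: (measurableT_comp (@measurable_rowcons R n)).
exact: measurable_pair1.
Qed.

Lemma measurable_integral_section n (f : 'rV[R]_n.+1 -> \bar R) :
  measurable_fun setT f -> (forall x, 0 <= f x)%E ->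
  measurable_fun setT (fun x : RT => \int[lebn n]_v f (rowcons (x, v)))%E.
Proof.
move=> mf f0; apply: (@measurable_fun_fubini_tonelli_F _ _ RT _ _ (lebn n) (f \o @rowcons R n)); last by move=> ?; exact: f0.
by apply: measurableT_comp => //; exact: measurable_rowcons.
Qed.

Lemma iint_lebn n (f : 'rV[R]_n -> \bar R) : measurable_fun setT f ->
  (forall x, 0 <= f x)%E -> iint f = (\int[lebn n]_v f v)%E.
Proof.
elim: n f => [|n IH] f mf f0 /=; first by rewrite integral_dirac// diracT mul1e.
rewrite (lebn_cons mf f0); apply: eq_integral => x _.
by apply: IH => //; exact: measurable_section.
Qed.

Lemma continuous_affine (V : normedModType R) (a : R) (w : V) : continuous (fun v : V => a *: v + w).
Proof. by move=> v; apply: cvgD; [exact: scaler_continuous|exact: cvg_cst]. Qed.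

Lemma lebn_affine n (a : R) (w : 'rV[R]_n) (f : 'rV[R]_n -> \bar R) : 0 < a ->
  measurable_fun setT f -> (forall x, 0 <= f x)%E ->
  (\int[lebn n]_v f v = (a ^+ n)%:E * \int[lebn n]_v f (a *: v + w)%R)%E.
Proof.
move=> a0; elim: n w f => [|n IH] w f mf f0.
  have E : (fun v : 'rV[R]_0 => f (a *: v + w)) = f.
    by apply/funext => v; congr f; apply/rowP => -[].
  by rewrite E expr0 mul1e.
have maff m (z : 'rV[R]_m) : measurable_fun setT (fun v : 'rV[R]_m => a *: v + z).
  apply: continuous_mx_measurable_mx; exact: (@continuous_affine 'rV[R]_m).
have E x v : a *: rowcons (x, v) + w = rowcons (a * x + rowhd w, a *: v + rowtl w).
  apply/rowP => i; rewrite /rowcons !mxE.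
  by case: splitP => j ij /=; rewrite !mxE /rowhd; congr (_ + w _ _); apply/val_inj; rewrite /= ij ?ord1.
rewrite !lebn_cons//; last by apply: measurableT_comp => //; exact: maff.
rewrite (@integral_affine _ a (rowhd w))//; first last.
- by move=> x; apply: integral_ge0.
- exact: measurable_integral_section.
rewrite exprS EFinM -muleA; congr (_ * _)%E.
rewrite -ge0_integralZl//; first last.
- by rewrite lee_fin exprn_ge0// ltW.
- by move=> x _; apply: integral_ge0.
- apply: (@measurable_integral_section n (fun v => f (a *: v + w))) => //.
  by apply: measurableT_comp => //; exact: maff.
apply: eq_integral => x _; rewrite (IH (rowtl w))//; last exact: measurable_section.
by congr (_ * _)%E; apply: eq_integral => v _; rewrite E.
Qed.

End lebesgue_measure_rV.

(** * The Prekopa-Leindler inequality *)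

Section prekopa_leindler_line.
Context {R : realType}.
Notation RT := (measurableTypeR R).
Notation mu := (@lebesgue_measure R).
Local Open Scope ereal_scope.

(** For finite [c] the product passes to the limit. For [c] infinite it jumps at 0, but then a
    nonzero limit forces some [a n] to be positive, and [B] to be infinite already. *)
Lemma lee_mul_limr (a : (\bar R)^nat) (A c B : \bar R) :
  (forall n, 0 <= a n) -> 0 <= c -> a @ \oo --> A -> (forall n, a n * c <= B) -> A * c <= B.
Proof.
move=> a0 c0 aA H.
have A0 : 0 <= A by apply: (cvge_ge _ aA); exact: nearW.
case: c c0 H => [c||//] c0 H.
  have : (fun n => a n * c%:E) @ \oo --> A * c%:E by apply: cvgeZr.
  by move=> h; apply: (cvge_le _ h); exact: nearW.
have [->|An0] := eqVneq A 0; first by rewrite mul0e; apply: le_trans (H 0%N); rewrite mule_ge0.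
have Ap : 0 < A by rewrite lt_neqAle eq_sym An0.
suff -> : B = +oo by rewrite leey.
have [n an] : exists n, 0 < a n.
  apply: contrapT => /forallNP K; move: Ap; apply/negP; rewrite -leNgt.
  by apply: (cvge_le _ aA); apply: nearW => n; rewrite leNgt; apply/negP/K.
by apply/eqP; rewrite -leye_eq; apply: le_trans (H n); rewrite gt0_muley.
Qed.

(** The Brunn-Minkowski inequality on the line. With k the maximum of [K] and l the minimum of [L],
    the sets (K + l) / 2 and (k + L) / 2 both lie in [C], on either side of (k + l) / 2; they share
    at most that point, so their measures add. *)
Lemma compact_half_sum (K L C : set RT) : compact (K : set R) -> compact (L : set R) ->
  K !=set0 -> L !=set0 -> measurable C ->
  (forall x y, K x -> L y -> C ((x + y) / 2)%R) -> mu K + mu L <= 2%:E * mu C.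
Proof.
move=> cK cL K0 L0 mC KLC.
have mK : measurable (K : set RT) by exact: compact_measurable.
have mL : measurable (L : set RT) by exact: compact_measurable.
have [k /set_mem Kk kmax] : exists2 k, k \in (K : set R) & forall t, t \in (K : set R) -> (t <= k)%R.
  by apply: (@compact_EVT_max R R id) => //; apply: continuous_subspaceT => x; exact: cvg_id.
have [l /set_mem Ll lmin] : exists2 l, l \in (L : set R) & forall t, t \in (L : set R) -> (l <= t)%R.
  by apply: (@compact_EVT_min R R id) => //; apply: continuous_subspaceT => x; exact: cvg_id.
pose D := ([set x | K (2 * x + - l)%R] : set RT); pose E := ([set y | L (2 * y + - k)%R] : set RT).
have ca z : measurable_fun setT (fun x : RT => (2 * x + z)%R : RT).
  apply: continuous_measurable_fun => x.
  by apply: cvgD; [apply: cvgM; [exact: cvg_cst|exact: cvg_id]|exact: cvg_cst].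
have mD : measurable D by rewrite -[D]setTI; exact: ca.
have mE : measurable E by rewrite -[E]setTI; exact: ca.
have mE' : measurable (E `\ ((k + l) / 2)%R) by apply: measurableD.
rewrite (lebesgue_affine (- l) (@ltr0n R 2) mK) (lebesgue_affine (- k) (@ltr0n R 2) mL).
rewrite -muleDr//; last by rewrite ge0_adde_def// inE.
rewrite lee_pmul2l//.
have -> : mu ([eta (fun x : RT => (2 * x - k)%R)] @^-1` L) = mu (E `\ ((k + l) / 2)%R).
  rewrite measureD//=.
    rewrite [X in _ - X](_ : _ = 0) ?sube0//.
    apply/eqP; rewrite eq_le measure_ge0 andbT -(lebesgue_measure_set1 ((k + l) / 2)%R).
    by apply: le_measure; rewrite ?inE//; apply: measurableI.
  rewrite ltey; apply/eqP => Eoo; have := compact_finite_measure cL.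
  by rewrite /= (lebesgue_affine (- k) (@ltr0n R 2) mL) -/E Eoo gt0_muley.
rewrite -measureU//; last first.
  apply/seteqP; split => // x [/= /mem_set/kmax h1 [/mem_set/lmin h2 h3]]; apply: h3.
  by apply/eqP; rewrite eq_le; apply/andP; split; lra.
apply: le_measure; rewrite ?inE//; first exact: measurableU.
move=> x [Dx|[Ex _]].
  by have := KLC _ _ Dx Ll; congr C; field.
by have := KLC _ _ Kk Ex; congr C; field.
Qed.

(** Inner regularity by compact sets, one of the two sets at a time. *)
Lemma measurable_half_sum (A B C : set RT) : measurable A -> measurable B -> measurable C ->
  A !=set0 -> B !=set0 -> (forall x y, A x -> B y -> C ((x + y) / 2)%R) ->
  mu A + mu B <= 2%:E * mu C.
Proof.
move=> mA mB mC [a Aa] [b Bb] ABC.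
have H (K L : set R) : compact K -> compact L -> K `<=` A -> L `<=` B -> mu K + mu L <= 2%:E * mu C.
  move=> cK cL KA LB.
  (* A compact approximation from inside may be empty; adjoining a point of the set makes the
     compact case applicable. *)
  have cK' : compact (K `|` [set a]) by apply: compactU => //; exact: compact_set1.
  have cL' : compact (L `|` [set b]) by apply: compactU => //; exact: compact_set1.
  apply: (@le_trans _ _ (mu (K `|` [set a]) + mu (L `|` [set b]))).
    apply: leeD; apply: le_measure; rewrite ?inE; try exact: compact_measurable; exact: subsetUl.
  apply: compact_half_sum => //; [by exists a; right|by exists b; right|].
  by move=> x y [/KA Kx|->] [/LB Ly|->]; exact: ABC.
rewrite [mu B](lebesgue_regularity_inner_sup mB) addeC.
have fA (K : set R) : compact K -> K `<=` A -> mu K \is a fin_num.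
  by move=> cK _; rewrite ge0_fin_numE//; exact: compact_finite_measure.
have HB (K : set R) : compact K -> K `<=` A -> mu B + mu K <= 2%:E * mu C.
  move=> cK KA; rewrite -leeBrDr ?fA// (lebesgue_regularity_inner_sup mB).
  by apply: ge_ereal_sup => _ [L [cL LB] <-]; rewrite leeBrDr ?fA// addeC; exact: H.
have [->|Coo] := eqVneq (2%:E * mu C) +oo; first by rewrite leey.
have fB : mu B \is a fin_num.
  rewrite ge0_fin_numE//; apply: le_lt_trans (_ : 2%:E * mu C < +oo); last by rewrite ltey.
  by apply: le_trans (HB set0 _ _) => //; [rewrite measure0 adde0|exact: compact0].
rewrite -lebesgue_regularity_inner_sup// addeC -leeBrDr// (lebesgue_regularity_inner_sup mA).
by apply: ge_ereal_sup => _ [K [cK KA] <-]; rewrite leeBrDr// addeC; exact: HB.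
Qed.

(** Tonelli on the region below the graph. The levels stop at 1 because [f] and [g] will be
    normalised to have supremum 1, whereas the midpoint function may exceed it and is then
    truncated. *)
Lemma layer_cake1 (u : RT -> \bar R) : measurable_fun setT u -> (forall x, 0 <= u x) ->
  \int[mu]_(t in `[0%R, 1%R[) mu [set x | t%:E < u x] = \int[mu]_x mine (u x) 1.
Proof.
move=> mu_ u0.
pose S : set (RT * RT) := [set p | (0 <= p.1 < 1)%R /\ p.1%:E < u p.2].
have mS : measurable S.
  have -> : S = ([set p : RT * RT | (p.1 \in `[0%R, 1%R[)] `&` [set p | p.1%:E < u p.2]).
    by apply/seteqP; split => p /=; rewrite in_itv.
  apply: measurableI.
    rewrite (_ : [set p | _] = `[0%R, 1%R[%classic `*` setT); first exact: measurableX.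
    by apply/seteqP; split => p /=; [split|case].
  rewrite -[X in measurable X]setTI; apply: measurable_lte => //.
    by apply/measurable_EFinP; exact: measurable_fst.
  by apply: measurableT_comp => //; exact: measurable_snd.
pose m' : {sigma_finite_measure set RT -> \bar R} := mu.
pose I : RT * RT -> \bar R := fun p => (\1_S p)%:E.
have mI : measurable_fun setT I by apply/measurable_EFinP; exact: measurable_indic.
have := @fubini_tonelli _ _ RT RT R m' m' I mI (fun x => ltac:(by rewrite lee_fin)).
move=> F; transitivity (\int[mu]_x \int[mu]_y I (x, y)).
  rewrite integral_mkcond; apply: eq_integral => t _; rewrite patchE.
  case: ifPn => [/set_mem|/negP]; rewrite ?inE/= in_itv/= => ht.
    pose A : set RT := [set x | t%:E < u x].
    have mt : measurable A.
      by rewrite -[X in measurable X]setTI; apply: measurable_lte.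
    transitivity (\int[mu]_x (\1_A x)%:E).
      by rewrite integral_indic ?setIT; [|exact: measurableT|exact: mt].
    apply: eq_integral => x _ /=; rewrite /I; congr (_%:E); rewrite !indicE; congr (_%:R); congr nat_of_bool.
    by apply/idP/idP; rewrite !inE /S/=; [split|case].
  rewrite [RHS]integral0_eq; first by [].
  move=> x _; rewrite /I indicE memNset; first by [].
  by move=> -[h _]; exact: (ht h).
rewrite F; apply: eq_integral => x _; rewrite /I /=; clear F mI I mS.
pose B : set RT := [set t | (0 <= t)%R /\ t%:E < mine (u x) 1].
have -> : \int[mu]_t (\1_S (t, x))%:E = \int[mu]_t (\1_B t)%:E.
  apply: eq_integral => t _; congr (_%:E); rewrite !indicE; congr (_%:R); congr nat_of_bool.
  apply/idP/idP; rewrite !inE /S /B/= lt_min lte_fin.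
    by move=> [/andP[h1 h2] h3]; exact: (conj h1 (introT andP (conj h3 h2))).
  by move=> [h1 /andP[h3 h2]]; exact: (conj (introT andP (conj h1 h2)) h3).
rewrite /B; have [r r01 ->] : exists2 r : R, (0 <= r)%R & mine (u x) 1 = r%:E.
  have := u0 x; case: (u x) => [r||//] r0; last by exists 1%R; rewrite ?minye.
  by exists (Num.min r 1%R); [rewrite le_min ler01 andbT -lee_fin|rewrite EFin_min].
have -> : [set t | (0 <= t)%R /\ t%:E < r%:E] = `[0%R, r[%classic.
  by apply/seteqP; split => t /=; rewrite in_itv/= lte_fin; [move=> [-> ->]|move=> /andP[-> ->]].
rewrite integral_indic ?setIT; [|exact: measurableT|exact: measurable_itv].
rewrite -[LHS]/(mu [set` `[0%R, r[]) lebesgue_measure_itv/= lte_fin; case: ltP => [_|r0]; first by rewrite sube0.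
by congr (_%:E); apply/eqP; rewrite eq_le r01 r0.
Qed.

End prekopa_leindler_line.

Section prekopa_leindler.
Context {R : realType}.
Notation RT := (measurableTypeR R).
Notation mu := (@lebesgue_measure R).
Local Open Scope ereal_scope.

(** Divide [f] and [g] by their suprema a and b, and [h] by the square root of ab. At each level t <
    1 the superlevel sets of the normalised [f] and [g] are nonempty, so the Brunn-Minkowski
    inequality on the line applies. Integration over t gives a bound on the sum of the two
    integrals, and the arithmetic-geometric mean inequality turns it into one on their product. The
    bound [M] keeps the suprema finite. *)
Lemma prekopa_leindler_bounded (f g h : RT -> \bar R) (M : R) :
  measurable_fun setT f -> measurable_fun setT g -> measurable_fun setT h ->
  (forall x, 0 <= f x <= M%:E) -> (forall x, 0 <= g x <= M%:E) -> (forall x, 0 <= h x) ->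
  (forall x y, f x * g y <= h ((x + y) / 2)%R * h ((x + y) / 2)%R) ->
  (\int[mu]_x f x) * (\int[mu]_x g x) <= (\int[mu]_x h x) * (\int[mu]_x h x).
Proof.
move=> mf mg mh f0 g0 h0 fgh.
have h20 : 0 <= (\int[mu]_x h x) * (\int[mu]_x h x) by rewrite mule_ge0// integral_ge0.
have H (u : RT -> \bar R) : (forall x, 0 <= u x <= M%:E) ->
    (forall x, u x = 0) \/ exists2 a : R, (0 < a)%R & (forall x, u x <= a%:E) /\
      forall b : R, (b < a)%R -> exists x, b%:E < u x.
  move=> u0; pose s := ereal_sup (range u).
  have us x : u x <= s by apply: ereal_sup_ubound; exists x.
  have s0 : 0 <= s by apply: le_trans (us 0%R); case/andP: (u0 0%R).
  have sM : s <= M%:E by apply: ge_ereal_sup => _ [x _ <-]; case/andP: (u0 x).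
  have sfin : s \is a fin_num.
    by rewrite ge0_fin_numE// (le_lt_trans sM)// ltry.
  have [s00|sn0] := eqVneq s 0.
    left=> x; apply/eqP; rewrite eq_le; case/andP: (u0 x) => -> _.
    by rewrite -s00 us.
  right; exists (fine s); first by rewrite fine_gt0// lt_neqAle eq_sym sn0 s0/= -ge0_fin_numE.
  rewrite fineK//; split => // b bs.
  have : b%:E < s by rewrite -(fineK sfin) lte_fin.
  by move=> /ereal_sup_gt[_ [x _ <-] ?]; exists x.
have [fz|[a a0 [fa sa]]] := H f f0.
  by rewrite (_ : \int[mu]_x f x = 0) ?mul0e//; apply: integral0_eq => x _.
have [gz|[b b0 [gb sb]]] := H g g0.
  by rewrite (_ : \int[mu]_x g x = 0) ?mule0//; apply: integral0_eq => x _.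
pose c := Num.sqrt (a * b).
have c0 : (0 < c)%R by rewrite sqrtr_gt0 mulr_gt0.
have cc : (c * c = a * b)%R by rewrite -expr2 sqr_sqrtr// mulr_ge0// ltW.
pose nrm (z : R) (u : RT -> \bar R) x := (z^-1)%:E * u x.
have nE (z : R) u : (0 < z)%R -> measurable_fun setT u -> (forall x, 0 <= u x) ->
    \int[mu]_x u x = z%:E * \int[mu]_x nrm z u x.
  move=> z0 mu_ u0; rewrite /nrm ge0_integralZl//; last by rewrite lee_fin invr_ge0 ltW.
  by rewrite muleA -EFinM divff ?mul1e// lt0r_neq0.
have mn (z : R) u : measurable_fun setT u -> measurable_fun setT (nrm z u).
  by move=> mu_; apply: measurable_funeM.
have n0 (z : R) u x : (0 < z)%R -> 0 <= u x -> 0 <= nrm z u x.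
  by move=> z0 u0; rewrite /nrm mule_ge0// lee_fin invr_ge0 ltW.
have nlt (z t : R) u x : (0 < z)%R -> (t%:E < nrm z u x) = ((z * t)%:E < u x).
  by move=> z0; rewrite /nrm muleC lte_pdivlMr// -EFinM mulrC.
have ff x : 0 <= f x by case/andP: (f0 x).
have gg x : 0 <= g x by case/andP: (g0 x).
have key : \int[mu]_x nrm a f x + \int[mu]_x nrm b g x <= 2%:E * \int[mu]_x nrm c h x.
  have E (z : R) u : (0 < z)%R -> (forall x, u x <= z%:E) -> measurable_fun setT u -> (forall x, 0 <= u x) ->
      \int[mu]_x nrm z u x = \int[mu]_(t in `[0%R, 1%R[) mu [set x | t%:E < nrm z u x].
    move=> z0 uz mu_ u0; rewrite layer_cake1; [|exact: mn|by move=> x; exact: n0].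
    apply: eq_integral => x _; rewrite min_l//.
    by rewrite /nrm muleC lee_pdivrMr// mul1e.
  rewrite (E a f)// (E b g)//.
  apply: (@le_trans _ _ (2%:E * \int[mu]_(t in `[0%R, 1%R[) mu [set x | t%:E < nrm c h x])); last first.
    rewrite lee_pmul2l// layer_cake1; [|exact: mn|by move=> x; exact: n0].
    apply: ge0_le_integral => //.
    - by move=> x _; rewrite le_min n0//=.
    - by apply: measurable_mine; [exact: mn|exact: measurable_cst].
    - exact: mn.
    - by move=> x _; rewrite ge_min lexx.
  have mm (z : R) u : measurable_fun setT u -> measurable_fun (`[0%R, 1%R[ : set RT) (fun t : RT => mu [set x | t%:E < nrm z u x]).
    move=> mu_; apply: measurable_funTS.
    pose S : set (RT * RT) := [set p | p.1%:E < nrm z u p.2].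
    have mS : measurable S.
      rewrite -[X in measurable X]setTI; apply: measurable_lte => //.
        by apply/measurable_EFinP; exact: measurable_fst.
      by apply: measurableT_comp; [exact: mn|exact: measurable_snd].
    have := @measurable_fun_xsection _ _ RT RT R [the sigma_finite_measure _ _ of mu] S mS.
    apply: eq_measurable_fun => t _ /=; congr (mu _).
    by apply/seteqP; split => x; rewrite /xsection/= inE.
  rewrite -ge0_integralD//; [|exact: mm|exact: mm].
  rewrite -ge0_integralZl//; last exact: mm.
  apply: ge0_le_integral => //.
  - by move=> x _; rewrite adde_ge0.
  - by apply: emeasurable_funD; exact: mm.
  - by apply: measurable_funeM; exact: mm.
  move=> t; rewrite /= in_itv/= => /andP[t0 t1].
  apply: measurable_half_sum.
  - by rewrite -[X in measurable X]setTI; apply: measurable_lte => //; exact: mn.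
  - by rewrite -[X in measurable X]setTI; apply: measurable_lte => //; exact: mn.
  - by rewrite -[X in measurable X]setTI; apply: measurable_lte => //; exact: mn.
  - by have [|x xt] := sa (a * t)%R; [rewrite gtr_pMr|exists x; rewrite /= nlt].
  - by have [|x xt] := sb (b * t)%R; [rewrite gtr_pMr|exists x; rewrite /= nlt].
  move=> x y /=; rewrite !nlt// => fx gy; rewrite ltNge; apply/negP => hh.
  have := fgh x y; apply/negP; rewrite -ltNge.
  apply: (@le_lt_trans _ _ ((c * t)%:E * (c * t)%:E)).
    by apply: lee_pmul.
  rewrite -EFinM (_ : (c * t * (c * t) = (a * t) * (b * t))%R); last first.
    by rewrite mulrACA cc; ring.
  by rewrite EFinM; apply: lte_pmul => //; rewrite lee_fin mulr_ge0// ltW.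
rewrite (nE a f)// (nE b g)// (nE c h)//.
move: key.
have : 0 <= \int[mu]_x nrm a f x by apply: integral_ge0 => x _; exact: n0.
have : 0 <= \int[mu]_x nrm b g x by apply: integral_ge0 => x _; exact: n0.
have : 0 <= \int[mu]_x nrm c h x by apply: integral_ge0 => x _; exact: n0.
case: (\int[mu]_x nrm c h x) => [r||//] r0; last first.
  have coo : c%:E * +oo = +oo by rewrite gt0_muley ?lte_fin.
  by move=> _ _ _; rewrite coo mulyy leey.
case: (\int[mu]_x nrm a f x) => [p||//] q0 p0 key; first last.
- by move: key; case: (\int[mu]_x nrm b g x) q0.
move: q0 key; case: (\int[mu]_x nrm b g x) => [q||//] q0; last by rewrite addey// -EFinM leye_eq.
rewrite -!EFinM -EFinD !lee_fin in p0 q0 r0 *.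
move=> key.
rewrite (_ : (a * p * (b * q) = (a * b) * (p * q))%R); last by ring.
rewrite (_ : (c * r * (c * r) = (a * b) * (r * r))%R); last by rewrite -cc; ring.
rewrite ler_pM2l ?mulr_gt0//.
have := sqr_ge0 (p - q)%R; nra.
Qed.

(** Truncating [f] and [g] preserves the hypothesis; the truncations are removed one after the other
    by monotone convergence. *)
Lemma prekopa_leindler1 (f g h : RT -> \bar R) :
  measurable_fun setT f -> measurable_fun setT g -> measurable_fun setT h ->
  (forall x, 0 <= f x) -> (forall x, 0 <= g x) -> (forall x, 0 <= h x) ->
  (forall x y, f x * g y <= h ((x + y) / 2)%R * h ((x + y) / 2)%R) ->
  (\int[mu]_x f x) * (\int[mu]_x g x) <= (\int[mu]_x h x) * (\int[mu]_x h x).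
Proof.
move=> mf mg mh f0 g0 h0 fgh.
pose T (u : RT -> \bar R) (n : nat) x := mine (u x) n%:R%:E.
have mT u n : measurable_fun setT u -> measurable_fun setT (T u n).
  by move=> mu_; apply: measurable_mine; [|exact: measurable_cst].
have T0 u n x : 0 <= u x -> 0 <= T u n x by move=> u0; rewrite /T le_min u0 lee_fin ler0n.
have Tu u n x : T u n x <= u x by rewrite /T ge_min lexx.
have Tc u : measurable_fun setT u -> (forall x, 0 <= u x) ->
    (fun n => \int[mu]_x T u n x) @ \oo --> \int[mu]_x u x.
  move=> mu_ u0.
  have -> : \int[mu]_x u x = \int[mu]_x limn (T u ^~ x).
    apply: eq_integral => x _; apply/esym/cvg_lim => //.
    have := u0 x; case E : (u x) => [r||//] r0.
      apply: cvg_near_cst; near=> n; rewrite /T E min_l// lee_fin.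
      by near: n; exact: nbhs_infty_ger.
    rewrite /T E (_ : (fun _ => _) = fun n => n%:R%:E); last by apply/funext => n; rewrite minye.
    by apply/cvgeryP; exact: cvgr_idn.
  apply: cvg_monotone_convergence => //.
  - by move=> n; exact: mT.
  - by move=> n x _; exact: T0.
  - by move=> x _ m n mn; rewrite /T le_min ge_min lexx/= ge_min lee_fin ler_nat mn orbT.
apply: (lee_mul_limr _ _ (Tc f mf f0)).
- by move=> n; apply: integral_ge0 => x _; exact: T0.
- exact: integral_ge0.
move=> n; rewrite muleC; apply: (lee_mul_limr _ _ (Tc g mg g0)).
- by move=> m; apply: integral_ge0 => x _; exact: T0.
- by apply: integral_ge0 => x _; exact: T0.
move=> m; rewrite muleC; apply: (@prekopa_leindler_bounded _ _ _ (maxn n m)%:R) => //; try exact: mT.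
- by move=> x; rewrite T0//= /T ge_min lee_fin ler_nat leq_maxl orbT.
- by move=> x; rewrite T0//= /T ge_min lee_fin ler_nat leq_maxr orbT.
by move=> x y; apply: le_trans (fgh x y); apply: lee_pmul => //; exact: T0.
Unshelve. all: by end_near. Qed.

(** Induction on the dimension: sections of [f], [g], [h] at x, y and (x + y) / 2 satisfy the
    hypothesis, so by induction the integrals of the sections satisfy the one-dimensional
    hypothesis. *)
Lemma prekopa_leindler n (f g h : 'rV[R]_n -> \bar R) :
  measurable_fun setT f -> measurable_fun setT g -> measurable_fun setT h ->
  (forall x, 0 <= f x) -> (forall x, 0 <= g x) -> (forall x, 0 <= h x) ->
  (forall x y, f x * g y <= h (2^-1 *: (x + y))%R * h (2^-1 *: (x + y))%R) ->
  (\int[lebn n]_x f x) * (\int[lebn n]_x g x) <= (\int[lebn n]_x h x) * (\int[lebn n]_x h x).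
Proof.
elim: n f g h => [|n IH] f g h mf mg mh f0 g0 h0 fgh.
  rewrite /= !integral_dirac// !diracT !mul1e.
  by have := fgh 0%R 0%R; rewrite addr0 scaler0.
rewrite !lebn_cons//; apply: prekopa_leindler1; try exact: measurable_integral_section;
  try by move=> x; apply: integral_ge0.
move=> x y; apply: IH => //; try exact: measurable_section.
move=> v w; have := fgh (rowcons (x, v)) (rowcons (y, w)).
rewrite (_ : (2^-1 *: (rowcons (x, v) + rowcons (y, w)))%R = rowcons (((x + y) / 2)%R, (2^-1 *: (v + w))%R))//.
apply/rowP => i; rewrite /rowcons !mxE.
by case: splitP => j ij; rewrite !mxE// mulrC.
Qed.

End prekopa_leindler.

(** * Balls, the isodiametric inequality and Gaussian integrals *)

Section euclidean.
Context {R : realType}.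
Implicit Types (n : nat).

Lemma dotpC n (u v : 'rV[R]_n) : dotp u v = dotp v u.
Proof. by apply: eq_bigr => i _; rewrite mulrC. Qed.

Lemma dotpDl n (u v w : 'rV[R]_n) : dotp (u + v) w = dotp u w + dotp v w.
Proof. by rewrite /dotp -big_split; apply: eq_bigr => i _; rewrite mxE mulrDl. Qed.

Lemma dotpZl n (a : R) (u v : 'rV[R]_n) : dotp (a *: u) v = a * dotp u v.
Proof. by rewrite /dotp mulr_sumr; apply: eq_bigr => i _; rewrite mxE mulrA. Qed.

Lemma dotpDr n (u v w : 'rV[R]_n) : dotp u (v + w) = dotp u v + dotp u w.
Proof. by rewrite dotpC dotpDl !(dotpC u). Qed.

Lemma dotpZr n (a : R) (u v : 'rV[R]_n) : dotp u (a *: v) = a * dotp u v.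
Proof. by rewrite dotpC dotpZl dotpC. Qed.

Lemma dotpNl n (u v : 'rV[R]_n) : dotp (- u) v = - dotp u v.
Proof. by rewrite -scaleN1r dotpZl mulN1r. Qed.

Lemma dotpNr n (u v : 'rV[R]_n) : dotp u (- v) = - dotp u v.
Proof. by rewrite dotpC dotpNl dotpC. Qed.

Lemma dotp_ge0 n (u : 'rV[R]_n) : 0 <= dotp u u.
Proof. by apply: sumr_ge0 => i _; rewrite -expr2 sqr_ge0. Qed.

Lemma dotp0l n (u : 'rV[R]_n) : dotp 0 u = 0.
Proof. by rewrite -(scale0r (0 : 'rV[R]_n)) dotpZl mul0r. Qed.

Lemma enorm_ge0 n (u : 'rV[R]_n) : 0 <= enorm u.
Proof. exact: sqrtr_ge0. Qed.

Lemma enorm_sqr n (u : 'rV[R]_n) : enorm u ^+ 2 = dotp u u.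
Proof. by rewrite sqr_sqrtr// dotp_ge0. Qed.

Lemma enorm_le n (u : 'rV[R]_n) (r : R) : 0 <= r -> (enorm u <= r) = (dotp u u <= r ^+ 2).
Proof. by move=> r0; rewrite -enorm_sqr ler_sqr ?nnegrE// enorm_ge0. Qed.

Lemma enormZ n (a : R) (u : 'rV[R]_n) : enorm (a *: u) = `|a| * enorm u.
Proof. by rewrite /enorm dotpZl dotpZr mulrA -expr2 sqrtrM ?sqr_ge0// sqrtr_sqr. Qed.

Lemma enormN n (u : 'rV[R]_n) : enorm (- u) = enorm u.
Proof. by rewrite -scaleN1r enormZ normrN1 mul1r. Qed.

Lemma enorm0 n : enorm (0 : 'rV[R]_n) = 0.
Proof. by rewrite /enorm dotp0l sqrtr0. Qed.

Lemma cauchy_schwarz n (u v : 'rV[R]_n) : dotp u v <= enorm u * enorm v.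
Proof.
have H (a b : R) : 2 * (a * b * dotp u v) <= a ^+ 2 * dotp u u + b ^+ 2 * dotp v v.
  have := dotp_ge0 (a *: u + (- b) *: v).
  rewrite !(dotpDl, dotpDr, dotpZl, dotpZr) (dotpC v u); nra.
have [u00|un] := eqVneq (enorm u) 0.
  suff -> : dotp u v = 0 by rewrite u00 mul0r.
  have uu : dotp u u = 0 by rewrite -enorm_sqr u00 expr0n.
  apply: big1 => i _; have := uu; rewrite /dotp => /eqP; rewrite psumr_eq0; last by move=> j _; rewrite -expr2 sqr_ge0.
  by move=> /allP/(_ i (mem_index_enum i)); rewrite /= mulf_eq0 orbb => /eqP ->; rewrite mul0r.
have u0 : 0 < enorm u by rewrite lt_neqAle eq_sym un enorm_ge0.
have := H (enorm v) (enorm u); rewrite -!enorm_sqr => h.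
have [v0|vn] := eqVneq (enorm v) 0.
  have := H (dotp u v) (enorm u ^+ 2); rewrite -!enorm_sqr v0.
  set d := dotp u v; set e := enorm u in u0 *; move=> h2.
  have : d ^+ 2 * e ^+ 2 <= 0 by nra.
  rewrite mulr0 pmulr_lle0 ?exprn_gt0// => d2.
  have : d ^+ 2 = 0 by apply/eqP; rewrite eq_le d2 sqr_ge0.
  by move/eqP; rewrite sqrf_eq0 => /eqP ->.
have v0 : 0 < enorm v by rewrite lt_neqAle eq_sym vn enorm_ge0.
have uv0 : 0 < enorm u * enorm v by rewrite mulr_gt0.
rewrite -(ler_pM2l uv0); nra.
Qed.

Lemma enormD n (u v : 'rV[R]_n) : enorm (u + v) <= enorm u + enorm v.
Proof.
rewrite enorm_le; last by rewrite addr_ge0 ?enorm_ge0.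
rewrite !(dotpDl, dotpDr) (dotpC v u) -!enorm_sqr.
have := cauchy_schwarz u v; nra.
Qed.

Lemma enormB n (u v w : 'rV[R]_n) : enorm (u - w) <= enorm (u - v) + enorm (v - w).
Proof. by rewrite -(subrKA v) enormD. Qed.

Lemma enormC n (u v : 'rV[R]_n) : enorm (u - v) = enorm (v - u).
Proof. by rewrite -opprB enormN. Qed.

Lemma coord_le_enorm n (u : 'rV[R]_n) i : `|u ord0 i| <= enorm u.
Proof.
rewrite -[leLHS]ger0_norm// -ler_sqr ?nnegrE ?enorm_ge0// normr_id real_normK ?num_real// enorm_sqr.
rewrite /dotp (bigD1 i)//= -expr2 lerDl; apply: sumr_ge0 => j _; rewrite -expr2; exact: sqr_ge0.
Qed.

Lemma enorm_le_coord n (u : 'rV[R]_n) (e : R) : 0 <= e -> (forall i, `|u ord0 i| <= e) ->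
  enorm u <= n%:R * e.
Proof.
move=> e0 H; rewrite enorm_le; last by rewrite mulr_ge0.
apply: (@le_trans _ _ (\sum_(i < n) e ^+ 2)).
  apply: ler_sum => i _; rewrite -expr2 -[_ ^+ 2]real_normK ?num_real// ler_sqr ?nnegrE//; exact: H.
rewrite sumr_const card_ord -[leLHS]mulr_natl exprMn; apply: ler_wpM2r; first exact: sqr_ge0.
by rewrite -natrX ler_nat; case: (n) => // k; rewrite -mulnn leq_pmulr.
Qed.

Lemma continuous_mul (T : topologicalType) (f g : T -> R) :
  continuous f -> continuous g -> continuous (fun v => f v * g v).
Proof. by move=> cf cg v; apply: cvgM; [exact: cf|exact: cg]. Qed.

Lemma continuous_add (T : topologicalType) (f g : T -> R) :
  continuous f -> continuous g -> continuous (fun v => f v + g v).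
Proof. by move=> cf cg v; apply: cvgD; [exact: cf|exact: cg]. Qed.

Lemma continuous_constant (T : topologicalType) (c : R) : continuous (fun _ : T => c).
Proof. by move=> v; exact: cvg_cst. Qed.

Lemma continuous_sum (T : topologicalType) (I : Type) (s : seq I) (F : I -> T -> R) :
  (forall i, continuous (F i)) -> continuous (fun v => \sum_(i <- s) F i v).
Proof.
move=> cF; elim: s => [|i s IH] v.
  by under eq_fun do rewrite big_nil; exact: cvg_cst.
under eq_fun do rewrite big_cons.
by apply: cvgD; [exact: cF|exact: IH].
Qed.

Lemma dotp_continuous n (w : 'rV[R]_n) : continuous (fun v : 'rV[R]_n => dotp v w).
Proof.
by apply: continuous_sum => i; apply: continuous_mul; [exact: coord_continuous|exact: continuous_constant].
Qed.

Lemma dotp_self_continuous n : continuous (fun v : 'rV[R]_n => dotp v v).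
Proof.
by apply: continuous_sum => i; apply: continuous_mul; exact: coord_continuous.
Qed.

Lemma enormB_continuous n (x : 'rV[R]_n) : continuous (fun v : 'rV[R]_n => enorm (v - x)).
Proof.
have c : continuous (fun v : 'rV[R]_n => dotp v v + (-2) * dotp v x + dotp x x).
  apply: continuous_add; last exact: continuous_constant.
  apply: continuous_add; first exact: dotp_self_continuous.
  by apply: continuous_mul; [exact: continuous_constant|exact: dotp_continuous].
have E : (fun v : 'rV[R]_n => enorm (v - x)) = @Num.sqrt R \o (fun v : 'rV[R]_n => dotp v v + (-2) * dotp v x + dotp x x).
  by apply/funext => v; rewrite /enorm /= !(dotpDl, dotpDr, dotpNl, dotpNr) (dotpC x v); congr Num.sqrt; ring.
by rewrite E => v; apply: continuous_comp; [exact: c|exact: sqrt_continuous].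
Qed.

(** Kept apart from [ball], which on row vectors refers to the sup norm. *)
Definition eball n (x : 'rV[R]_n) (r : R) : set 'rV[R]_n := [set y | enorm (y - x) <= r].

Lemma closed_eball n (x : 'rV[R]_n) r : closed (eball x r).
Proof.
rewrite (_ : eball x r = (fun y => enorm (y - x)) @^-1` [set z | z <= r])//.
apply: preimage_closed; last exact: closed_le.
by move=> y _; exact: enormB_continuous.
Qed.

Lemma nbhs_eball n (x : 'rV[R]_n) (A : set 'rV[R]_n) :
  nbhs x A <-> exists2 r : R, 0 < r & eball x r `<=` A.
Proof.
split.
  move=> /nbhs_ballP[e/= e0 eA]; exists (e / 2); first by rewrite divr_gt0.
  move=> y yx; apply: eA; split => // i j; rewrite ord1 /ball/= distrC.
  have := coord_le_enorm (y - x) j; rewrite !mxE => h.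
  apply: (le_lt_trans h); apply: (le_lt_trans yx); lra.
move=> [r r0 rA]; apply/nbhs_ballP.
exists (r / (n%:R + 1)) => /=; first by rewrite divr_gt0// ltr_wpDl.
move=> y [_ H]; apply: rA; rewrite /eball/=.
apply: (@le_trans _ _ (n%:R * (r / (n%:R + 1)))).
  apply: enorm_le_coord => [|i]; first by rewrite divr_ge0// ?ltW// ltr_wpDl.
  by rewrite !mxE distrC; apply/ltW; exact: H.
rewrite mulrA ler_pdivrMr ?ltr_wpDl//; lra.
Qed.

Lemma bounded_closed_compact_enorm n (A : set 'rV[R]_n) (r : R) :
  closed A -> (forall x, A x -> enorm x <= r) -> compact A.
Proof.
move=> cA bA; apply: bounded_closed_compact => //.
exists r; split; first exact: num_real.
move=> s rs x /bA xr; apply: (le_trans _ (ltW rs)).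
have r0 : 0 <= r by apply: le_trans xr; exact: enorm_ge0.
rewrite (_ : `|x| = mx_norm x)// mx_normrE; apply/bigmax_leP; split => //= -[i j] _ /=.
by rewrite ord1; apply: le_trans xr; exact: coord_le_enorm.
Qed.

End euclidean.

Lemma bernoulli_le {R : realFieldType} (n : nat) (e : R) : 0 <= e <= 1 -> 1 - n%:R * e <= (1 - e) ^+ n.
Proof.
move=> /andP[e0 e1]; elim: n => [|k IH]; first by rewrite mul0r subr0 expr0.
rewrite exprS; apply: (@le_trans _ _ ((1 - e) * (1 - k%:R * e))); last by rewrite ler_wpM2l// subr_ge0.
have := mulr_ge0 (ler0n R k) (sqr_ge0 e); rewrite -(natr1 k); nra.
Qed.

(** * Volumes of balls, the isodiametric inequality, Gaussian integrals *)

Section volumes.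
Context {R : realType}.
Notation RT := (measurableTypeR R).
Notation mu := (@lebesgue_measure R).
Local Open Scope ereal_scope.

Lemma lebn_opp n (f : 'rV[R]_n -> \bar R) : measurable_fun setT f -> (forall x, 0 <= f x) ->
  \int[lebn n]_v f (- v)%R = \int[lebn n]_v f v.
Proof.
elim: n f => [|n IH] f mf f0.
  by apply: eq_integral => v _; congr f; apply/rowP => -[].
have cN m : measurable_fun setT (fun v : 'rV[R]_m => - v)%R.
  rewrite (_ : (fun v => _) = (fun v : 'rV[R]_m => (-1)%R *: v + (0%R : 'rV[R]_m))%R).
    by apply: continuous_mx_measurable_mx; exact: (@continuous_affine R 'rV[R]_m).
  by apply/funext => v; rewrite scaleN1r addr0.
rewrite !lebn_cons//; last exact: measurableT_comp.
have E x (v : 'rV[R]_n) : (- rowcons (x, v))%R = rowcons ((- x)%R, (- v)%R).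
  by apply/rowP => i; rewrite /rowcons !mxE; case: splitP => j ij; rewrite !mxE.
pose g (x : RT) := \int[lebn n]_v f (rowcons (x, v)).
transitivity (\int[mu]_x g (- x)%R).
  apply: eq_integral => x _; rewrite /g -[RHS]IH//; last exact: measurable_section.
  by apply: eq_integral => v _; rewrite E.
have mg : measurable_fun setT g by exact: measurable_integral_section.
have mN : measurable_fun setT (fun x : RT => - x : RT)%R by apply: continuous_measurable_fun => x; exact: cvgN.
transitivity (\int[pushforward mu (fun x : RT => - x : RT)%R]_x g x).
  by rewrite (ge0_integral_pushforward mN)// => x _; apply: integral_ge0.
by apply: eq_measure_integral => A mA _; exact: lebesgue_measureN.
Qed.


Lemma lebn_le n (A B : set 'rV[R]_n) : measurable A -> measurable B -> A `<=` B -> lebn n A <= lebn n B.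
Proof. by move=> mA mB AB; apply: le_measure; rewrite ?inE. Qed.

Lemma lebnE n (A : set 'rV[R]_n) : measurable A -> lebn n A = \int[lebn n]_v (\1_A v)%:E.
Proof. by move=> mA; rewrite integral_indic ?setIT//; exact: measurableT. Qed.

Lemma measurable_indicE n (A : set 'rV[R]_n) : measurable A ->
  measurable_fun setT (fun v => (\1_A v)%:E : \bar R).
Proof. by move=> mA; apply/measurable_EFinP; exact: measurable_indic. Qed.

Lemma lebn_affine_set n (a : R) (w : 'rV[R]_n) (A : set 'rV[R]_n) : (0 < a)%R -> measurable A ->
  lebn n A = (a ^+ n)%:E * lebn n [set v | A (a *: v + w)%R].
Proof.
move=> a0 mA; rewrite lebnE// (lebn_affine w a0)//; [|exact: measurable_indicE].
congr (_ * _); rewrite lebnE; first by apply: eq_integral => v _; rewrite !indicE; congr ((_ \in _)%:R%:E).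
have : measurable_fun setT (fun v : 'rV[R]_n => (a *: v + w)%R).
  by apply: continuous_mx_measurable_mx; exact: (@continuous_affine R 'rV[R]_n).
by move=> /(_ measurableT A mA); rewrite setTI.
Qed.

Lemma lebn_opp_set n (A : set 'rV[R]_n) : measurable A -> measurable [set v | A (- v)%R] ->
  lebn n [set v | A (- v)%R] = lebn n A.
Proof.
move=> mA mA'; rewrite !lebnE// -(lebn_opp (measurable_indicE mA))//.
Qed.

Lemma lebn_rect n (A : set RT) (B : set 'rV[R]_n) : measurable A -> measurable B ->
  lebn n.+1 [set v | A (rowhd v) /\ B (rowtl v)] = mu A * lebn n B.
Proof.
move=> mA mB.
rewrite [LHS]/=/push_rowcons /pushforward.
rewrite -product_measure1E//; congr (_ _).
by apply/seteqP; split => -[x v] /=; rewrite rowhd_cons rowtl_cons.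
Qed.

Lemma dotp_rowsplit n (u v : 'rV[R]_n.+1) :
  dotp u v = (rowhd u * rowhd v + dotp (rowtl u) (rowtl v))%R.
Proof.
rewrite /dotp big_ord_recl; congr (_ + _)%R.
by apply: eq_bigr => i _; rewrite !mxE.
Qed.

Lemma measurable_eball n (x : 'rV[R]_n) r : measurable (eball x r).
Proof. by apply: closed_measurable_mx; exact: closed_eball. Qed.

Lemma measurable_rect n (A : set RT) (B : set 'rV[R]_n) : measurable A -> measurable B ->
  measurable [set v : 'rV[R]_n.+1 | A (rowhd v) /\ B (rowtl v)].
Proof.
move=> mA mB; have := @measurable_rowsplit R n measurableT (A `*` B) (measurableX mA mB).
by rewrite setTI.
Qed.

Lemma lebn_eball_scale n (x : 'rV[R]_n) (r : R) : (0 < r)%R ->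
  lebn n (eball x r) = (r ^+ n)%:E * lebn n (eball 0%R 1).
Proof.
move=> r0; rewrite (lebn_affine_set x r0); last exact: measurable_eball.
congr (_ * lebn n _); apply/seteqP; split => v; rewrite /eball/= addrK subr0 enormZ gtr0_norm// => h.
  by rewrite -(ler_pM2l r0) mulr1.
by rewrite -[leRHS]mulr1 ler_pM2l.
Qed.

Lemma eball0E n (r : R) : eball (0%R : 'rV[R]_n) r = [set w | (enorm w <= r)%R].
Proof. by apply/seteqP; split => v; rewrite /eball/= subr0. Qed.

Lemma itv_length (a b : R) : (a <= b)%R -> mu `[a, b]%classic = (b - a)%:E.
Proof.
move=> ab; rewrite -[mu _]/(mu [set` `[a, b]]) lebesgue_measure_itv/= lte_fin.
case: ltP => [_|ba]; first by rewrite EFinB.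
by have -> : b = a by [apply/eqP; rewrite eq_le ab ba]; rewrite subrr.
Qed.

(** The ball lies in the cylinder of height 2 over the ball of one dimension less. It contains the
    cylinder of half-height h = 1 / (n + 1) over the ball of radius 1 - h^2, whose base keeps half
    of its volume by Bernoulli. Polynomial comparability of consecutive unit ball volumes is all
    that is used to pass between [n] and [n.-1]. *)
Lemma lebn_unit_ball_bounds n :
  (n.+1%:R^-1 : R)%:E * lebn n (eball (0%R : 'rV[R]_n) 1) <=
    lebn n.+1 (eball (0%R : 'rV[R]_n.+1) 1) <= 2%:E * lebn n (eball (0%R : 'rV[R]_n) 1).
Proof.
apply/andP; split; last first.
  have -> : 2%:E * lebn n (eball (0%R : 'rV[R]_n) 1) = mu `[(-1)%R, 1%R]%classic * lebn n (eball (0%R : 'rV[R]_n) 1).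
    by rewrite itv_length; [congr (_%:E * _); ring|lra].
  rewrite -lebn_rect; [|exact: measurable_itv|exact: measurable_eball].
  apply: lebn_le; first exact: measurable_eball.
    by apply: measurable_rect; [exact: measurable_itv|exact: measurable_eball].
  move=> v; rewrite /eball/= !subr0 !enorm_le// dotp_rowsplit => h.
  have := dotp_ge0 (rowtl v); have := sqr_ge0 (rowhd v); rewrite in_itv/= => h1 h2; split.
    by apply/andP; split; nra.
  by nra.
(* Here h would be 1 and Bernoulli would be of no help; the interval [-1, 1] is the ball itself. *)
have [->|n0] := eqVneq n 0%N.
  rewrite invr1 mul1e.
  apply: (@le_trans _ _ (mu `[(-1)%R, 1%R]%classic * lebn 0 (eball (0%R : 'rV[R]_0) 1))).
    rewrite -[leLHS]mul1e; apply: lee_pmul => //.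
    by rewrite itv_length ?lee_fin; lra.
  rewrite -lebn_rect; [|exact: measurable_itv|exact: measurable_eball].
  apply: lebn_le; last 2 first.
  - exact: measurable_eball.
  - move=> v; rewrite /eball/= !subr0 !enorm_le// dotp_rowsplit in_itv/= => -[/andP[h1 h2] _].
    by rewrite /dotp big_ord0; nra.
  by apply: measurable_rect; [exact: measurable_itv|exact: measurable_eball].
pose h : R := (n.+1%:R^-1)%R.
have N2 : (2 <= n.+1%:R :> R)%R by rewrite (ler_nat R 2); case: (n) n0.
have h0 : (0 < h)%R by rewrite invr_gt0; lra.
have h12 : (h <= 2^-1)%R by rewrite lef_pV2 ?posrE; lra.
have r0 : (0 < 1 - h ^+ 2)%R by nra.
have B : (2^-1 <= (1 - h ^+ 2) ^+ n)%R.
  apply: (@le_trans _ _ (1 - n%:R * h ^+ 2)%R).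
    suff : (n%:R * h ^+ 2 <= h)%R by lra.
    rewrite expr2 mulrA -[leRHS]mul1r ler_pM2r// /h ler_pdivrMr ?mul1r; [|lra].
    by rewrite ler_nat leqnSn.
  by apply: bernoulli_le; apply/andP; split; nra.
apply: (@le_trans _ _ (mu `[(- h)%R, h]%classic * lebn n (eball (0%R : 'rV[R]_n) (1 - h ^+ 2)))); last first.
  rewrite -lebn_rect; [|exact: measurable_itv|exact: measurable_eball].
  apply: lebn_le; last 2 first.
  - exact: measurable_eball.
  - move=> v; rewrite /eball/= !subr0 !enorm_le//; last exact: ltW.
    rewrite dotp_rowsplit in_itv/= => -[/andP[h1 h2] h3].
    apply: (@le_trans _ _ (h ^+ 2 + (1 - h ^+ 2) ^+ 2)%R); last by nra.
    by apply: lerD => //; nra.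
  by apply: measurable_rect; [exact: measurable_itv|exact: measurable_eball].
rewrite (lebn_eball_scale _ r0) muleA; apply: lee_pmul => //.
rewrite itv_length; last by lra.
rewrite -EFinM lee_fin -/h; move: B; set X := ((1 - h ^+ 2) ^+ n)%R => B; nra.
Qed.

Lemma lebn_unit_ball_fin n : lebn n (eball (0%R : 'rV[R]_n) 1) \is a fin_num /\
  0 < lebn n (eball (0%R : 'rV[R]_n) 1).
Proof.
elim: n => [|n [IHf IH0]].
  have -> : lebn 0 (eball (0%R : 'rV[R]_0) 1) = 1 :> \bar R; last by [].
  by rewrite /= diracE mem_set// /eball/= subrr enorm0.
have /andP[h1 h2] := lebn_unit_ball_bounds n; split.
  by rewrite ge0_fin_numE//; apply: le_lt_trans h2 _; rewrite lte_mul_pinfty// ltey_eq IHf.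
by apply: lt_le_trans h1; rewrite mule_gt0// lte_fin invr_gt0.
Qed.

Lemma ball_volE n : (ball_vol R n)%:E = lebn n (eball (0%R : 'rV[R]_n) 1).
Proof.
have [f _] := lebn_unit_ball_fin n.
rewrite /ball_vol -eball0E iint_lebn -?lebnE ?fineK//.
- exact: measurable_eball.
by apply: measurable_indicE; exact: measurable_eball.
Qed.

Lemma ball_vol_gt0 n : (0 < ball_vol R n)%R.
Proof. by rewrite -lte_fin ball_volE; case: (lebn_unit_ball_fin n). Qed.

Lemma ball_vol_recl n : (ball_vol R n <= n.+1%:R * ball_vol R n.+1)%R.
Proof.
have /andP[h _] := lebn_unit_ball_bounds n; move: h; rewrite -!ball_volE -EFinM lee_fin.
by rewrite ler_pdivrMl.
Qed.

Lemma ball_vol_recr n : (ball_vol R n.+1 <= 2 * ball_vol R n)%R.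
Proof. by have /andP[_] := lebn_unit_ball_bounds n; rewrite -!ball_volE -EFinM lee_fin. Qed.

Lemma lebn_eball n (x : 'rV[R]_n) (r : R) : (0 < r)%R ->
  lebn n (eball x r) = (ball_vol R n * r ^+ n)%:E.
Proof. by move=> r0; rewrite lebn_eball_scale// -ball_volE -EFinM mulrC. Qed.

(* Prekopa-Leindler for the indicators of A, -A and the ball of diameter d. *)
Lemma isodiametric n (A : set 'rV[R]_n) (d : R) : measurable A -> (0 < d)%R ->
  (forall x y, A x -> A y -> (enorm (x - y) <= d)%R) ->
  lebn n A <= (ball_vol R n * (d / 2) ^+ n)%:E.
Proof.
move=> mA d0 Ad; have d20 : (0 < d / 2)%R by rewrite divr_gt0.
have mN : measurable [set v : 'rV[R]_n | A (- v)%R].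
  have : measurable_fun setT (fun v : 'rV[R]_n => ((-1) *: v + 0)%R).
    by apply: continuous_mx_measurable_mx; exact: (@continuous_affine R 'rV[R]_n).
  move=> /(_ measurableT A mA); rewrite setTI.
  by congr measurable; apply/seteqP; split => v /=; rewrite scaleN1r addr0.
have PL := @prekopa_leindler R n (fun v => (\1_A v)%:E) (fun v => (\1_[set v | A (- v)%R] v)%:E)
  (fun v => (\1_(eball (0%R : 'rV[R]_n) (d / 2)) v)%:E).
have : lebn n A * lebn n A <=
    lebn n (eball (0%R : 'rV[R]_n) (d / 2)) * lebn n (eball (0%R : 'rV[R]_n) (d / 2)).
  rewrite -{2}(lebn_opp_set mA mN) !lebnE//; last exact: measurable_eball.
  apply: PL; try exact: measurable_indicE; try by move=> x; rewrite lee_fin.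
  - apply: measurable_indicE; exact: measurable_eball.
  move=> x y; rewrite !indicE -!EFinM lee_fin.
  have [/set_mem Ax|_] := boolP (x \in A); last by rewrite mul0r mulr_ge0.
  have [/set_mem Ay|_] := boolP (y \in _); last by rewrite mulr0 mulr_ge0.
  rewrite mem_set ?mulr1// /eball/= subr0 enormZ gtr0_norm ?invr_gt0//.
  have := Ad _ _ Ax Ay; rewrite opprK => h; rewrite mulrC ler_pM2r//.
rewrite lebn_eball// -EFinM.
have : 0 <= lebn n A by [].
case: (lebn n A) => [r||//] r0; rewrite ?mulyy// -?EFinM !lee_fin => h.
rewrite leNgt; apply/negP => h2.
have p0 : (0 <= ball_vol R n * (d / 2) ^+ n)%R by rewrite mulr_ge0 ?exprn_ge0 ?ltW// ball_vol_gt0.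
by nra.
Qed.

Lemma gauss_line (a : R) : (0 < a)%R ->
  \int[mu]_x (expR (- (a * x ^+ 2)))%:E = (Num.sqrt (pi / a))%:E.
Proof.
move=> a0; pose s := Num.sqrt a; have s0 : (0 < s)%R by rewrite sqrtr_gt0.
have mg : measurable_fun setT (fun x : RT => (gauss_fun x)%:E).
  by apply/measurable_EFinP; exact: measurable_gauss_fun.
have := @integral_affine R s 0%R (fun x => (gauss_fun x)%:E) s0 mg (fun x => ltac:(by rewrite lee_fin gauss_fun_ge0)).
rewrite integralT_gauss => H.
have -> : \int[mu]_x (expR (- (a * x ^+ 2)))%:E = \int[mu]_x (gauss_fun (s * x + 0))%:E.
  by apply: eq_integral => x _; rewrite /gauss_fun addr0 exprMn sqr_sqrtr// ltW.
rewrite sqrtrM ?pi_ge0// sqrtrV ?ltW// -/s mulrC EFinM H muleA -EFinM mulVf ?mul1e//.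
exact: lt0r_neq0.
Qed.

Lemma gauss_lebn n (a : R) : (0 < a)%R ->
  \int[lebn n]_v (expR (- (a * dotp v v)))%:E = (Num.sqrt (pi / a) ^+ n)%:E.
Proof.
move=> a0; have mf m : measurable_fun setT (fun v : 'rV[R]_m => (expR (- (a * dotp v v)))%:E).
  apply/measurable_EFinP; apply: measurableT_comp => //; apply: continuous_measurable_mx.
  under eq_fun do rewrite -mulNr.
  by apply: continuous_mul; [exact: continuous_constant|exact: dotp_self_continuous].
elim: n => [|n IH].
  transitivity (\int[lebn 0]_(v in [set: 'rV[R]_0]) (1 : \bar R)).
    by apply: eq_integral => v _; rewrite /dotp big_ord0 mulr0 oppr0 expR0.
  by rewrite integral_cst// mul1e expr0; exact: diracT.
rewrite lebn_cons//.
have E x (v : 'rV[R]_n) : (expR (- (a * dotp (rowcons (x, v)) (rowcons (x, v)))))%:E =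
    (expR (- (a * x ^+ 2)))%:E * (expR (- (a * dotp v v)))%:E.
  by rewrite dotp_rowsplit rowhd_cons rowtl_cons -EFinM -expRD; congr (expR _)%:E; rewrite /=; ring.
under eq_integral do under eq_integral do rewrite E.
under eq_integral => x _ do rewrite ge0_integralZl// ?IH ?lee_fin ?expR_ge0//.
rewrite ge0_integralZr//; last first.
- apply/measurable_EFinP; apply: measurableT_comp => //; apply: continuous_measurable_fun.
  under eq_fun do rewrite -mulNr.
  by apply: continuous_mul; [exact: continuous_constant|exact: exprn_continuous].
by rewrite gauss_line// -EFinM exprS.
Qed.

End volumes.

(** * Convex functions *)

Section calculus.
Context {R : realType}.
Implicit Types (n : nat).

Lemma derive_line n (f : 'rV[R]_n -> R) (x e : 'rV[R]_n) (t : R) :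
  'D_1 (fun s : R => f (x + s *: e)) t = 'D_e f (x + t *: e).
Proof.
have E : (fun h : R => h^-1 *: (((fun s : R => f (x + s *: e)) \o shift t) (h *: (1 : R)) - f (x + t *: e))) =
    (fun h : R => h^-1 *: ((f \o shift (x + t *: e)) (h *: e) - f (x + t *: e))).
  apply/funext => h; rewrite /= /shift; congr (_ *: (f _ - _)).
  by rewrite [h *: 1]mulr1 scalerDl addrCA.
by rewrite /derive E.
Qed.

Lemma derivable_line n (f : 'rV[R]_n -> R) (x e : 'rV[R]_n) (t : R) :
  derivable f (x + t *: e) e -> derivable (fun s : R => f (x + s *: e)) t 1.
Proof.
have E : (fun h : R => h^-1 *: (((fun s : R => f (x + s *: e)) \o shift t) (h *: (1 : R)) - f (x + t *: e))) =
    (fun h : R => h^-1 *: ((f \o shift (x + t *: e)) (h *: e) - f (x + t *: e))).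
  apply/funext => h; rewrite /= /shift; congr (_ *: (f _ - _)).
  by rewrite [h *: 1]mulr1 scalerDl addrCA.
by rewrite /derivable E.
Qed.

Lemma is_derive_line n (f : 'rV[R]_n -> R) (x e : 'rV[R]_n) (t : R) :
  differentiable f (x + t *: e) ->
  is_derive t (1 : R) (fun s : R => f (x + s *: e)) ('D_e f (x + t *: e)).
Proof.
move=> df; rewrite -derive_line; apply: derivableP.
exact/derivable_line/diff_derivable.
Qed.

Lemma derive_dotp n (f : 'rV[R]_n -> R) (x v : 'rV[R]_n) : differentiable f x ->
  'D_v f x = dotp (grad f x) v.
Proof.
move=> df; rewrite deriveE// [in LHS](row_sum_delta v) linear_sum /dotp.
apply: eq_bigr => i _; rewrite linearZ /= /grad mxE mulrC deriveE//.
Qed.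

Lemma convex_grad_le n (f : 'rV[R]_n -> R) (x y : 'rV[R]_n) : convex_fun f -> differentiable f x ->
  f x + dotp (grad f x) (y - x) <= f y.
Proof.
move=> cf df; rewrite -lerBrDl -derive_dotp//.
have := @diff_derivable _ _ _ f x (y - x) df.
rewrite /derivable -/(derive f x (y - x)) => /cvg_ex[l hl].
have -> : 'D_(y - x) f x = l by apply: cvg_lim.
have hr := cvg_dnbhs_at_right hl.
apply: (cvgr_to_le hr); near=> h.
have h0 : 0 < h by near: h; exact: nbhs_right_gt.
have h1 : h <= 1 by near: h; exact: nbhs_right_le.
rewrite /= /shift [_ *: _]mulrC ler_pdivrMr//.
have := cf y x h; rewrite h1 ltW// => /(_ isT).
rewrite (_ : h *: y + (1 - h) *: x = h *: (y - x) + x); first by lra.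
by rewrite scalerBl scale1r scalerBr addrA addrAC.
Unshelve. all: by end_near.
Qed.

Lemma segment_crossing n (f : 'rV[R]_n -> R) (x y : 'rV[R]_n) (c : R) : continuous f ->
  f x <= c <= f y -> exists2 t, 0 <= t <= 1 & f (x + t *: (y - x)) = c.
Proof.
move=> cf /andP[xc cy].
have cg : continuous (fun t : R => f (x + t *: (y - x))).
  move=> t; apply: continuous_comp; last exact: cf.
  have := @scalel_continuous R 'rV[R]_n (y - x) t.
  move=> h; apply: (@cvgD _ 'rV[R]_n); [exact: cvg_cst|exact: h].
have [|t] := @IVT R (fun t => f (x + t *: (y - x))) 0 1 c ler01 (continuous_subspaceT cg).
  by rewrite scale0r addr0 scale1r subrKC ge_min xc/= le_max cy orbT.
by rewrite in_itv/= => t01 ft; exists t.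
Qed.

(** [psi], the derivative of g - c t^2 / 2, is nondecreasing on [-s, s]; hence the even function
    [phi] has derivative psi(t) - psi(-t) >= 0 for t >= 0. *)
Lemma second_derivative_midpoint (g g1 g2 : R -> R) (s c : R) : 0 <= s ->
  (forall t, is_derive t (1 : R) g (g1 t)) -> (forall t, is_derive t (1 : R) g1 (g2 t)) ->
  (forall t, - s <= t <= s -> c <= g2 t) ->
  2 * g 0 + c * s ^+ 2 <= g s + g (- s).
Proof.
move=> s0 dg dg1 hc.
have drv (f : R -> R) (t l : R) : is_derive t (1 : R) f l -> derivable f t 1 by case.
pose psi t := g1 t - c * t.
have dpsi t : is_derive t (1 : R) psi (g2 t - c).
  have dl : is_derive t (1 : R) (fun t : R => c * t) c.
    have H := is_deriveM (is_derive_cst c t (1 : R)) (is_derive_id t (1 : R)).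
    by apply: (is_derive_eq H); rewrite /= scaler0 addr0 [_ *: _]mulr1.
  exact: (is_deriveB (dg1 t) dl).
have mpsi : {in `[- s, s] &, {homo psi : x y / x <= y}}.
  move=> a b ha hb; rewrite le_eqVlt => /predU1P[->//|ab].
  have [z hz E] := @MVT R psi (fun t => g2 t - c) a b ab (fun t _ => dpsi t) (derivable_within_continuous (fun t _ => drv _ _ _ (dpsi t))).
  rewrite -subr_ge0 E mulr_ge0//; last by rewrite subr_ge0 ltW.
  rewrite subr_ge0; apply: hc; move: ha hb hz; rewrite !in_itv/= => /andP[a1 a2] /andP[b1 b2] /andP[z1 z2]; apply/andP; split; lra.
pose phi t := g t + g (- t) - c * t ^+ 2.
have dphi t : is_derive t (1 : R) phi (psi t - psi (- t)).
  have dN : is_derive t (1 : R) (fun t : R => g (- t)) (- g1 (- t)).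
    have := @is_derive1_comp R g (fun t : R => - t) t (g1 (- t)) (-1) (dg (- t)) _.
    rewrite mulrN1; apply; exact: (is_deriveN (is_derive_id t (1 : R))).
  have dX : is_derive t (1 : R) (fun t : R => c * t ^+ 2) (c * (2 * t)).
    have H := is_deriveM (is_derive_cst c t (1 : R)) (is_deriveX 2 (is_derive_id t (1 : R))).
    by apply: (is_derive_eq H); rewrite /= scaler0 addr0 expr1 /= mulr_natl; congr (_ * _); rewrite [_ *: _]mulr1.
  apply: (is_derive_eq (is_deriveB (is_deriveD (dg t) dN) dX)).
  by rewrite /psi; ring.
have : phi 0 <= phi s.
  move: s0; rewrite le_eqVlt => /predU1P[<-//|s0].
  have [z hz E] := @MVT R phi (fun t => psi t - psi (- t)) 0 s s0 (fun t _ => dphi t) (derivable_within_continuous (fun t _ => drv _ _ _ (dphi t))).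
  rewrite -subr_ge0 E mulr_ge0//; last by rewrite subr0 ltW.
  rewrite subr_ge0; apply: mpsi; move: hz; rewrite !in_itv/= => /andP[z1 z2]; try (apply/andP; split); lra.
rewrite /phi oppr0 expr0n mulr0; lra.
Qed.

(* The assumption is on the restriction of f to lines, differentiated at the base point only. *)
Lemma strongly_convex_midpoint n (f : 'rV[R]_n -> R) (r c : R) (x y : 'rV[R]_n) :
  (forall (ds : seq 'rV[R]_n) z, (size ds <= 2)%N -> differentiable (Defs.iterD ds f) z) ->
  (forall e J : 'rV[R]_n, enorm e = 1 -> enorm J <= r ->
     c <= derive1n 2 (fun t : R => f (J + t *: e)) 0) ->
  enorm x <= r -> enorm y <= r ->
  f (2^-1 *: (x + y)) <= (f x + f y) / 2 - c / 8 * dotp (x - y) (x - y).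
Proof.
move=> df fc xr yr.
have [xy|xy] := eqVneq x y.
  rewrite xy subrr dotp0l mulr0 subr0 (_ : 2^-1 *: (y + y) = y); last by apply/rowP => i; rewrite !mxE; lra.
  lra.
pose d := enorm (x - y); pose e := d^-1 *: (x - y); pose m := 2^-1 *: (x + y).
have d0 : 0 < d.
  rewrite lt_neqAle enorm_ge0 andbT eq_sym; apply: contra_neq xy => d0.
  apply/rowP => i; have := coord_le_enorm (x - y) i; rewrite -/d d0 normr_le0 !mxE subr_eq0.
  by move/eqP.
have e1 : enorm e = 1 by rewrite enormZ ger0_norm ?invr_ge0 ?ltW// mulVf// lt0r_neq0.
have dn0 : d != 0 by rewrite lt0r_neq0.
have ex : x = m + (d / 2) *: e by apply/rowP => i; rewrite !mxE; field.
have ey : y = m + (- (d / 2)) *: e by apply/rowP => i; rewrite !mxE; field.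
have d1 t : is_derive t (1 : R) (fun s : R => f (m + s *: e)) ('D_e f (m + t *: e)).
  by apply: is_derive_line; exact: (df [::]).
have d2 t : is_derive t (1 : R) (fun s : R => 'D_e f (m + s *: e)) ('D_e ('D_e f) (m + t *: e)).
  by apply: is_derive_line; exact: (df [:: e]).
have := @second_derivative_midpoint (fun s : R => f (m + s *: e)) _ _ (d / 2) c _ d1 d2 _.
rewrite -ex -ey scale0r addr0 -[dotp _ _]enorm_sqr -/d -/m => H.
have : 2 * f m + c * (d / 2) ^+ 2 <= f x + f y.
  apply: H; first by rewrite divr_ge0// ltW.
  move=> t tI; have := fc e (m + t *: e) e1.
  have -> : derive1n 2 (fun s : R => f (m + t *: e + s *: e)) 0 = 'D_e ('D_e f) (m + t *: e).
    rewrite derive1nS derive1n1.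
    have -> : derive1 (fun s : R => f (m + t *: e + s *: e)) = (fun s : R => 'D_e f (m + t *: e + s *: e)).
      by apply/funext => s; rewrite derive1E derive_line.
    by rewrite derive1E (derive_line (fun z => 'D_e f z) (m + t *: e) e 0) scale0r addr0.
  apply.
  (* The base point [m + t *: e] lies on the segment from [y] to [x], hence in the ball of radius
     [r]; moving it along the segment turns a bound at parameter 0 into a bound for every t. *)
  have -> : m + t *: e = ((t + d / 2) / d) *: x + (1 - (t + d / 2) / d) *: y.
    by apply/rowP => i; rewrite !mxE; field.
  apply: (le_trans (enormD _ _)); rewrite !enormZ.
  move: tI => /andP[t1 t2].
  have q0 : 0 <= (t + d / 2) / d by apply: divr_ge0; lra.
  have q1 : (t + d / 2) / d <= 1 by rewrite ler_pdivrMr//; lra.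
  have q1' : 0 <= 1 - (t + d / 2) / d by rewrite subr_ge0.
  rewrite (ger0_norm q0) (ger0_norm q1').
  have := ler_wpM2l q0 xr; have := ler_wpM2l q1' yr; set q := _ / d; lra.
set a := f m; set b := f x; set b' := f y; nra.
Qed.

End calculus.

(** * Gibbs averages *)

Section gibbs.
Context {R : realType} (n : nat) (G : set 'rV[R]_n) (f : 'rV[R]_n -> R) (a b : R).
Hypotheses (mG : measurable G) (cf : continuous f) (a0 : 0 < a) (b0 : 0 <= b).
Hypothesis growth : forall J, G J -> a * dotp J J - b <= f J.

Let mf : measurable_fun setT f.
Proof. exact: continuous_measurable_mx. Qed.

Lemma gauss_integrable (k : R) : 0 < k ->
  (lebn n).-integrable setT (fun J : 'rV[R]_n => (expR (- (k * dotp J J)))%:E).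
Proof.
move=> k0; have mg : measurable_fun setT (fun J : 'rV[R]_n => (expR (- (k * dotp J J)))%:E).
  apply/measurable_EFinP; apply: measurableT_comp => //; apply: continuous_measurable_mx.
  under eq_fun do rewrite -mulNr.
  by apply: continuous_mul; [exact: continuous_constant|exact: dotp_self_continuous].
apply/integrableP; split => //.
under eq_integral do rewrite gee0_abs ?lee_fin ?expR_ge0//.
by rewrite gauss_lebn// ltry.
Qed.

Lemma gauss_dominated_integrable (A : set 'rV[R]_n) (F : 'rV[R]_n -> R) (k K : R) : measurable A ->
  measurable_fun setT F -> 0 < k -> (forall J, A J -> `|F J| <= K * expR (- (k * dotp J J))) ->
  (lebn n).-integrable A (fun J => (F J)%:E).
Proof.
move=> mA mF k0 FK.
have ig : (lebn n).-integrable A (fun J => (K * expR (- (k * dotp J J)))%:E).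
  under eq_fun do rewrite EFinM; apply: integrableZl => //.
  by apply: (@integrableS _ _ _ _ setT) => //; exact: gauss_integrable.
apply: (le_integrable mA _ _ ig).
  by apply/measurable_EFinP; exact: measurable_funTS.
move=> J AJ; rewrite !abse_EFin lee_fin; apply: le_trans (FK _ AJ) _; exact: ler_norm.
Qed.

Lemma integrable_scale (A : set 'rV[R]_n) (k : R) (F : 'rV[R]_n -> R) : measurable A ->
  (lebn n).-integrable A (fun J => (F J)%:E) -> (lebn n).-integrable A (fun J => (k * F J)%:E).
Proof. by move=> mA iF; under eq_fun do rewrite EFinM; exact: integrableZl. Qed.

Lemma young_sq (k c t : R) : 0 < k -> c * t <= k * t ^+ 2 + c ^+ 2 / (4 * k).
Proof.
move=> k0; have kn : k != 0 by rewrite lt0r_neq0.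
rewrite -subr_ge0 (_ : _ - _ = k * (t - c / (2 * k)) ^+ 2); last by field.
by rewrite mulr_ge0 ?sqr_ge0// ltW.
Qed.

(** The allowance [f J / 2] makes room for [f] itself as an integrand. The other half of [f] leaves
    a Gaussian with coefficient a / 2, of which a / 4 absorbs the linear exponent and a / 4 remains
    integrable. *)
Lemma gibbs_integrable (F : 'rV[R]_n -> R) (K c : R) : measurable_fun setT F -> 0 <= c ->
  (forall J, G J -> `|F J| <= K * expR (c * enorm J + f J / 2)) ->
  (lebn n).-integrable G (fun J => (F J * expR (- f J))%:E).
Proof.
move=> mF c0 FK; have a4 : 0 < a / 4 by rewrite divr_gt0.
apply: (@gauss_dominated_integrable _ _ (a / 4) (K * expR (b / 2 + c ^+ 2 / a))) => //.
  by apply: measurable_funM => //; apply: measurableT_comp => //; exact: measurableT_comp.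
move=> J GJ; rewrite normrM [`|expR _|]ger0_norm ?expR_ge0//.
apply: (le_trans (ler_wpM2r (expR_ge0 _) (FK _ GJ))).
have K0 : 0 <= K.
  by have := le_trans (normr_ge0 _) (FK _ GJ); rewrite pmulr_lge0// expR_gt0.
rewrite -!mulrA -!expRD ler_wpM2l// ler_expR.
have := growth GJ; have := young_sq c (enorm J) a4; rewrite enorm_sqr (_ : 4 * (a / 4) = a); last by field.
lra.
Qed.

Lemma gibbs_exp_integrable (F : 'rV[R]_n -> R) (K c : R) : measurable_fun setT F -> 0 <= c ->
  (forall J, G J -> `|F J| <= K * expR (c * enorm J)) ->
  (lebn n).-integrable G (fun J => (F J * expR (- f J))%:E).
Proof.
move=> mF c0 FK; apply: (@gibbs_integrable _ (K * expR (b / 2)) c) => // J GJ.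
apply: le_trans (FK _ GJ) _.
have K0 : 0 <= K.
  by have := le_trans (normr_ge0 _) (FK _ GJ); rewrite pmulr_lge0// expR_gt0.
rewrite -mulrA ler_wpM2l// -expRD ler_expR.
have := growth GJ; have := mulr_ge0 (ltW a0) (dotp_ge0 J); lra.
Qed.

Lemma boltzmann_integrable : (lebn n).-integrable G (fun J => (expR (- f J))%:E).
Proof.
have := @gibbs_exp_integrable (cst 1) 1 0 (measurable_cst _) (lexx _).
under [X in _.-integrable _ X]eq_fun do rewrite mul1r.
by apply=> J _; rewrite mul0r expR0 normr1 mulr1.
Qed.

Lemma energy_integrable : (lebn n).-integrable G (fun J => (f J * expR (- f J))%:E).
Proof.
(* The term 2 serves f >= 0, where f <= 2 exp(f / 2); the other term serves -b <= f < 0, where exp(f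
   / 2) >= exp(- b / 2). *)
apply: (@gibbs_integrable _ (2 + b * expR (b / 2)) 0) => // J GJ.
rewrite mul0r add0r; have := growth GJ; have := mulr_ge0 (ltW a0) (dotp_ge0 J) => h1 h2.
have e1 := expR_ge1Dx (f J / 2); have e0 := expR_gt0 (f J / 2).
have [f0|f0] := leP 0 (f J).
  rewrite ger0_norm// mulrDl; have : 0 <= b * expR (b / 2) * expR (f J / 2) by rewrite !mulr_ge0// expR_ge0.
  by lra.
rewrite ltr0_norm// mulrDl -mulrA -expRD.
have : b <= b * expR (b / 2 + f J / 2).
  rewrite -[leLHS]mulr1 ler_wpM2l// -[leLHS]expR0 ler_expR; lra.
by lra.
Qed.

(** The two terms of [gint] are the integrals of the positive and the negative part; integrability
    makes both finite, so [fine] loses nothing. *)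
Lemma gintE (F : 'rV[R]_n -> R) : measurable_fun setT F ->
  (lebn n).-integrable G (fun J => (F J)%:E) -> gint G F = \int[lebn n]_(J in G) F J.
Proof.
move=> mF iF.
have mG1 : measurable_fun setT (fun J => \1_G J * F J) by apply: measurable_funM => //; exact: measurable_indic.
have m1 : measurable_fun setT (fun J => (Num.max (\1_G J * F J) 0)%:E).
  by apply/measurable_EFinP; apply: measurable_maxr => //; exact: measurable_cst.
have m2 : measurable_fun setT (fun J => (Num.max (- (\1_G J * F J)) 0)%:E).
  apply/measurable_EFinP; apply: measurable_maxr; last exact: measurable_cst.
  exact: measurableT_comp.
rewrite /gint !iint_lebn//; [|by move=> J; rewrite lee_fin le_max lexx orbT..].
have E1 : (\int[lebn n]_J (Num.max (\1_G J * F J) 0)%:E = \int[lebn n]_(J in G) ((fun J => (F J)%:E)^\+ J))%E.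
  rewrite [RHS]integral_mkcond; apply: eq_integral => J _; rewrite patchE indicE funeposE.
  by case: ifP => _; rewrite ?mul1r ?mul0r ?maxxx// EFin_max.
have E2 : (\int[lebn n]_J (Num.max (- (\1_G J * F J)) 0)%:E = \int[lebn n]_(J in G) ((fun J => (F J)%:E)^\- J))%E.
  rewrite [RHS]integral_mkcond; apply: eq_integral => J _; rewrite patchE indicE funenegE.
  by case: ifP => _; rewrite ?mul1r ?mul0r ?oppr0 ?maxxx// EFin_max.
have p1 := integrable_pos_fin_num mG iF; have p2 := integrable_neg_fin_num mG iF.
by rewrite E1 E2 /Rintegral [in RHS]integralE [RHS](fineB p1 p2).
Qed.

Lemma EFin_Rint (A : set 'rV[R]_n) (F : 'rV[R]_n -> R) : measurable A ->
  (lebn n).-integrable A (fun J => (F J)%:E) ->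
  ((\int[lebn n]_(J in A) F J)%:E = \int[lebn n]_(J in A) (F J)%:E)%E.
Proof. by move=> mA iF; rewrite /Rintegral fineK// integrable_fin_num. Qed.

(** The form in which the inequality is applied: zero exponents give the log-concavity of volumes,
    opposite linear tilts of - f give the moment bound. *)
Lemma prekopa_leindler_exp (A B C : set 'rV[R]_n) (u v w : 'rV[R]_n -> R) :
  measurable A -> measurable B -> measurable C ->
  measurable_fun setT u -> measurable_fun setT v -> measurable_fun setT w ->
  (forall x y, A x -> B y -> C (2^-1 *: (x + y)) /\ u x + v y <= 2 * w (2^-1 *: (x + y))) ->
  ((\int[lebn n]_(J in A) (expR (u J))%:E) * (\int[lebn n]_(J in B) (expR (v J))%:E) <=
   (\int[lebn n]_(J in C) (expR (w J))%:E) * (\int[lebn n]_(J in C) (expR (w J))%:E))%E.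
Proof.
move=> mA mB mC mu mv mw H.
have M (D : set 'rV[R]_n) (z : 'rV[R]_n -> R) : measurable D -> measurable_fun setT z ->
    measurable_fun setT ((fun J => (expR (z J))%:E) \_ D).
  move=> mD mz; apply/(measurable_restrictT _ _).1 => //; apply/measurable_EFinP.
  by apply: measurable_funTS; exact: measurableT_comp.
have P (D : set 'rV[R]_n) (z : 'rV[R]_n -> R) x : (0 <= ((fun J => (expR (z J))%:E) \_ D) x)%E.
  by rewrite patchE; case: ifP => _ //; rewrite lee_fin expR_ge0.
rewrite (integral_mkcond A) (integral_mkcond B) (integral_mkcond C).
apply: prekopa_leindler; try exact: M; try exact: P.
move=> x y; rewrite patchE; case: ifPn => [/set_mem Ax|_]; last by rewrite mul0e mule_ge0.
rewrite patchE; case: ifPn => [/set_mem By|_]; last by rewrite mule0 mule_ge0.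
have [Cxy uvw] := H x y Ax By.
by rewrite patchE mem_set// -!EFinM lee_fin -!expRD ler_expR; lra.
Qed.


Notation Z := (\int[lebn n]_(J in G) expR (- f J)).

(** Not divided by [Z], so that linearity and comparison are those of the integral. *)
Definition gibbs (F : 'rV[R]_n -> R) := \int[lebn n]_(J in G) (F J * expR (- f J)).

Lemma gibbsD (F F' : 'rV[R]_n -> R) :
  (lebn n).-integrable G (fun J => (F J * expR (- f J))%:E) ->
  (lebn n).-integrable G (fun J => (F' J * expR (- f J))%:E) ->
  gibbs (fun J => F J + F' J) = gibbs F + gibbs F'.
Proof.
move=> iF iF'; rewrite /gibbs -RintegralD//.
by apply: eq_Rintegral => J _; rewrite mulrDl.
Qed.

Lemma gibbsZ (k : R) (F : 'rV[R]_n -> R) :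
  (lebn n).-integrable G (fun J => (F J * expR (- f J))%:E) ->
  gibbs (fun J => k * F J) = k * gibbs F.
Proof.
move=> iF; rewrite /gibbs -RintegralZl//.
by apply: eq_Rintegral => J _; rewrite mulrA.
Qed.

Lemma gibbs1 (k : R) : gibbs (fun=> k) = k * Z.
Proof. by rewrite /gibbs RintegralZl//; exact: boltzmann_integrable. Qed.

Lemma gibbs_le (F F' : 'rV[R]_n -> R) :
  (lebn n).-integrable G (fun J => (F J * expR (- f J))%:E) ->
  (lebn n).-integrable G (fun J => (F' J * expR (- f J))%:E) ->
  (forall J, G J -> F J <= F' J) -> gibbs F <= gibbs F'.
Proof.
move=> iF iF' FF'; apply: le_Rintegral => // J GJ.
by rewrite ler_wpM2r ?expR_ge0// FF'.
Qed.

Lemma partition_gt0 : open G -> G !=set0 -> 0 < Z.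
Proof.
move=> oG [x Gx].
have [r r0 rG] : exists2 r, 0 < r & eball x r `<=` G by apply/nbhs_eball; exact: open_nbhs_nbhs.
have cB : compact (eball x r).
  apply: (@bounded_closed_compact_enorm _ _ _ (r + enorm x)); first exact: closed_eball.
  by move=> y yr; rewrite -(subrK x y); apply: (le_trans (enormD _ _)); rewrite lerD2r.
have [y By ymax] : exists2 y, y \in eball x r & forall t, t \in eball x r -> f t <= f y.
  apply: EVT_max_rV => //; last exact: continuous_subspaceT.
  by exists x; rewrite /eball/= subrr enorm0 ltW.
have mB := measurable_eball x r.
have me (A : set 'rV[R]_n) : measurable_fun A (fun J => (expR (- f J))%:E).
  by apply/measurable_EFinP; apply: measurable_funTS; apply: measurableT_comp => //; exact: measurableT_comp.
rewrite -lte_fin EFin_Rint//; last exact: boltzmann_integrable.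
apply: (@lt_le_trans _ _ (\int[lebn n]_(J in eball x r) (expR (- f y))%:E)%E).
  rewrite integral_cst//; apply: mule_gt0; first by rewrite lte_fin expR_gt0.
  suff : (0 < lebn n (eball x r))%E by [].
  rewrite lebn_eball// lte_fin; apply: mulr_gt0; [exact: ball_vol_gt0|exact: exprn_gt0].
apply: (@le_trans _ _ (\int[lebn n]_(J in eball x r) (expR (- f J))%:E)%E).
  apply: ge0_le_integral => //.
  - by move=> J BJ; rewrite lee_fin ler_expR lerN2; apply: ymax; rewrite inE.
by apply: ge0_subset_integral => // J _; rewrite lee_fin expR_ge0.
Qed.

Lemma pow_le_fact_expR (y : R) (p : nat) : `|y| ^+ p <= p`!%:R * expR `|y|.
Proof.
case: p => [|p]; first by rewrite expr0 fact0 mul1r -[leLHS]expR0 ler_expR.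
have := @expR_ge1Dxn R `|y| p (normr_ge0 y).
rewrite -lerBrDl ler_pdivrMr ?ltr0n ?fact_gt0// mulrC => h; apply: (le_trans h).
by rewrite ler_wpM2l// gerBl.
Qed.

Lemma pow_le_fact_cosh (y : R) (p : nat) : y ^+ p <= p`!%:R * (expR y + expR (- y)).
Proof.
apply: (le_trans (ler_norm _)); rewrite normrX; apply: (le_trans (pow_le_fact_expR y p)).
rewrite ler_wpM2l//; have := expR_ge0 y; have := expR_ge0 (- y).
by case: (ger0P y) => _; lra.
Qed.

Lemma dotp_le_enorm (J e : 'rV[R]_n) : enorm e = 1 -> `|dotp J e| <= enorm J.
Proof.
move=> e1; rewrite ler_norml; apply/andP; split.
  by rewrite lerNl -dotpNl; have := cauchy_schwarz (- J) e; rewrite e1 mulr1 enormN.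
by have := cauchy_schwarz J e; rewrite e1 mulr1.
Qed.

Lemma measurable_dotp (e : 'rV[R]_n) : measurable_fun setT (fun J : 'rV[R]_n => dotp J e).
Proof. by apply: continuous_measurable_mx; exact: dotp_continuous. Qed.

Lemma linear_integrable (e : 'rV[R]_n) : enorm e = 1 ->
  (lebn n).-integrable G (fun J => (dotp J e * expR (- f J))%:E).
Proof.
move=> e1; apply: (@gibbs_exp_integrable _ 1 1) => //; first exact: measurable_dotp.
move=> J _; rewrite !mul1r; apply: (le_trans (dotp_le_enorm J e1)).
by apply: le_trans (expR_ge1Dx _); rewrite lerDr.
Qed.

Lemma exp_linear_integrable (e : 'rV[R]_n) (s m : R) : enorm e = 1 -> `|s| <= 1 ->
  (lebn n).-integrable G (fun J => (expR (s * (dotp J e - m)) * expR (- f J))%:E).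
Proof.
move=> e1 s1; apply: (@gibbs_exp_integrable _ (expR `|m|) 1) => //.
  apply: measurableT_comp => //; apply: measurable_funM => //.
  by apply: measurable_funB => //; exact: measurable_dotp.
move=> J _; rewrite mul1r ger0_norm ?expR_ge0// -expRD ler_expR.
apply: (le_trans (ler_norm _)); rewrite normrM.
apply: (le_trans (ler_piMl (normr_ge0 _) s1)).
by apply: (le_trans (ler_normB _ _)); rewrite addrC lerD2l dotp_le_enorm.
Qed.

Lemma power_integrable (e : 'rV[R]_n) (m : R) (p : nat) : enorm e = 1 ->
  (lebn n).-integrable G (fun J => ((dotp J e - m) ^+ p * expR (- f J))%:E).
Proof.
move=> e1; apply: (@gibbs_exp_integrable _ (p`!%:R * expR `|m|) 1) => //.
  by apply: measurable_funX; apply: measurable_funB => //; exact: measurable_dotp.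
move=> J _; rewrite mul1r normrX; apply: (le_trans (pow_le_fact_expR _ p)).
rewrite -mulrA ler_wpM2l// -expRD ler_expR.
by apply: (le_trans (ler_normB _ _)); rewrite addrC lerD2l dotp_le_enorm.
Qed.

(** After centring, the linear term has mean zero, so by Jensen each of the two exponential
    integrals is at least [Z]. A bound on their product therefore bounds each of them, and y^p <= p!
    (exp y + exp(- y)). *)
Lemma gibbs_moment_le (e : 'rV[R]_n) (p : nat) (C : R) : enorm e = 1 -> 0 < Z ->
  gibbs (fun J => expR (dotp J e)) * gibbs (fun J => expR (- dotp J e)) <= C * Z ^+ 2 ->
  forall m, m = Z^-1 * gibbs (fun J => dotp J e) ->
  Z^-1 * gibbs (fun J => (dotp J e - m) ^+ p) <= p`!%:R * (2 * C).
Proof.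
move=> e1 Z0 HC m mE; have Zn : Z != 0 by rewrite lt0r_neq0.
pose P := gibbs (fun J => expR (1 * (dotp J e - m))).
pose Q := gibbs (fun J => expR (-1 * (dotp J e - m))).
have iP := @exp_linear_integrable e 1 m e1 _; have iQ := @exp_linear_integrable e (-1) m e1 _.
have {}iP := iP ltac:(by rewrite normr1); have {}iQ := iQ ltac:(by rewrite normrN1).
have PQ : P * Q <= C * Z ^+ 2.
  have -> : P = expR (- m) * gibbs (fun J => expR (dotp J e)).
    rewrite -gibbsZ; first by apply: eq_Rintegral => J _; rewrite mul1r expRD [expR _ * expR (- m)]mulrC.
    by have := @exp_linear_integrable e 1 0 e1 ltac:(by rewrite normr1); under eq_fun do rewrite mul1r subr0.
  have -> : Q = expR m * gibbs (fun J => expR (- dotp J e)).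
    rewrite -gibbsZ; first by apply: eq_Rintegral => J _; rewrite mulN1r opprB expRD.
    by have := @exp_linear_integrable e (-1) 0 e1 ltac:(by rewrite normrN1); under eq_fun do rewrite mulN1r subr0.
  by rewrite mulrACA -expRD addNr expR0 mul1r.
(* Jensen in the form exp x >= 1 + x, whose right-hand side integrates to [Z] by the choice of
   [m]. *)
have jensen (s : R) : `|s| <= 1 -> Z <= gibbs (fun J => expR (s * (dotp J e - m))).
  move=> s1.
  have iC : (lebn n).-integrable G (fun J => ((1 - s * m) * expR (- f J))%:E).
    by under eq_fun do rewrite EFinM; apply: integrableZl => //; exact: boltzmann_integrable.
  have iL : (lebn n).-integrable G (fun J => ((s * dotp J e) * expR (- f J))%:E).
    by under eq_fun do rewrite -mulrA EFinM; apply: integrableZl => //; exact: linear_integrable.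
  have <- : gibbs (fun J => (1 - s * m) + s * dotp J e) = Z.
    rewrite gibbsD// gibbs1 gibbsZ; last exact: linear_integrable.
    by rewrite mE; set X := gibbs _; field.
  apply: gibbs_le => //.
  - by under eq_fun do rewrite mulrDl EFinD; exact: integrableD.
  - exact: exp_linear_integrable.
  - move=> J _; apply: le_trans (expR_ge1Dx _).
    by rewrite mulrBr [leRHS]addrCA [leLHS]addrC.
have P1 : Z <= P by apply: jensen; rewrite normr1.
have Q1 : Z <= Q by apply: jensen; rewrite normrN1.
have PC : P <= C * Z.
  rewrite -(ler_pM2r Z0) -mulrA -expr2; apply: le_trans PQ.
  by apply: ler_wpM2l Q1; exact: le_trans (ltW Z0) P1.
have QC : Q <= C * Z.
  rewrite -(ler_pM2r Z0) -mulrA -expr2; apply: le_trans PQ; rewrite mulrC.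
  by apply: ler_wpM2r P1; exact: le_trans (ltW Z0) Q1.
rewrite ler_pdivrMl//; apply: (@le_trans _ _ (p`!%:R * (P + Q))); last first.
  rewrite mulrCA; apply: ler_wpM2l => //; rewrite (_ : Z * (2 * C) = C * Z + C * Z); last by ring.
  exact: lerD.
have iPQ : (lebn n).-integrable G (fun J => ((expR (1 * (dotp J e - m)) + expR (-1 * (dotp J e - m))) * expR (- f J))%:E).
  by under eq_fun do rewrite mulrDl EFinD; exact: integrableD.
rewrite -gibbsD// -gibbsZ//; apply: gibbs_le.
- exact: power_integrable.
- by under eq_fun do rewrite -mulrA EFinM; apply: integrableZl.
- by move=> J _; rewrite mul1r mulN1r; exact: pow_le_fact_cosh.
Qed.

(** The coefficient a of |J|^2 is shared out: a / 2 absorbs the linear term at the cost 1 / (2 a), a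
    / 4 is bounded below by its value at |J| = r, and a / 4 is integrated as a Gaussian over the
    whole space. *)
Lemma gibbs_exp_tail_le (r s : R) (e : 'rV[R]_n) : enorm e = 1 -> `|s| <= 1 -> 0 <= r ->
  (forall J, G J -> r < enorm J -> a * dotp J J <= f J) ->
  \int[lebn n]_(J in G `\` eball 0 r) (expR (s * dotp J e) * expR (- f J)) <=
  expR ((2 * a)^-1 - a / 4 * r ^+ 2) * Num.sqrt (pi / (a / 4)) ^+ n.
Proof.
move=> e1 s1 r0 far; have a4 : 0 < a / 4 by rewrite divr_gt0.
have mT : measurable (G `\` eball 0 r) by apply: measurableD => //; exact: measurable_eball.
have iT : (lebn n).-integrable (G `\` eball 0 r) (fun J => (expR (s * dotp J e) * expR (- f J))%:E).
  apply: (@integrableS _ _ _ _ G) => //.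
  by have := exp_linear_integrable 0 e1 s1; under eq_fun do rewrite subr0.
rewrite -lee_fin EFin_Rint//.
pose K := expR ((2 * a)^-1 - a / 4 * r ^+ 2).
apply: (@le_trans _ _ (\int[lebn n]_(J in G `\` eball 0 r) (K * expR (- (a / 4 * dotp J J)))%:E)%E).
  have mg : measurable_fun setT (fun J : 'rV[R]_n => expR (- (a / 4 * dotp J J))).
    by have /integrableP[/measurable_EFinP] := gauss_integrable a4.
  apply: ge0_le_integral => //.
  - by have /integrableP[] := iT.
  - by apply/measurable_EFinP; apply: measurable_funTS; apply: measurable_funM.
  move=> J [GJ nB]; have rJ : r < enorm J.
    by rewrite ltNge; apply/negP => h; apply: nB; rewrite /eball/= subr0.
  rewrite lee_fin -!expRD ler_expR.
  have h1 : s * dotp J e <= enorm J.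
    apply: (le_trans (ler_norm _)); rewrite normrM; apply: (le_trans (ler_piMl (normr_ge0 _) s1)).
    exact: dotp_le_enorm.
  have h2 := far J GJ (rJ).
  have h3 : r ^+ 2 <= enorm J ^+ 2 by rewrite ler_sqr ?nnegrE ?enorm_ge0// ltW.
  have h4 := ler_wpM2l (ltW a4) h3.
  have a2 : 0 < a / 2 by rewrite divr_gt0.
  have := young_sq 1 (enorm J) a2; rewrite -enorm_sqr in h2 *; rewrite expr1n mul1r (_ : 4 * (a / 2) = 2 * a); last by field.
  rewrite div1r; move: h1 h2 h4; set t := enorm J ^+ 2; set q := r ^+ 2; set w := (2 * a)^-1; lra.
apply: (@le_trans _ _ (\int[lebn n]_J (K * expR (- (a / 4 * dotp J J)))%:E)%E).
  apply: ge0_subset_integral => //.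
    have /integrableP[/measurable_EFinP mg _] := gauss_integrable a4.
    by apply/measurable_EFinP; apply: measurable_funM.
  by move=> J _; rewrite lee_fin mulr_ge0 ?expR_ge0.
under eq_integral do rewrite EFinM.
rewrite ge0_integralZl//; last first.
- by rewrite lee_fin expR_ge0.
- by have /integrableP[] := gauss_integrable a4.
by rewrite gauss_lebn// -EFinM.
Qed.

Lemma Rintegral_le_subset (A B : set 'rV[R]_n) (F : 'rV[R]_n -> R) : measurable A -> measurable B ->
  A `<=` B -> (forall J, 0 <= F J) -> (lebn n).-integrable B (fun J => (F J)%:E) ->
  \int[lebn n]_(J in A) F J <= \int[lebn n]_(J in B) F J.
Proof.
move=> mA mB AB F0 iF; have iA := integrableS mB mA AB iF.
rewrite -lee_fin !EFin_Rint//; apply: ge0_subset_integral => //.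
- by have /integrableP[] := iF.
- by move=> J _; rewrite lee_fin.
Qed.

(** Split both integrals at the ball of radius [r]. Inside, the tilts contribute (x - y, e) to the
    exponent, at most c |x - y|^2 / 4 + 1 / c, and strong convexity at the midpoint pays for the
    quadratic term; what is left is the factor exp(1 / c). The three terms involving the outside are
    governed by [D]. *)
Lemma gibbs_exp_product_le (r c D : R) (e : 'rV[R]_n) : enorm e = 1 -> 0 <= r -> 0 < c -> Defs.convex_set G ->
  (forall J, G J -> r < enorm J -> a * dotp J J <= f J) ->
  (forall x y, enorm x <= r -> enorm y <= r ->
     f (2^-1 *: (x + y)) <= (f x + f y) / 2 - c / 8 * dotp (x - y) (x - y)) ->
  expR r * (expR ((2 * a)^-1 - a / 4 * r ^+ 2) * Num.sqrt (pi / (a / 4)) ^+ n) <= D * Z ->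
  gibbs (fun J => expR (dotp J e)) * gibbs (fun J => expR (- dotp J e)) <=
  (expR c^-1 + 2 * D + D ^+ 2) * Z ^+ 2.
Proof.
move=> e1 r0 c0 cG far sc; set tau := _ * _ ^+ n => HD.
have half (u v w : R) : u <= r -> v <= r -> w <= u + v -> 2^-1 * w <= r by move=> *; lra.
have key (X Y fx fy m t d w : R) : m <= (fx + fy) / 2 - c / 8 * t -> d <= c / 4 * t + w ->
    X - Y <= d -> 1 * X - fx + (-1 * Y - fy) <= 2 * (w / 2 - m) by move=> *; lra.
pose K := G `&` eball 0 r; pose T := G `\` eball 0 r.
have mB : measurable (eball (0 : 'rV[R]_n) r) by exact: measurable_eball.
have mK : measurable K by exact: measurableI.
have mT : measurable T by exact: measurableD.
have KG : K `<=` G by move=> x [].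
have iE (s : R) : `|s| <= 1 -> (lebn n).-integrable G (fun J => (expR (s * dotp J e) * expR (- f J))%:E).
  by move=> s1; have := exp_linear_integrable 0 e1 s1; under eq_fun do rewrite subr0.
have split_ (s : R) : `|s| <= 1 -> \int[lebn n]_(J in G) (expR (s * dotp J e) * expR (- f J)) =
    \int[lebn n]_(J in K) (expR (s * dotp J e) * expR (- f J)) + \int[lebn n]_(J in T) (expR (s * dotp J e) * expR (- f J)).
  move=> s1; have KT : K `|` T = G.
    by apply/seteqP; split => x; [case=> -[]|move=> Gx; case: (pselect (eball 0 r x)) => h; [left|right]].
  rewrite -[in LHS]KT Rintegral_setU// ?KT; first exact: iE.
  by apply/disj_setPS => x [[_ +] [_ h]].
have Kle (s : R) : `|s| <= 1 -> \int[lebn n]_(J in K) (expR (s * dotp J e) * expR (- f J)) <= expR r * Z.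
  move=> s1; apply: (@le_trans _ _ (\int[lebn n]_(J in K) (expR r * expR (- f J)))).
    apply: le_Rintegral => //.
    - by apply: (integrableS mG) => //; exact: iE.
    - by apply: integrable_scale => //; apply: (integrableS mG) => //; exact: boltzmann_integrable.
    move=> J [GJ]; rewrite /eball/= subr0 => Jr; rewrite ler_wpM2r ?expR_ge0// ler_expR.
    apply: le_trans Jr; apply: (le_trans (ler_norm _)); rewrite normrM.
    by apply: (le_trans (ler_piMl (normr_ge0 _) s1)); exact: dotp_le_enorm.
  rewrite RintegralZl//; last by apply: (integrableS mG) => //; exact: boltzmann_integrable.
  rewrite ler_wpM2l ?expR_ge0//; apply: Rintegral_le_subset => //.
  exact: boltzmann_integrable.
have PL : (\int[lebn n]_(J in K) (expR (1 * dotp J e) * expR (- f J))) *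
    (\int[lebn n]_(J in K) (expR (-1 * dotp J e) * expR (- f J))) <= expR c^-1 * Z ^+ 2.
  have := @prekopa_leindler_exp K K K (fun J => 1 * dotp J e - f J) (fun J => -1 * dotp J e - f J)
    (fun J => (2 * c)^-1 - f J) mK mK mK.
  have mL (s : R) : measurable_fun setT (fun J => s * dotp J e - f J).
    by apply: measurable_funB => //; apply: measurable_funM => //; exact: measurable_dotp.
  move=> /(_ (mL 1) (mL (-1)) (measurable_funB (measurable_cst _) mf)) H.
  have {}H := H _.
  have eE (s : R) : `|s| <= 1 -> (\int[lebn n]_(J in K) (expR (s * dotp J e - f J))%:E =
      (\int[lebn n]_(J in K) (expR (s * dotp J e) * expR (- f J)))%:E)%E.
    move=> s1; rewrite EFin_Rint//; last by apply: (integrableS mG) => //; exact: iE.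
    by apply: eq_integral => J _; rewrite expRD.
  rewrite eE ?normr1// eE ?normrN1// in H.
  have E3 : (\int[lebn n]_(J in K) (expR ((2 * c)^-1 - f J))%:E =
      (expR (2 * c)^-1 * \int[lebn n]_(J in K) expR (- f J))%:E)%E.
    have ik := integrableS mG mK KG boltzmann_integrable.
    rewrite -RintegralZl// EFin_Rint//; first by apply: eq_integral => J _; rewrite expRD.
    by under eq_fun do rewrite EFinM; apply: integrableZl.
  rewrite E3 -!EFinM lee_fin in H.
  apply: (le_trans (H _)) => [x y [Gx xr] [Gy yr]|].
    rewrite /eball/= !subr0 in xr yr.
    have hm : 2^-1 *: (x + y) = 2^-1 *: x + (1 - 2^-1) *: y.
      by apply/rowP => i; rewrite !mxE; field.
    split.
      split; first by rewrite hm; apply: cG => //; rewrite invr_ge0 ler0n/= invf_le1// ler1n.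
      rewrite /eball/= subr0 enormZ gtr0_norm ?invr_gt0//; exact: half (enormD x y).
    have h1 := sc x y xr yr; have h2 := dotp_le_enorm (x - y) e1.
    rewrite -enorm_sqr in h1; rewrite ler_norml dotpDl dotpNl in h2; case/andP: h2 => h2 h3.
    have c4 : 0 < c / 4 by rewrite divr_gt0.
    have := young_sq 1 (enorm (x - y)) c4; rewrite expr1n mul1r (_ : 4 * (c / 4) = c); last by field.
    have -> : (2 * c)^-1 = c^-1 / 2 by rewrite invfM mulrC.
    by rewrite div1r => h4; exact: key h1 h4 h3.
  rewrite mulrACA -expRD (_ : (2 * c)^-1 + (2 * c)^-1 = c^-1); last by have := lt0r_neq0 c0 => cn; field.
  rewrite ler_wpM2l ?expR_ge0// -expr2 lerXn2r ?nnegrE//.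
  - by apply: Rintegral_ge0 => J _; exact: expR_ge0.
  - by apply: Rintegral_ge0 => J _; exact: expR_ge0.
  - by apply: Rintegral_le_subset => //; exact: boltzmann_integrable.
have G1 : gibbs (fun J => expR (dotp J e)) = \int[lebn n]_(J in G) (expR (1 * dotp J e) * expR (- f J)).
  by apply: eq_Rintegral => J _; rewrite mul1r.
have G2 : gibbs (fun J => expR (- dotp J e)) = \int[lebn n]_(J in G) (expR (-1 * dotp J e) * expR (- f J)).
  by apply: eq_Rintegral => J _; rewrite mulN1r.
have n1 : `|1 : R| <= 1 by rewrite normr1.
have nN1 : `|-1 : R| <= 1 by rewrite normrN1.
rewrite G1 G2 (split_ 1 n1) (split_ (-1) nN1).
have tP : \int[lebn n]_(J in T) (expR (1 * dotp J e) * expR (- f J)) <= tau by exact: gibbs_exp_tail_le.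
have tM : \int[lebn n]_(J in T) (expR (-1 * dotp J e) * expR (- f J)) <= tau by exact: gibbs_exp_tail_le.
have p0 (s : R) (A : set 'rV[R]_n) : 0 <= \int[lebn n]_(J in A) (expR (s * dotp J e) * expR (- f J)).
  by apply: Rintegral_ge0 => J _; rewrite mulr_ge0 ?expR_ge0.
have tau0 : 0 <= tau by rewrite mulr_ge0 ?expR_ge0// exprn_ge0// sqrtr_ge0.
have er : 1 <= expR r by rewrite -[leLHS]expR0 ler_expR.
have tD : tau <= D * Z by apply: le_trans HD; rewrite ler_peMl.
have := p0 1 K; have := p0 1 T; have := p0 (-1) K; have := p0 (-1) T.
move: PL tP tM (Kle _ n1) (Kle _ nN1) HD.
move: (\int[lebn n]_(J in K) _) (\int[lebn n]_(J in K) _) (\int[lebn n]_(J in T) _) (\int[lebn n]_(J in T) _) => aP aM sP sM.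
move=> PL tP tM KP KM HD hM hk hP hK.
have Z0 : 0 <= Z by apply: Rintegral_ge0 => J _; exact: expR_ge0.
(* In the mixed terms the inner integral is bounded only by exp(r) Z; this is why the tail is
   required to be small even after multiplication by [expR r]. *)
have h1 : aP * sM <= D * Z * Z.
  apply: (@le_trans _ _ (expR r * Z * tau)); first exact: ler_pM.
  by rewrite mulrAC ler_wpM2r.
have h2 : aM * sP <= D * Z * Z.
  apply: (@le_trans _ _ (expR r * Z * tau)); first exact: ler_pM.
  by rewrite mulrAC ler_wpM2r.
have h3 : sP * sM <= (D * Z) * (D * Z).
  by apply: ler_pM; first [exact: hP|exact: hM|exact: le_trans tM tD|exact: le_trans tP tD].
apply: le_trans (le_trans (lerD PL (lerD h1 (lerD h2 h3))) _).
  by rewrite le_eqVlt; apply/orP; left; apply/eqP; ring.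
by rewrite le_eqVlt; apply/orP; left; apply/eqP; ring.
Qed.

End gibbs.

(** * Volumes of sublevel sets *)

Section levels.
Context {R : realType} (n : nat) (G : set 'rV[R]_n) (f : 'rV[R]_n -> R) (a b : R).
Hypotheses (oG : open G) (cG : Defs.convex_set G) (cf : continuous f) (vf : convex_fun f).
Hypotheses (a0 : 0 < a) (b0 : 0 <= b).
Hypothesis growth : forall J, G J -> a * dotp J J - b <= f J.

Let mG : measurable G. Proof. exact: open_measurable_mx. Qed.

Let mf : measurable_fun setT f. Proof. exact: continuous_measurable_mx. Qed.

Definition level (v : R) : set 'rV[R]_n := G `&` [set J | f J <= v].

Definition lvol (v : R) : R := fine (lebn n (level v)).

Lemma measurable_le_set (v : R) : measurable [set J | f J <= v].
Proof.
rewrite (_ : [set J | _] = f @^-1` [set` `]-oo, v]]).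
  by rewrite -[X in measurable X]setTI; apply: mf.
by apply/seteqP; split => x /=; rewrite in_itv.
Qed.

Lemma measurable_level v : measurable (level v).
Proof. by apply: measurableI => //; exact: measurable_le_set. Qed.

Lemma level_bounded v J : level v J -> enorm J <= (v + b) / a + 1.
Proof.
move=> [GJ /= fv]; have := growth GJ; rewrite -enorm_sqr => h.
have a1 : enorm J ^+ 2 <= (v + b) / a by rewrite ler_pdivlMr//; lra.
by have := enorm_ge0 J; nra.
Qed.

Lemma bounded_measure_fin (A : set 'rV[R]_n) (r : R) : measurable A -> (forall J, A J -> enorm J <= r) ->
  lebn n A \is a fin_num.
Proof.
move=> mA Ar; rewrite ge0_fin_numE//.
apply: (@le_lt_trans _ _ (lebn n (eball 0 (Num.max r 1)))); last by rewrite lebn_eball ?ltry// lt_max ltr01 orbT.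
apply: lebn_le => //; first exact: measurable_eball.
by move=> J /Ar h; rewrite /eball/= subr0 le_max h.
Qed.

Lemma lvolE v : (lvol v)%:E = lebn n (level v).
Proof.
rewrite /lvol fineK//; apply: bounded_measure_fin (@level_bounded v).
exact: measurable_level.
Qed.

Lemma lvol_ge0 v : 0 <= lvol v.
Proof. by rewrite -lee_fin lvolE. Qed.

Lemma lvol_le v w : v <= w -> lvol v <= lvol w.
Proof.
move=> vw; rewrite -lee_fin !lvolE; apply: lebn_le; try exact: measurable_level.
by move=> J [GJ /= h]; split => //=; exact: le_trans vw.
Qed.

(** By convexity, the homothety with centre [J0] and ratio [t] maps the level [w] into the level
    [v], and it multiplies volume by t^n. With t = 1 - O(1/n) it shows that volumes change by
    bounded factors over energy differences of order 1/n times the height above [J0]. *)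
Lemma lvol_scale J0 (t v w : R) : G J0 -> 0 < t -> t <= 1 -> f J0 + t * (w - f J0) <= v ->
  t ^+ n * lvol w <= lvol v.
Proof.
move=> GJ0 t0 t1 H; rewrite -lee_fin EFinM !lvolE.
rewrite [leRHS](lebn_affine_set ((1 - t) *: J0) t0); last exact: measurable_level.
rewrite lee_pmul2l ?lte_fin ?exprn_gt0//; apply: lebn_le; first exact: measurable_level.
  have : measurable_fun setT (fun v : 'rV[R]_n => t *: v + (1 - t) *: J0).
    by apply: continuous_mx_measurable_mx; exact: (@continuous_affine R 'rV[R]_n).
  by move=> /(_ measurableT _ (measurable_level v)); rewrite setTI.
move=> J [GJ /= fJ]; have t01 : 0 <= t <= 1 by rewrite ltW.
split; first exact: cG.
have := vf J J0 t01; move=> h /=; have := ler_wpM2l (ltW t0) fJ; lra.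
Qed.

(** The midpoint form suffices, since volumes are only compared along grids of step 1. *)
Lemma lvol_logconcave v w : lvol v * lvol w <= lvol ((v + w) / 2) ^+ 2.
Proof.
have := @prekopa_leindler_exp R n (level v) (level w) (level ((v + w) / 2)) (cst 0) (cst 0) (cst 0)
  (measurable_level _) (measurable_level _) (measurable_level _)
  (measurable_cst _) (measurable_cst _) (measurable_cst _).
have E u : (\int[lebn n]_(J in level u) (expR (@cst 'rV[R]_n R 0 J))%:E)%E = (lvol u)%:E.
  by rewrite /= expR0 integral_cst ?mul1e ?lvolE//; exact: measurable_level.
rewrite !E -!EFinM !lee_fin expr2; apply=> x y [Gx /= fx] [Gy /= fy].
have hm : 2^-1 *: (x + y) = 2^-1 *: x + (1 - 2^-1) *: y by apply/rowP => i; rewrite !mxE; field.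
have h01 : 0 <= (2^-1 : R) <= 1 by apply/andP; split; lra.
split; last by lra.
split; first by rewrite hm; exact: cG.
by rewrite /= hm; have := vf x y h01; lra.
Qed.

(** By log-concavity, ratios of consecutive volumes along the grid do not increase, so the first one
    bounds all later ones. *)
Lemma lvol_ratio_up c (q : R) : 0 < lvol c -> lvol (c + 1) = q * lvol c ->
  forall k : nat, lvol (c + k%:R + 1) <= q * lvol (c + k%:R).
Proof.
move=> V0 qE; elim=> [|k IH]; first by rewrite addr0 qE.
have Vk : 0 < lvol (c + k%:R) by apply: (lt_le_trans V0); apply: lvol_le; rewrite lerDl.
have := lvol_logconcave (c + k%:R) (c + k.+1%:R + 1).
rewrite (_ : (c + k%:R + (c + k.+1%:R + 1)) / 2 = c + k.+1%:R); last by rewrite -natr1; field.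
rewrite (_ : c + k%:R + 1 = c + k.+1%:R) in IH; last by rewrite -natr1; ring.
move=> h; rewrite -(ler_pM2l Vk); apply: (le_trans h).
by rewrite expr2 mulrA ler_wpM2r ?lvol_ge0// mulrC.
Qed.

Lemma lvol_up_le c (q : R) : 0 < lvol c -> lvol (c + 1) = q * lvol c ->
  forall k : nat, lvol (c + k%:R) <= q ^+ k * lvol c.
Proof.
move=> V0 qE; have q0 : 0 <= q.
  by rewrite -(pmulr_lge0 _ V0) -qE lvol_ge0.
elim=> [|k IH]; first by rewrite addr0 expr0 mul1r.
rewrite -natr1 addrA exprS -mulrA; apply: (le_trans (lvol_ratio_up V0 qE k)).
by rewrite ler_wpM2l.
Qed.

(** Going down from [c], consecutive ratios are at least [q], so volumes decay at least
    geometrically. *)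
Lemma lvol_down_le c (q : R) : 0 < lvol c -> lvol (c + 1) = q * lvol c ->
  forall k : nat, q ^+ k * lvol (c - k%:R) <= lvol c.
Proof.
move=> V0 qE; have q0 : 0 <= q.
  by rewrite -(pmulr_lge0 _ V0) -qE lvol_ge0.
have H (k : nat) : q * lvol (c - k.+1%:R) <= lvol (c - k%:R).
  elim: k => [|k IH].
    have := lvol_logconcave (c - 1%:R) (c + 1).
    rewrite (_ : (c - 1%:R + (c + 1)) / 2 = c); last by field.
    by rewrite qE subr0 expr2 mulrA ler_pM2r// mulrC.
  (* A ratio with zero denominator says nothing; but below a level of volume zero all volumes
     vanish. *)
  have [V00|Vn] := eqVneq (lvol (c - k.+1%:R)) 0.
    rewrite (_ : lvol (c - k.+2%:R) = 0) ?mulr0 ?lvol_ge0//.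
    apply/eqP; rewrite eq_le lvol_ge0 andbT -V00; apply: lvol_le.
    by rewrite lerD2l lerN2 ler_nat.
  have Vk1 : 0 < lvol (c - k.+1%:R) by rewrite lt_neqAle eq_sym Vn lvol_ge0.
  have Vk : 0 < lvol (c - k%:R).
    by apply: (lt_le_trans Vk1); apply: lvol_le; rewrite lerD2l lerN2 ler_nat.
  have := lvol_logconcave (c - k%:R) (c - k.+2%:R).
  rewrite (_ : (c - k%:R + (c - k.+2%:R)) / 2 = c - k.+1%:R); last by rewrite -!natr1; field.
  move=> h; rewrite -(ler_pM2l Vk); apply: (@le_trans _ _ (q * lvol (c - k.+1%:R) ^+ 2)).
    by rewrite mulrCA ler_wpM2l.
  by rewrite expr2 mulrA ler_pM2r.
elim=> [|k IH]; first by rewrite subr0 expr0 mul1r.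
apply: le_trans IH; rewrite exprSr -mulrA ler_wpM2l ?exprn_ge0//.
Qed.

(** Open below and closed above, so that consecutive slabs partition and their volumes are
    differences of [lvol]. *)
Definition slab (v w : R) : set 'rV[R]_n := G `&` [set J | v < f J <= w].

Lemma slabE v w : slab v w = level w `\` level v.
Proof.
apply/seteqP; split => J.
  move=> [GJ /= /andP[h1 h2]]; split; first by split.
  by move=> [_ /=]; rewrite leNgt h1.
move=> [[GJ /= h1] h2]; split => //=; rewrite h1 andbT ltNge; apply/negP => h; apply: h2; split => //.
Qed.

Lemma measurable_slab v w : measurable (slab v w).
Proof. by rewrite slabE; apply: measurableD; exact: measurable_level. Qed.

Lemma lebn_slab v w : v <= w -> lebn n (slab v w) = (lvol w - lvol v)%:E.
Proof.
move=> vw; rewrite slabE measureD//; try exact: measurable_level; last first.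
  by apply: (le_lt_trans _ (ltry (lvol w))); rewrite lvolE.
rewrite (setIidr _); last by move=> J [GJ /= h]; split => //=; exact: le_trans vw.
by rewrite EFinB !lvolE.
Qed.

Lemma slab_integral_le (v w K : R) (F : 'rV[R]_n -> R) : v <= w ->
  (lebn n).-integrable G (fun J => (F J)%:E) -> (forall J, slab v w J -> F J <= K) ->
  \int[lebn n]_(J in slab v w) F J <= K * (lvol w - lvol v).
Proof.
move=> vw iF FK; have mS := measurable_slab v w.
have SG : slab v w `<=` G by move=> J [].
have -> : K * (lvol w - lvol v) = \int[lebn n]_(J in slab v w) K.
  by rewrite Rintegral_cst// (_ : fine _ = lvol w - lvol v)// -[RHS]/(fine (lvol w - lvol v)%:E) -lebn_slab.
apply: le_Rintegral => //; first exact: (integrableS mG).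
apply/integrableP; split; first exact: measurable_cst.
by rewrite integral_cst//= (lebn_slab vw) lte_mul_pinfty ?ltry.
Qed.

Lemma slab_sum_le (c : R) (F : 'rV[R]_n -> R) (K : nat -> R) (M : nat) :
  (lebn n).-integrable G (fun J => (F J)%:E) ->
  (forall k J, slab (c + k%:R) (c + k.+1%:R) J -> F J <= K k) ->
  \int[lebn n]_(J in slab c (c + M%:R)) F J <=
  \sum_(k < M) K k * (lvol (c + k.+1%:R) - lvol (c + k%:R)).
Proof.
move=> iF FK; elim: M => [|M IH].
  rewrite big_ord0 addr0 (_ : slab c c = set0) ?Rintegral_set0//.
  by apply/seteqP; split => // J [_ /= /andP[h1 h2]]; have := lt_le_trans h1 h2; rewrite ltxx.
have Mle : c + M%:R <= c + M.+1%:R by rewrite lerD2l ler_nat.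
have U : slab c (c + M%:R) `|` slab (c + M%:R) (c + M.+1%:R) = slab c (c + M.+1%:R).
  apply/seteqP; split => J.
    case=> -[GJ /= /andP[h1 h2]]; split => //=; rewrite ?h1 ?h2 ?(le_trans h2 Mle)//= ?andbT.
    by apply: le_lt_trans h1; rewrite lerDl.
  move=> [GJ /= /andP[h1 h2]]; case: (leP (f J) (c + M%:R)) => h; [left|right]; split => //=.
    by rewrite h1 h.
  by rewrite h h2.
rewrite big_ord_recr/= -U Rintegral_setU; try exact: measurable_slab; first last.
- by apply/disj_setPS => J [[_ /= /andP[_ h1]] [_ /= /andP[h2 _]]]; have := lt_le_trans h2 h1; rewrite ltxx.
- by rewrite U; apply: (integrableS mG) => //; [exact: measurable_slab|move=> J []].
apply: lerD => //; apply: slab_integral_le => //; exact: FK.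
Qed.

(** The region above [c] is the increasing union of finite stacks of unit slabs; a bound on all
    partial sums passes to it by monotone convergence. *)
Lemma slab_series_le (c B : R) (F : 'rV[R]_n -> R) (K : nat -> R) : (forall J, 0 <= F J) ->
  (lebn n).-integrable G (fun J => (F J)%:E) ->
  (forall k J, slab (c + k%:R) (c + k.+1%:R) J -> F J <= K k) ->
  (forall M, \sum_(k < M) K k * (lvol (c + k.+1%:R) - lvol (c + k%:R)) <= B) ->
  \int[lebn n]_(J in G `&` [set J | c < f J]) F J <= B.
Proof.
move=> F0 iF FK KB; pose A (M : nat) := slab c (c + M%:R).
have UA : \bigcup_M A M = G `&` [set J | c < f J].
  apply/seteqP; split => J.
    by move=> [M _ [GJ /= /andP[h _]]]; split.
  move=> [GJ /= h]; exists (Num.truncn (f J - c)).+1 => //; split => //=.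
  by rewrite h/= -lerBlDl ltW// truncnS_gt.
have mU : measurable (\bigcup_M A M) by apply: bigcupT_measurable => M; exact: measurable_slab.
have iU : (lebn n).-integrable (\bigcup_M A M) (fun J => (F J)%:E).
  by apply: (integrableS mG) => //; rewrite UA => J [].
rewrite -UA -lee_fin EFin_Rint//.
have nd : nondecreasing_seq A.
  move=> i j ij; apply/subsetPset => J [GJ /= /andP[h1 h2]]; split => //=; rewrite h1/=.
  by apply: (le_trans h2); rewrite lerD2l ler_nat.
have H : (\int[lebn n]_(J in A i) (F J)%:E)%E @[i --> \oo] --> (\int[lebn n]_(J in \bigcup_M A M) (F J)%:E)%E.
  apply: ge0_nondecreasing_set_cvg_integral => //.
  - by move=> M; exact: measurable_slab.
  - by move=> M; apply: (@measurable_funS _ _ _ _ (\bigcup_M A M)) => //; [exact: bigcup_sup|have /integrableP[] := iU].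
  - by move=> M J _; rewrite lee_fin.
apply: (cvge_to_le H).
apply: nearW => M; rewrite -EFin_Rint//; last 2 first.
- exact: measurable_slab.
- by apply: (integrableS mG) => //; [exact: measurable_slab|move=> J []].
by rewrite lee_fin; apply: le_trans (KB M); exact: slab_sum_le.
Qed.

Lemma slab_sum_down_le (c : R) (F : 'rV[R]_n -> R) (K : nat -> R) (M : nat) :
  (lebn n).-integrable G (fun J => (F J)%:E) ->
  (forall k, 0 <= K k) -> (forall k J, slab (c - k.+1%:R) (c - k%:R) J -> F J <= K k) ->
  \int[lebn n]_(J in slab (c - M%:R) c) F J <= \sum_(k < M) K k * lvol (c - k%:R).
Proof.
move=> iF K0 FK; elim: M => [|M IH].
  rewrite big_ord0 subr0 (_ : slab c c = set0) ?Rintegral_set0//.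
  by apply/seteqP; split => // J [_ /= /andP[h1 h2]]; have := lt_le_trans h1 h2; rewrite ltxx.
have Mle : c - M.+1%:R <= c - M%:R by rewrite lerD2l lerN2 ler_nat.
have U : slab (c - M%:R) c `|` slab (c - M.+1%:R) (c - M%:R) = slab (c - M.+1%:R) c.
  apply/seteqP; split => J.
    case=> -[GJ /= /andP[h1 h2]]; split => //=; rewrite ?h1 ?h2 ?(le_lt_trans Mle h1)//=.
    by apply: (le_trans h2); rewrite gerBl.
  move=> [GJ /= /andP[h1 h2]]; case: (leP (f J) (c - M%:R)) => h; [right|left]; split => //=.
    by rewrite h1 h.
  by rewrite h h2.
rewrite big_ord_recr/= -U Rintegral_setU; try exact: measurable_slab; first last.
- by apply/disj_setPS => J [[_ /= /andP[h1 _]] [_ /= /andP[_ h2]]]; have := lt_le_trans h1 h2; rewrite ltxx.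
- by rewrite U; apply: (integrableS mG) => //; [exact: measurable_slab|move=> J []].
apply: lerD => //; apply: (le_trans (slab_integral_le (K := K M) Mle iF _)); first exact: FK.
by rewrite ler_wpM2l// gerBl lvol_ge0.
Qed.

End levels.

(** * Elementary estimates for geometric series and for powers of numbers near one *)

Section arith_geom.
Context {R : realType}.

(** Multiplication by (1 - x)^2 collapses the sum. The weight k + 1 is the bound for |f - c| on the
    k-th unit slab. *)
Lemma sum_arith_geom_le (x : R) (M : nat) : 0 <= x < 1 ->
  \sum_(k < M) (k.+1%:R * x ^+ k) <= ((1 - x) ^+ 2)^-1.
Proof.
move=> /andP[x0 x1]; have x10 : 0 < 1 - x by rewrite subr_gt0.
have E : (1 - x) ^+ 2 * \sum_(k < M) (k.+1%:R * x ^+ k) = 1 - M.+1%:R * x ^+ M + M%:R * x ^+ M.+1.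
  elim: M => [|M IH]; first by rewrite big_ord0 mulr0 expr0 mul0r; ring.
  by rewrite big_ord_recr/= mulrDr IH !exprS -!natr1; ring.
rewrite -[leRHS]mul1r ler_pdivlMr ?exprn_gt0// mulrC E.
have : M%:R * x ^+ M.+1 <= M.+1%:R * x ^+ M.
  by rewrite ler_pM ?exprn_ge0 ?ler_nat// exprS ler_piMl ?exprn_ge0// ltW.
lra.
Qed.

(** A geometric series of ratio exp(- 1 / j) has a sum polynomial in j. *)
Lemma expR_inv_nat_gap (j : nat) : (0 < j)%N -> (j.+1%:R^-1 : R) <= 1 - expR (- j%:R^-1).
Proof.
move=> j0; have jn : (0 : R) < j%:R by rewrite ltr0n.
have h : 1 + j%:R^-1 <= expR (j%:R^-1 : R) by exact: expR_ge1Dx.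
have e0 := expR_gt0 (j%:R^-1 : R).
have : expR (- j%:R^-1) <= (1 + j%:R^-1)^-1 :> R.
  by rewrite expRN lef_pV2 ?posrE// addr_gt0// invr_gt0.
have -> : (1 + j%:R^-1)^-1 = 1 - j.+1%:R^-1 :> R.
  by rewrite -natr1; field; rewrite !lt0r_neq0// addr_gt0.
by rewrite !lerBrDr addrC.
Qed.

Lemma inv_double_nat_le (n : nat) : (0 < n)%N -> 0 <= (2 * n%:R : R)^-1 <= 1 / 2.
Proof.
move=> n0; have n1 : (1 : R) <= n%:R by rewrite ler1n.
rewrite invr_ge0 mulr_ge0//= invfM ler_pdivrMr ?ltr0n//; lra.
Qed.

(** The source of the recurring 2 n: a contraction by a ratio of at least 1 - 1 / (2 n) keeps half
    of the volume. *)
Lemma half_le_exprn (n : nat) (t : R) : (0 < n)%N -> 1 - (2 * n%:R)^-1 <= t -> 1 / 2 <= t ^+ n.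
Proof.
move=> n0 t1; have nR : (0 : R) < n%:R by rewrite ltr0n.
have h0 : 0 <= (2 * n%:R : R)^-1 <= 1 by have := inv_double_nat_le n0; lra.
have := bernoulli_le n h0; rewrite invfM mulrCA divff ?lt0r_neq0// mulr1 => h.
apply: (@le_trans _ _ ((1 - (2 * n%:R)^-1) ^+ n)); first by rewrite invfM; lra.
by rewrite lerXn2r ?nnegrE//; case/andP: h0; lra.
Qed.

Lemma expR1_le3 : expR (1 : R) <= 3.
Proof.
have h := @expR_ge1Dx R (- (1 / 6)).
have : expR (1 : R) * (expR (- (1 / 6))) ^+ 6 = 1.
  by rewrite -expRM_natl -expRD (_ : 1 + 6%:R * - (1 / 6) = 0 :> R) ?expR0//; field.
have : (5 / 6) ^+ 6 <= (expR (- (1 / 6) : R)) ^+ 6 by rewrite lerXn2r ?nnegrE ?expR_ge0//; lra.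
have e0 := expR_gt0 (1 : R); set t := expR (- (1 / 6)) ^+ 6; set e := expR 1; move=> t1 et.
have t3 : 1 / 3 <= t by lra.
have : e * (1 / 3) <= e * t by rewrite ler_pM2l.
lra.
Qed.

End arith_geom.

(** * The volume below the mean energy *)

Section mean_energy.
Context {R : realType} (n : nat) (G : set 'rV[R]_n) (f : 'rV[R]_n -> R) (a b : R).
Hypotheses (n0 : (0 < n)%N).
Hypotheses (oG : open G) (cG : Defs.convex_set G) (cf : continuous f) (vf : convex_fun f).
Hypotheses (a0 : 0 < a) (b0 : 0 <= b).
Hypothesis growth : forall J, G J -> a * dotp J J - b <= f J.
Notation Z := (\int[lebn n]_(J in G) expR (- f J)).
Variables (c : R) (J0 : 'rV[R]_n).
Hypotheses (Z0 : 0 < Z) (meanE : gibbs G f f = c * Z).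

Let mG : measurable G. Proof. exact: open_measurable_mx. Qed.

Let mf : measurable_fun setT f. Proof. exact: continuous_measurable_mx. Qed.

Let vol0 v : 0 <= lvol G f v. Proof. exact: (lvol_ge0 oG cf a0 growth). Qed.

Let nR : (0 : R) < n%:R. Proof. by rewrite ltr0n. Qed.

Let inv_2n : 0 <= (2 * n%:R : R)^-1 <= 1 / 2. Proof. exact: inv_double_nat_le. Qed.

Let half_pow (t : R) : 1 - (2 * n%:R)^-1 <= t -> t <= 1 -> 1 / 2 <= t ^+ n.
Proof. by move=> t1 _; exact: half_le_exprn. Qed.

(* Compare the partition function with that of the contraction of G towards J, on which convexity bounds f. *)
Lemma mean_energy_gap_le (J : 'rV[R]_n) : G J -> c - f J <= 2 * n%:R.
Proof.
move=> GJ; have n1 : (1 : R) <= n%:R by rewrite ler1n.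
(* With this ratio s^n >= 1 / 2, so the partition function of the contraction, rescaled, is at most
   2 Z. Convexity and exp x >= 1 + x bound it below by (1 + (1 - s) (c - f J)) Z. *)
pose s : R := 1 - (2 * n%:R)^-1.
have i0 : 0 < (2 * n%:R : R)^-1 by rewrite invr_gt0 mulr_gt0.
have i1 : (2 * n%:R : R)^-1 <= 1 / 2 by case/andP: inv_2n.
have s0 : 0 < s by rewrite /s; lra.
have s1 : s <= 1 by rewrite /s; lra.
have sn : 1 / 2 <= s ^+ n by exact: half_pow.
pose w := (1 - s) *: J.
have mg : measurable_fun setT (fun v => (\1_G v * expR (- f v))%:E).
  apply/measurable_EFinP; apply: measurable_funM => //.
  by apply: measurableT_comp => //; exact: measurableT_comp.
have ms : measurable_fun setT (fun v : 'rV[R]_n => s *: v + w).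
  by apply: continuous_mx_measurable_mx; exact: (@continuous_affine R 'rV[R]_n).
have ZE : (Z%:E = \int[lebn n]_v (\1_G v * expR (- f v))%:E)%E.
  rewrite EFin_Rint//; last exact: boltzmann_integrable growth.
  rewrite integral_mkcond; apply: eq_integral => v _; rewrite patchE indicE.
  by case: ifP => _; rewrite ?mul1r ?mul0r.
have mh : measurable_fun setT (fun v : 'rV[R]_n => (expR (- f (s *: v + w)))%:E).
  apply/measurable_EFinP; apply: measurableT_comp => //; apply: measurableT_comp => //.
  exact: measurableT_comp.
have sub : (\int[lebn n]_(v in G) (expR (- f (s *: v + w)))%:E <= (Z / s ^+ n)%:E)%E.
  rewrite mulrC EFinM ZE (lebn_affine w s0 mg); last by move=> v; rewrite lee_fin mulr_ge0 ?expR_ge0.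
  rewrite muleA -EFinM mulVf ?mul1e ?expf_neq0 ?lt0r_neq0//.
  rewrite integral_mkcond; apply: ge0_le_integral => //.
  - by move=> v _; rewrite patchE; case: ifP => _ //; rewrite lee_fin expR_ge0.
  - by apply/(measurable_restrictT _ _).1 => //; exact: measurable_funTS.
  - exact: (measurableT_comp mg ms).
  move=> v _; rewrite patchE indicE; case: ifPn => [/set_mem Gv|_]; last by rewrite lee_fin mulr_ge0 ?expR_ge0.
  rewrite (_ : (_ \in G) = true) ?mul1r//; apply/mem_set; rewrite /w; apply: cG => //.
  by rewrite (ltW s0).
have ih : (lebn n).-integrable G (fun v => (expR (- f (s *: v + w)))%:E).
  apply/integrableP; split; first exact: measurable_funTS.
  under eq_integral do rewrite gee0_abs ?lee_fin ?expR_ge0//.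
  exact: (le_lt_trans sub (ltry _)).
have iR : (lebn n).-integrable G (fun v => ((1 + (1 - s) * (f v - f J)) * expR (- f v))%:E).
  have -> : (fun v => ((1 + (1 - s) * (f v - f J)) * expR (- f v))%:E) =
     (fun v => ((1 - (1 - s) * f J) * expR (- f v))%:E + ((1 - s) * (f v * expR (- f v)))%:E)%E.
    by apply/funext => v; rewrite -EFinD; congr (_%:E); ring.
  apply: integrableD => //; apply: integrable_scale => //.
    exact: boltzmann_integrable growth.
  exact: energy_integrable growth.
have : \int[lebn n]_(v in G) ((1 + (1 - s) * (f v - f J)) * expR (- f v)) <= Z / s ^+ n.
  apply: (@le_trans _ _ (\int[lebn n]_(v in G) expR (- f (s *: v + w)))); last first.
    by rewrite -lee_fin EFin_Rint.
  apply: le_Rintegral => // v Gv; have s01 : 0 <= s <= 1 by rewrite (ltW s0).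
  have h := vf v J s01.
  apply: (@le_trans _ _ (expR (- f v + (1 - s) * (f v - f J)))).
    by rewrite expRD mulrC ler_wpM2l ?expR_ge0// expR_ge1Dx.
  by rewrite ler_expR /w; lra.
have -> : \int[lebn n]_(v in G) ((1 + (1 - s) * (f v - f J)) * expR (- f v)) = (1 + (1 - s) * (c - f J)) * Z.
  transitivity (gibbs G f (fun v => (1 - (1 - s) * f J) + (1 - s) * f v)).
    by apply: eq_Rintegral => v _; congr (_ * _); ring.
  rewrite (gibbsD mG); last 2 first.
  - by apply: integrable_scale => //; exact: boltzmann_integrable growth.
  - under eq_fun do rewrite -mulrA; apply: integrable_scale => //; exact: energy_integrable growth.
  rewrite (gibbs1 mG cf a0 growth) (gibbsZ mG); last exact: energy_integrable growth.
  by rewrite meanE; ring.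
rewrite mulrC ler_pM2l// => h.
have : (s ^+ n)^-1 <= 2 by rewrite invf_ple ?posrE ?exprn_gt0//; lra.
move=> h2; have : (1 - s) * (c - f J) <= 1 by lra.
by rewrite /s opprB addrCA subrr addr0 ler_pdivrMl ?mulr_gt0// mulr1.
Qed.

(** Densities normalised at the energy c: [w] integrates to exp(c) Z, and [y] measures the absolute
    fluctuation of the energy around c. *)
Let y J := `|f J - c| * expR (c - f J).

Let w J := expR (c - f J).

Let iw : (lebn n).-integrable G (fun J => (w J)%:E).
Proof.
have -> : (fun J => (w J)%:E) = (fun J => (expR c * expR (- f J))%:E).
  by apply/funext => J; rewrite /w expRD.
by apply: integrable_scale => //; exact: boltzmann_integrable growth.
Qed.

Let isy : (lebn n).-integrable G (fun J => ((f J - c) * w J)%:E).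
Proof.
have -> : (fun J => ((f J - c) * w J)%:E) =
   (fun J => (expR c * (f J * expR (- f J)))%:E + ((- c * expR c) * expR (- f J))%:E)%E.
  by apply/funext => J; rewrite /w expRD -EFinD; congr (_%:E); ring.
apply: integrableD => //; apply: integrable_scale => //.
  exact: energy_integrable growth.
exact: boltzmann_integrable growth.
Qed.

Let iy : (lebn n).-integrable G (fun J => (y J)%:E).
Proof.
have := integrable_abse isy; congr (_.-integrable _ _).
by apply/funext => J; rewrite /= normrM (ger0_norm (expR_ge0 _)).
Qed.

Let GU := G `&` [set J | c < f J].

Let mGU : measurable GU.
Proof.
rewrite (_ : GU = G `\` level G f c); first by apply: measurableD => //; exact: measurable_level.
apply/seteqP; split => J.
  by move=> [GJ /= h]; split => // -[_ /=]; rewrite leNgt h.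
by move=> [GJ h]; split => //=; rewrite ltNge; apply/negP => h2; apply: h; split.
Qed.

Let split_int (F : 'rV[R]_n -> R) : (lebn n).-integrable G (fun J => (F J)%:E) ->
  \int[lebn n]_(J in G) F J = \int[lebn n]_(J in GU) F J + \int[lebn n]_(J in level G f c) F J.
Proof.
move=> iF; have U : GU `|` level G f c = G.
  apply/seteqP; split => J; first by case=> -[].
  by move=> GJ; case: (leP (f J) c) => h; [right|left]; split.
rewrite -[in LHS]U Rintegral_setU ?U//; first exact: measurable_level.
by apply/disj_setPS => J [[_ /= h1] [_ /= h2]]; have := lt_le_trans h1 h2; rewrite ltxx.
Qed.

(** Since c is the mean energy, (f - c) exp(c - f) has integral zero over [G]; this equates the
    fluctuation above c with that below. *)
Let balance : \int[lebn n]_(J in GU) y J = \int[lebn n]_(J in level G f c) y J.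
Proof.
have : \int[lebn n]_(J in G) ((f J - c) * w J) = 0.
  transitivity (gibbs G f (fun J => expR c * (f J + - c))).
    by apply: eq_Rintegral => J _; rewrite /w expRD; ring.
  have iE := energy_integrable mG cf a0 b0 growth.
  have iC : (lebn n).-integrable G (fun J => (- c * expR (- f J))%:E).
    by apply: integrable_scale => //; exact: boltzmann_integrable growth.
  rewrite (gibbsZ mG); last by under eq_fun do rewrite mulrDl EFinD; exact: integrableD.
  by rewrite (gibbsD mG)// (gibbs1 mG cf a0 growth) meanE mulNr subrr mulr0.
rewrite split_int; last exact: isy.
move=> /eqP; rewrite addr_eq0 => /eqP E.
transitivity (\int[lebn n]_(J in GU) ((f J - c) * w J)).
  by apply: eq_Rintegral => J /set_mem[_ /= h]; rewrite /y gtr0_norm// subr_gt0.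
rewrite E -mulN1r -RintegralZl; last 2 first.
- exact: measurable_level.
- by apply: (integrableS mG) => //; [exact: measurable_level|move=> J []].
apply: eq_Rintegral => J /set_mem[_ /= h]; rewrite /y ler0_norm ?subr_le0//.
by rewrite mulN1r mulNr.
Qed.

(** On the k-th unit slab above c one has |f - c| <= k + 1 and exp(c - f) <= exp(- k). If the slab
    volumes weighted by exp(- k) decay like x^k, both integrals are bounded by the same
    arithmetic-geometric series. *)
Let upper_series (x D : R) : 0 <= x < 1 ->
  (forall k : nat, expR (- k%:R) * (lvol G f (c + k.+1%:R) - lvol G f (c + k%:R)) <= D * x ^+ k) ->
  \int[lebn n]_(J in GU) y J <= D * ((1 - x) ^+ 2)^-1 /\ \int[lebn n]_(J in GU) w J <= D * ((1 - x) ^+ 2)^-1.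
Proof.
move=> x01 HD.
have D0 : 0 <= D.
  have := HD 0%N; rewrite expr0 mulr1; apply: le_trans; rewrite mulr_ge0 ?expR_ge0// subr_ge0.
  by apply: lvol_le growth _ _ _ => //; rewrite lerD2l ler_nat.
have HB M : \sum_(k < M) (k.+1%:R * expR (- k%:R)) * (lvol G f (c + k.+1%:R) - lvol G f (c + k%:R)) <=
    D * ((1 - x) ^+ 2)^-1.
  apply: (@le_trans _ _ (D * \sum_(k < M) (k.+1%:R * x ^+ k))); last first.
    by rewrite ler_wpM2l// sum_arith_geom_le.
  rewrite mulr_sumr; apply: ler_sum => k _; rewrite -mulrA [leRHS]mulrCA ler_wpM2l//; exact: HD.
split; apply: (slab_series_le (K := fun k => k.+1%:R * expR (- k%:R)) oG cf a0 growth _ _ _ HB) => //.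
- by move=> J; rewrite mulr_ge0 ?expR_ge0.
- move=> k J [GJ /= /andP[h1 h2]]; rewrite /y; apply: ler_pM; rewrite ?expR_ge0//.
    rewrite gtr0_norm; first by lra.
    by have : (0 : R) <= k%:R by []; lra.
  by rewrite ler_expR; lra.
- by move=> J; exact: expR_ge0.
- move=> k J [GJ /= /andP[h1 h2]]; rewrite /w; apply: (@le_trans _ _ (expR (- k%:R))).
    by rewrite ler_expR; lra.
  by rewrite ler_peMl ?expR_ge0// ler1n.
Qed.

Variable g : R.
Hypotheses (GJ0 : G J0) (g0 : 0 < g) (gE : g <= c - f J0).

(** An energy step over which the volume at c changes by a factor of at most 2 in either direction,
    by contraction towards [J0]. *)
Let h := g / (2 * n%:R).

Let h0 : 0 < h. Proof. by rewrite divr_gt0// mulr_gt0. Qed.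

Lemma mean_level_vol_gt0 : 0 < lvol G f c.
Proof.
have oU : open (G `&` [set J | f J < c]).
  apply: openI => //; apply: (@open_comp _ _ f [set z | z < c]); last exact: open_lt.
  by move=> J _; exact: cf.
have UJ0 : (G `&` [set J | f J < c]) J0 by split => //=; move: gE g0; lra.
have [r r0 rU] : exists2 r, 0 < r & eball J0 r `<=` (G `&` [set J | f J < c]).
  by apply/nbhs_eball; exact: open_nbhs_nbhs.
rewrite -lte_fin (lvolE oG cf a0 growth); apply: (@lt_le_trans _ _ (lebn n (eball J0 r))).
  by rewrite lebn_eball// lte_fin; apply: mulr_gt0; [exact: ball_vol_gt0|exact: exprn_gt0].
apply: lebn_le; [exact: measurable_eball|exact: measurable_level|].
by move=> J /rU[GJ /= fJ]; split => //=; exact: ltW.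
Qed.

Let V0 := lvol G f c.

Let V00 : 0 < V0. Proof. exact: mean_level_vol_gt0. Qed.

Let lower_half : V0 / 2 <= lvol G f (c - h).
Proof.
pose t := 1 - h / (c - f J0).
have gp : 0 < c - f J0 by exact: lt_le_trans gE.
have ht : h / (c - f J0) <= (2 * n%:R)^-1.
  rewrite ler_pdivrMr// /h [leRHS]mulrC ler_wpM2r//; by case/andP: inv_2n.
have i1 : (2 * n%:R : R)^-1 <= 1 / 2.
  by case/andP: inv_2n.
have hp : 0 < h / (c - f J0) by rewrite divr_gt0.
have t0 : 0 < t by rewrite /t; lra.
have t1 : t <= 1 by rewrite /t; lra.
have tn : 1 / 2 <= t ^+ n by apply: half_pow => //; rewrite /t; lra.
have := @lvol_scale R n G f a b oG cG cf vf a0 growth J0 t (c - h) c GJ0 t0 t1.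
have -> : f J0 + t * (c - f J0) = c - h by rewrite /t mulrBl divfK ?lt0r_neq0// mul1r; ring.
move=> /(_ (lexx _)) H; have := ler_wpM2r (ltW V00) tn; rewrite -/V0 in H *; lra.
Qed.

Let upper_double : lvol G f (c + h) <= 2 * V0.
Proof.
have gp : 0 < c - f J0 by exact: lt_le_trans gE.
have gh : 0 < c - f J0 + h by rewrite addr_gt0.
pose t := 1 - h / (c - f J0 + h).
have ht : h / (c - f J0 + h) <= (2 * n%:R)^-1.
  rewrite ler_pdivrMr// /h [leRHS]mulrC; apply: ler_wpM2r; first by case/andP: inv_2n.
  by apply: (le_trans gE); rewrite lerDl ltW.
have i1 : (2 * n%:R : R)^-1 <= 1 / 2.
  by case/andP: inv_2n.
have hp : 0 < h / (c - f J0 + h) by rewrite divr_gt0.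
have t0 : 0 < t by rewrite /t; lra.
have t1 : t <= 1 by rewrite /t; lra.
have tn : 1 / 2 <= t ^+ n by apply: half_pow => //; rewrite /t; lra.
have := @lvol_scale R n G f a b oG cG cf vf a0 growth J0 t c (c + h) GJ0 t0 t1.
have -> : f J0 + t * (c + h - f J0) = c.
  by rewrite /t (_ : c + h - f J0 = c - f J0 + h); [rewrite mulrBl divfK ?lt0r_neq0// mul1r|]; ring.
move=> /(_ (lexx _)) H; have p := vol0 (c + h).
by have := ler_wpM2r p tn; rewrite -/V0 in H *; lra.
Qed.

(** With q = V(c + 1) / V(c), only q <= exp(1 / 2) needs work. Then the fluctuation above c is at
    most 9 (q - 1) V(c), whereas that below is at least h V(c) / 2, since half of the volume lies
    below c - h. The balance gives q - 1 >= h / 18 = g / (36 n). *)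
Lemma mean_level_vol_increment :
  Num.min (1 / 2) (g / (36 * n%:R)) * V0 <= lvol G f (c + 1) - V0.
Proof.
pose q := lvol G f (c + 1) / V0.
have qE : lvol G f (c + 1) = q * V0 by rewrite divfK// lt0r_neq0.
have q1 : 1 <= q.
  rewrite -(ler_pM2r V00) mul1r -qE; apply: lvol_le growth _ _ _ => //; lra.
suff : Num.min (1 / 2) (g / (36 * n%:R)) <= q - 1.
  by move=> H; rewrite qE -[X in _ - X]mul1r -mulrBl ler_pM2r.
have [q2|q2] := leP q (expR (1 / 2)); last first.
  by rewrite ge_min; apply/orP; left; have := expR_ge1Dx (1 / 2 : R); lra.
rewrite ge_min; apply/orP; right.
(* q^k exp(- k) <= x^k as q <= exp(1 / 2); and 1 - x >= 1 / 3 is the origin of the 9. *)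
pose x : R := expR (- 2%:R^-1).
have x3 : 3^-1 <= 1 - x by exact: (@expR_inv_nat_gap R 2).
have x0 : 0 <= x by exact: expR_ge0.
have x01 : 0 <= x < 1 by rewrite x0; lra.
have [|U _] := @upper_series x ((q - 1) * V0) x01.
  move=> k; have := @lvol_ratio_up R n G f a b oG cG cf vf a0 growth c q V00 qE k.
  have := @lvol_up_le R n G f a b oG cG cf vf a0 growth c q V00 qE k.
  rewrite -(natr1 k) addrA -/V0 => h1 h2.
  have q0 : 0 <= q by lra.
  apply: (@le_trans _ _ (expR (- k%:R) * ((q - 1) * (q ^+ k * V0)))).
    rewrite ler_wpM2l ?expR_ge0//.
    apply: (@le_trans _ _ ((q - 1) * lvol G f (c + k%:R))); first by lra.
    by rewrite ler_wpM2l//; lra.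
  rewrite mulrC -!mulrA ler_wpM2l//; first by lra.
  rewrite [leLHS]mulrCA ler_wpM2l//; first exact: ltW.
  apply: (@le_trans _ _ (expR (1 / 2) ^+ k * expR (- k%:R))).
    by rewrite ler_wpM2r ?expR_ge0// lerXn2r ?nnegrE ?expR_ge0.
  rewrite /x -!expRM_natl -expRD ler_expR.
  by have : (0 : R) <= k%:R by []; lra.
have L : h * (V0 / 2) <= \int[lebn n]_(J in level G f c) y J.
  apply: (@le_trans _ _ (\int[lebn n]_(J in level G f (c - h)) y J)).
    apply: (@le_trans _ _ (\int[lebn n]_(J in level G f (c - h)) h)).
      rewrite Rintegral_cst; last exact: measurable_level.
      by apply: ler_wpM2l; [exact: ltW|exact: lower_half].
    apply: le_Rintegral; first exact: measurable_level.
    - apply/integrableP; split; first exact: measurable_cst.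
      rewrite integral_cst/=; last exact: measurable_level.
      apply: lte_mul_pinfty => //.
      by apply: (le_lt_trans _ (ltry (lvol G f (c - h)))); rewrite (lvolE oG cf a0 growth).
    - by apply: (integrableS mG) => //; [exact: measurable_level|move=> J []].
    move=> J [GJ /= fJ]; rewrite /y; have hp := h0.
    have : h <= `|f J - c| by rewrite ler0_norm; lra.
    have : 1 <= expR (c - f J) by rewrite -[leLHS]expR0 ler_expR; lra.
    by move=> e1 e2; rewrite -[leLHS]mulr1 ler_pM// ltW.
  apply: Rintegral_le_subset; try exact: measurable_level.
  - by move=> J [GJ /= fJ]; split => //=; have := h0; lra.
  - by move=> J; rewrite mulr_ge0 ?expR_ge0.
  - by apply: (integrableS mG) => //; [exact: measurable_level|move=> J []].
have x9 : ((1 - x) ^+ 2)^-1 <= 9.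
  by rewrite invf_ple ?posrE//; [nra|rewrite exprn_gt0//; lra].
have : h * (V0 / 2) <= (q - 1) * V0 * 9.
  apply: (le_trans L); rewrite -balance; apply: (le_trans U); apply: ler_wpM2l => //; apply: mulr_ge0; [by rewrite subr_ge0|exact: ltW].
rewrite (_ : (q - 1) * V0 * 9 = (18 * (q - 1)) * (V0 / 2)); last by field.
rewrite ler_pM2r; last by rewrite divr_gt0.
rewrite /h (_ : g / (36 * n%:R) = g / (2 * n%:R) / 18); last by field; rewrite lt0r_neq0.
lra.
Qed.

Lemma mean_level_vol_le : V0 <= expR c * Z.
Proof.
have -> : expR c * Z = \int[lebn n]_(J in G) w J.
  rewrite -RintegralZl//; last exact: boltzmann_integrable growth.
  by apply: eq_Rintegral => J _; rewrite /w expRD.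
rewrite split_int//; have p0 : 0 <= \int[lebn n]_(J in GU) w J by apply: Rintegral_ge0 => J _; exact: expR_ge0.
suff : V0 <= \int[lebn n]_(J in level G f c) w J by lra.
apply: (@le_trans _ _ (\int[lebn n]_(J in level G f c) 1)).
  by rewrite Rintegral_cst ?mul1r//; exact: measurable_level.
apply: le_Rintegral; first exact: measurable_level.
- apply/integrableP; split; first exact: measurable_cst.
  rewrite integral_cst/=; last exact: measurable_level.
  apply: lte_mul_pinfty => //.
  by apply: (le_lt_trans _ (ltry (lvol G f c))); rewrite (lvolE oG cf a0 growth).
- by apply: (integrableS mG) => //; [exact: measurable_level|move=> J []].
by move=> J [GJ /= fJ]; rewrite /w -[leLHS]expR0 ler_expR; lra.
Qed.

(** Two cases for q = V(c + 1) / V(c), with threshold exp(1 - 1 / j) and j = 2 n + 1. Each case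
    bounds [w] and [y] by M V(c) on one side of c; the balance then bounds [y] on the other side,
    and there [w] is at most a multiple of [y] except in a slab next to c, whose volume is
    controlled directly. M is 9 (j + 1)^2 and covers both cases. *)
Lemma partition_le_mean_level_vol (M : R) : M = 9 * (2 * n%:R + 2) ^+ 2 ->
  expR c * Z <= (4 + 2 * M + M * (2 * n%:R / g)) * V0.
Proof.
move=> ME.
have -> : expR c * Z = \int[lebn n]_(J in G) w J.
  rewrite -RintegralZl//; last exact: boltzmann_integrable growth.
  by apply: eq_Rintegral => J _; rewrite /w expRD.
rewrite split_int//.
(* On [G] the energy is at least c - 2 n; one more unit is taken because slabs are open below. So j
   unit slabs exhaust the part below c. *)
pose j := (2 * n).+1; have jE : j%:R = 2 * n%:R + 1 :> R by rewrite /j -natr1 natrM.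
have j0 : (0 : R) < j%:R by rewrite ltr0n.
have M0 : 0 <= M by rewrite ME mulr_ge0// sqr_ge0.
pose q := lvol G f (c + 1) / V0.
have qE : lvol G f (c + 1) = q * V0 by rewrite divfK// lt0r_neq0.
have q0 : 0 < q.
  by rewrite -(pmulr_lgt0 _ V00) -qE (lt_le_trans V00)//; apply: lvol_le growth _ _ _ => //; lra.
have e3 := @expR1_le3 R; have e0 := expR_gt0 (1 : R).
have GL : level G f c = slab G f (c - j%:R) c.
  apply/seteqP; split => J [GJ /=] hJ; split => //=; last by case/andP: hJ.
  by rewrite hJ andbT; have := mean_energy_gap_le GJ; rewrite jE; lra.
have wp J : 0 <= w J by exact: expR_ge0.
have yp J : 0 <= y J by rewrite mulr_ge0 ?expR_ge0.
(* In the first case V(c - k) <= exp(- k (1 - 1 / j)) V(c), and as k < j the loss exp(k / j) is at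
   most e: each of the j slabs contributes at most 9 j V(c). *)
have [qj|qj] := leP (expR (1 - j%:R^-1)) q.
  have low (F : 'rV[R]_n -> R) : (lebn n).-integrable G (fun J => (F J)%:E) ->
      (forall (k : nat) J, slab G f (c - k.+1%:R) (c - k%:R) J -> F J <= k.+1%:R * expR k.+1%:R) ->
      \int[lebn n]_(J in level G f c) F J <= M * V0.
    move=> iF HF; rewrite GL.
    have K0 (k : nat) : 0 <= k.+1%:R * expR k.+1%:R :> R by rewrite mulr_ge0 ?expR_ge0.
    apply: (le_trans (slab_sum_down_le oG cf a0 growth j iF K0 HF)).
    apply: (@le_trans _ _ (\sum_(k < j) (9 * j%:R * V0))).
      apply: ler_sum => k _; have kj := ltn_ord k.
      have kj' : k%:R <= j%:R - 1 :> R by rewrite lerBrDr natr1 ler_nat.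
      have dn := @lvol_down_le R n G f a b oG cG cf vf a0 growth c q V00 qE k.
      have : expR (1 - j%:R^-1) ^+ k * lvol G f (c - k%:R) <= V0.
        by apply: le_trans dn; rewrite ler_wpM2r ?vol0// lerXn2r ?nnegrE ?expR_ge0// ltW.
      rewrite -expRM_natl => dn2.
      have E : expR k.+1%:R <= 9 * expR (k%:R * (1 - j%:R^-1)) :> R.
        apply: (@le_trans _ _ (expR 1 * expR 1 * expR (k%:R * (1 - j%:R^-1)))); last first.
          by rewrite ler_wpM2r ?expR_ge0//; nra.
        rewrite -!expRD ler_expR -natr1 mulrBr mulr1.
        have : k%:R * j%:R^-1 <= 1 :> R by rewrite ler_pdivrMr// mul1r; lra.
        lra.
      have v0 := vol0 (c - k%:R).
      apply: (@le_trans _ _ (k.+1%:R * (9 * expR (k%:R * (1 - j%:R^-1))) * lvol G f (c - k%:R))).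
        by rewrite ler_wpM2r// ler_wpM2l.
      rewrite (_ : k.+1%:R * (9 * expR (k%:R * (1 - j%:R^-1))) * lvol G f (c - k%:R) =
         (9 * k.+1%:R) * (expR (k%:R * (1 - j%:R^-1)) * lvol G f (c - k%:R))); last by ring.
      by rewrite ler_pM ?mulr_ge0 ?expR_ge0// ler_wpM2l// ler_nat.
    rewrite sumr_const card_ord -[leLHS]mulr_natl ME.
    have -> : j%:R * (9 * j%:R * V0) = 9 * j%:R ^+ 2 * V0 by ring.
    by rewrite ler_pM2r// ler_pM2l// lerXn2r ?nnegrE ?jE//; have := nR; lra.
  have Lw : \int[lebn n]_(J in level G f c) w J <= M * V0.
    apply: low => // k J [GJ /= /andP[h1 h2]]; rewrite /w.
    apply: (@le_trans _ _ (expR k.+1%:R)); first by rewrite ler_expR; lra.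
    by rewrite ler_peMl ?expR_ge0// ler1n.
  have Ly : \int[lebn n]_(J in level G f c) y J <= M * V0.
    apply: low => // k J [GJ /= /andP[h1 h2]]; rewrite /y; apply: ler_pM; rewrite ?expR_ge0//.
      have k0 : (0 : R) <= k%:R by [].
      by rewrite ler0_norm; lra.
    by rewrite ler_expR; lra.
  (* In the slab of height h one has w <= 1, and its volume is at most V(c) by [upper_double]; above
     it w <= y / h. *)
  have Uw : \int[lebn n]_(J in GU) w J <= V0 + h^-1 * (M * V0).
    pose T := G `&` [set J | c + h < f J].
    have U : slab G f c (c + h) `|` T = GU.
      apply/seteqP; split => J; first by case=> -[GJ /=]; [case/andP => h1 h2|move=> h1]; split => //=; have := h0; lra.
      by move=> [GJ /= h1]; case: (leP (f J) (c + h)) => h2; [left|right]; split => //=; rewrite h1.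
    have mT : measurable T.
      rewrite (_ : T = G `\` level G f (c + h)); first by apply: measurableD => //; exact: measurable_level.
      apply/seteqP; split => J.
        by move=> [GJ /= h1]; split => // -[_ /=]; rewrite leNgt h1.
      by move=> [GJ h1]; split => //=; rewrite ltNge; apply/negP => h2; apply: h1; split.
    have GUG : GU `<=` G by move=> J [].
    have TG : T `<=` G by move=> J [].
    rewrite -U Rintegral_setU//; first last.
    - by apply/disj_setPS => J [[_ /= /andP[_ h1]] [_ /= h2]]; have := lt_le_trans h2 h1; rewrite ltxx.
    - by rewrite U; exact: (integrableS mG).
    - exact: measurable_slab.
    apply: lerD.
      apply: (le_trans (slab_integral_le oG cf a0 growth (K := 1) _ iw _)); first by have := h0; lra.
        by move=> J [GJ /= /andP[h1 h2]]; rewrite /w -[leRHS]expR0 ler_expR; lra.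
      by rewrite mul1r; have := upper_double; rewrite -/V0; lra.
    apply: (@le_trans _ _ (\int[lebn n]_(J in T) (h^-1 * y J))).
      apply: le_Rintegral => //; [exact: (integrableS mG)|by apply: integrable_scale => //; exact: (integrableS mG)|].
      move=> J [GJ /= h1]; rewrite /y /w mulrA ler_peMl ?expR_ge0// ler_pdivlMl// mulr1.
      by rewrite gtr0_norm; have := h0; lra.
    rewrite RintegralZl//; last exact: (integrableS mG).
    rewrite ler_wpM2l ?invr_ge0 ?(ltW h0)//; apply: le_trans Ly; rewrite -balance.
    apply: Rintegral_le_subset => //; last exact: (integrableS mG).
    by move=> J [GJ /= h1]; split => //=; have := h0; lra.
  have -> : 2 * n%:R / g = h^-1 by rewrite /h invf_div.
  have := mulr_ge0 M0 (ltW V00); have := V00; lra.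
(* Second case: growth at a rate below 1 - 1 / j makes the upper series geometric with ratio exp(- 1
   / j). *)
have [||Uy Uw] := @upper_series (expR (- j%:R^-1)) (3 * V0).
- rewrite expR_ge0/= -[ltRHS]expR0 ltr_expR oppr_lt0 invr_gt0//.
- move=> k; have up := @lvol_up_le R n G f a b oG cG cf vf a0 growth c q V00 qE k.+1.
  have v0 := vol0 (c + k%:R).
  apply: (@le_trans _ _ (expR (- k%:R) * (expR (1 - j%:R^-1) ^+ k.+1 * V0))).
    rewrite ler_wpM2l ?expR_ge0//; apply: (@le_trans _ _ (lvol G f (c + k.+1%:R))); first by lra.
    apply: (le_trans up); rewrite ler_wpM2r ?(ltW V00)// lerXn2r ?nnegrE ?expR_ge0 ?(ltW q0)//; exact: ltW.
  rewrite mulrA [leRHS]mulrAC ler_pM2r// -!expRM_natl -expRD.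
  apply: (@le_trans _ _ (expR 1 * expR (k%:R * - j%:R^-1))); last by rewrite ler_wpM2r ?expR_ge0.
  rewrite -expRD ler_expR -natr1.
  have : (0 : R) <= j%:R^-1 by rewrite invr_ge0 ltW.
  lra.
have gap : j.+1%:R^-1 <= 1 - expR (- j%:R^-1) :> R by exact: expR_inv_nat_gap.
have jj : (0 : R) < j.+1%:R^-1 by rewrite invr_gt0.
have DM : 3 * V0 * ((1 - expR (- j%:R^-1)) ^+ 2)^-1 <= M * V0.
  rewrite mulrAC ler_pM2r// ME.
  apply: (@le_trans _ _ (9 * (j.+1%:R^-1 ^+ 2)^-1)); last first.
    by rewrite exprVn invrK -(natr1 j) jE (_ : 2 * n%:R + 1 + 1 = 2 * n%:R + 2)//; ring.
  apply: ler_pM; [by []|by rewrite invr_ge0 sqr_ge0|by rewrite ler_nat|].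
  have p0 : 0 < 1 - expR (- j%:R^-1) :> R by exact: lt_le_trans gap.
  rewrite lef_pV2 ?posrE ?exprn_gt0//.
  by rewrite lerXn2r ?nnegrE//; lra.
(* In the unit slab below c one has w <= e <= 3; further down w <= y. *)
have Lw : \int[lebn n]_(J in level G f c) w J <= 3 * V0 + M * V0.
  have U : slab G f (c - 1) c `|` level G f (c - 1) = level G f c.
    apply/seteqP; split => J; first by case=> -[GJ /=]; [case/andP => h1 h2|move=> h1]; split => //=; lra.
    by move=> [GJ /= h1]; case: (leP (f J) (c - 1)) => h2; [right|left]; split => //=; rewrite h1 andbT.
  have LG v : level G f v `<=` G by move=> J [].
  rewrite -U Rintegral_setU; first last.
  - by apply/disj_setPS => J [[_ /= /andP[h1 _]] [_ /= h2]]; have := lt_le_trans h1 h2; rewrite ltxx.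
  - by rewrite U; apply: (integrableS mG) => //; exact: measurable_level.
  - exact: measurable_level.
  - exact: measurable_slab.
  apply: lerD.
    apply: (le_trans (slab_integral_le oG cf a0 growth (K := 3) _ iw _)); first by lra.
      by move=> J [GJ /= /andP[h1 h2]]; rewrite /w; apply: le_trans e3; rewrite ler_expR; lra.
    by have := vol0 (c - 1); rewrite -/V0; lra.
  apply: le_trans DM; apply: le_trans Uy; rewrite balance.
  apply: (@le_trans _ _ (\int[lebn n]_(J in level G f (c - 1)) y J)).
    apply: le_Rintegral; first exact: measurable_level.
    - by apply: (integrableS mG) => //; exact: measurable_level.
    - by apply: (integrableS mG) => //; exact: measurable_level.
    move=> J [GJ /= h1]; rewrite /y /w ler_peMl ?expR_ge0// ler0_norm; lra.
  apply: Rintegral_le_subset; try exact: measurable_level; last 2 first.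
  - exact: yp.
  - by apply: (integrableS mG) => //; exact: measurable_level.
  by move=> J [GJ /= h1]; split => //=; lra.
have gn : 0 <= M * (2 * n%:R / g) * V0.
  by apply: mulr_ge0; [apply: mulr_ge0 => //; apply: divr_ge0; [exact: mulr_ge0|exact: ltW]|exact: ltW].
have := le_trans Uw DM; have := V00; lra.
Qed.

End mean_energy.

(** * Coverings by balls *)

Section covering.
Context {R : realType} (n : nat) (n0 : (0 < n)%N).
Implicit Types (S : seq 'rV[R]_n) (D X : set 'rV[R]_n).

Definition inball (r : R) (x : 'rV[R]_n) : pred 'rV[R]_n := fun p => enorm (x - p) <= r.

Let w := ball_vol R n.

Let w0 : 0 < w. Proof. exact: ball_vol_gt0. Qed.

(** Double counting: the integral over [X] of the number of balls containing a point is the sum of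
    their volumes. *)
Lemma count_ball_le X (W : R) S (r : R) (k : nat) : measurable X -> lebn n X = W%:E -> 0 < r ->
  (forall p, p \in S -> eball p r `<=` X) ->
  (forall x, (count (inball r x) S <= k)%N) ->
  (size S)%:R * (w * r ^+ n) <= k%:R * W.
Proof.
move=> mX XW r0 SX Sk.
have cE x : \sum_(p <- S) \1_(eball p r) x = (count (inball r x) S)%:R :> R.
  elim: S {SX Sk} => [|p S IH]; first by rewrite big_nil.
  rewrite big_cons /= natrD IH indicE; congr (_ + _); congr (_%:R).
  by rewrite /inball; case: (boolP (_ <= r)) => h; [rewrite mem_set|rewrite memNset//; exact/negP].
have mE p : measurable_fun setT (fun v => (\1_(eball p r) v)%:E : \bar R).
  by apply: measurable_indicE; exact: measurable_eball.
rewrite -lee_fin [leRHS]EFinM -XW.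
have -> : ((size S)%:R * (w * r ^+ n))%:E = (\int[lebn n]_x \sum_(p <- S) (\1_(eball p r) x)%:E)%E.
  rewrite ge0_integral_sum//.
  rewrite (eq_bigr (fun=> (w * r ^+ n)%:E)) => [|p _]; last first.
    by rewrite -lebnE ?lebn_eball//; exact: measurable_eball.
  by rewrite sumEFin big_const_seq count_predT iter_addr_0 mulr_natl.
rewrite (lebnE mX) -ge0_integralZl_EFin//; last exact: measurable_indicE.
apply: ge0_le_integral => //.
- by move=> x _; apply: sume_ge0.
- exact: emeasurable_sum.
- by apply: measurable_funeM; exact: measurable_indicE.
move=> x _; rewrite sumEFin cE -EFinM lee_fin indicE.
have [xX|xX] := pselect (X x); first by rewrite mem_set// mulr1 ler_nat.
rewrite memNset// mulr0 lern0 -leqn0 leqNgt -has_count; apply/hasPn => p pS.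
by apply/negP => h; apply: xX; exact: SX h.
Qed.

Lemma count_separated_le1 S (d : R) x : pairwise (fun p q => d < enorm (p - q)) S ->
  (count (inball (d / 2) x) S <= 1)%N.
Proof.
elim: S => //= p S IH /andP[pS /IH h].
case: (boolP (inball (d / 2) x p)) => //= hp.
rewrite -[leqRHS]addn0 leq_add2l leqNgt -has_count; apply/hasPn => q qS; apply/negP => hq.
have := allP pS q qS; have := enormB p x q; rewrite (enormC p x).
by move: hp hq; rewrite /inball; lra.
Qed.

Lemma separated_net D X (W d : R) : measurable X -> lebn n X = W%:E -> 0 < d ->
  (forall p, D p -> eball p (d / 2) `<=` X) ->
  exists S, [/\ forall p, p \in S -> D p, (size S)%:R * (w * (d / 2) ^+ n) <= W &
    forall y, D y -> exists2 p, p \in S & enorm (y - p) <= d].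
Proof.
move=> mX XW d0 DX; have d2 : 0 < d / 2 by rewrite divr_gt0.
pose sep S := (forall p, p \in S -> D p) /\ pairwise (fun p q => d < enorm (p - q)) S.
have sepW S : sep S -> (size S)%:R * (w * (d / 2) ^+ n) <= W.
  move=> [SD Sd]; have := @count_ball_le X W S (d / 2) 1 mX XW d2; rewrite mul1r; apply.
    by move=> p pS; apply: DX; exact: SD.
  by move=> x; exact: count_separated_le1.
have c0 : 0 < w * (d / 2) ^+ n by rewrite mulr_gt0 ?exprn_gt0.
pose P k := `[< exists2 S, size S = k & sep S >].
have exP : exists k, P k by exists 0%N; apply/asboolP; exists [::].
have bP k : P k -> (k <= Num.bound (W / (w * (d / 2) ^+ n)))%N.
  move=> /asboolP[S <- sS]; rewrite -(ler_nat R); apply/ltW.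
  have h : (size S)%:R <= W / (w * (d / 2) ^+ n) by rewrite ler_pdivlMr ?sepW.
  by apply: (le_lt_trans h); apply: archi_boundP; apply: le_trans h.
case: (ex_maxnP exP bP) => k /asboolP[S Sk sS] kmax.
exists S; split; [by case: sS|exact: sepW|].
move=> y Dy; apply: contrapT => H; have := kmax k.+1; rewrite ltnn => F; suff : false by []; apply: F.
apply/asboolP; exists (y :: S); first by rewrite /= Sk.
split=> [p|/=]; first by rewrite inE => /orP[/eqP->//|]; exact: sS.1.
rewrite sS.2 andbT; apply/allP => q qS; rewrite ltNge; apply/negP => h; apply: H.
by exists q.
Qed.

(* Averaging gives a point that covers at least the average number of uncovered points. *)
Lemma greedy_cover X (W : R) S (r : R) (t : nat) : measurable X -> lebn n X = W%:E -> 0 < r ->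
  w * r ^+ n <= W -> (forall p, p \in S -> eball p r `<=` X) ->
  exists xs T, [/\ (size xs <= t)%N, {subset T <= S},
     (size T)%:R <= (1 - w * r ^+ n / W) ^+ t * (size S)%:R &
     forall p, p \in S -> p \in T \/ exists2 x, x \in xs & enorm (x - p) <= r].
Proof.
move=> mX XW r0 mW SX; have m0 : 0 < w * r ^+ n by rewrite mulr_gt0 ?exprn_gt0.
have W0 : 0 < W by exact: lt_le_trans mW.
have q0 : 0 <= 1 - w * r ^+ n / W by rewrite subr_ge0 ler_pdivrMr// mul1r.
elim: t => [|t [xs [T [xst TS Tt ST]]]].
  by exists [::], S; split => //; [rewrite expr0 mul1r|left].
pose P k := `[< exists x, count (inball r x) T = k >].
have exP : exists k, P k by exists (count (inball r 0) T); apply/asboolP; exists 0.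
have bP k : P k -> (k <= size T)%N by move=> /asboolP[x <-]; exact: count_size.
case: (ex_maxnP exP bP) => k /asboolP[x xk] kmax.
have TX p : p \in T -> eball p r `<=` X by move=> /TS; exact: SX.
have H := count_ball_le mX XW r0 TX (fun y => kmax _ (introT (asboolP _) (ex_intro _ y erefl))).
exists (x :: xs), [seq p <- T | ~~ inball r x p]; split => //=.
- by move=> p; rewrite mem_filter => /andP[_ /TS].
- rewrite size_filter; have := count_predC (inball r x) T; rewrite xk => E.
  have -> : (count (fun p => ~~ inball r x p) T)%:R = (size T)%:R - k%:R :> R.
    by rewrite -E natrD addrC addKr.
  rewrite exprS -mulrA; apply: (@le_trans _ _ ((1 - w * r ^+ n / W) * (size T)%:R)); last by rewrite ler_wpM2l.
  rewrite mulrBl mul1r lerD2l lerN2 mulrAC ler_pdivrMr// mulrC [leLHS]mulrC.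
  by rewrite mulrC.
move=> p /ST[pT|[y yx yp]]; last by right; exists y; rewrite // inE yx orbT.
case: (boolP (inball r x p)) => h; first by right; exists x; rewrite // inE eqxx.
by left; rewrite mem_filter h.
Qed.

(** A net of mesh r / (2 n) has at most (4 n)^n W / (w r^n) points, and (4 n)^n <= exp(4 n^2). After
    [j] greedy steps the fraction left is at most exp(- 4 n^2), so no more than W / (w r^n) points
    remain. *)
Let remainder_count_le (s t W r m : R) (j : nat) : 0 < r -> 0 < m -> 0 < W -> m <= W ->
  W / m * (4 * n%:R ^+ 2) <= j%:R -> t <= (1 - m / W) ^+ j * s ->
  s * (w * ((2 * n%:R)^-1 * r / 2) ^+ n) <= W -> 0 <= s -> t * (w * r ^+ n) <= W.
Proof.
move=> r0 m0 W0 mW uj ts sW s0; have nR : (0 : R) < n%:R by rewrite ltr0n.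
have rn0 : 0 < r ^+ n by rewrite exprn_gt0.
have q0 : 0 <= 1 - m / W by rewrite subr_ge0 ler_pdivrMr// mul1r.
have q1 : (1 - m / W) ^+ j <= expR (- (4 * n%:R ^+ 2)).
  apply: (@le_trans _ _ (expR (- (m / W)) ^+ j)).
    by rewrite lerXn2r ?nnegrE ?expR_ge0//; have := expR_ge1Dx (- (m / W)).
  rewrite -expRM_natl ler_expR mulrN lerN2.
  have -> : 4 * n%:R ^+ 2 = W / m * (4 * n%:R ^+ 2) * (m / W).
    by field; rewrite !lt0r_neq0.
  by rewrite ler_wpM2r// divr_ge0// ltW.
have S4 : s * (w * r ^+ n) <= W * expR (4 * n%:R ^+ 2).
  have E : r ^+ n = (4 * n%:R) ^+ n * ((2 * n%:R)^-1 * r / 2) ^+ n.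
    by rewrite -exprMn; congr (_ ^+ _); field; rewrite lt0r_neq0.
  have d0 : 0 <= (2 * n%:R)^-1 * r / 2.
    by rewrite !mulr_ge0 ?invr_ge0 ?mulr_ge0 ?(ltW r0).
  rewrite E (_ : _ * _ = s * (w * ((2 * n%:R)^-1 * r / 2) ^+ n) * (4 * n%:R) ^+ n); last by ring.
  apply: ler_pM; [by rewrite !mulr_ge0 ?exprn_ge0 ?(ltW w0)|by rewrite exprn_ge0 ?mulr_ge0|exact: sW|].
  apply: (@le_trans _ _ (expR (4 * n%:R) ^+ n)).
    by rewrite lerXn2r ?nnegrE ?expR_ge0 ?mulr_ge0//; have := expR_ge1Dx (4 * n%:R : R); lra.
  by rewrite -expRM_natl ler_expR expr2 mulrCA.
apply: (@le_trans _ _ (expR (- (4 * n%:R ^+ 2)) * (s * (w * r ^+ n)))).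
  rewrite [leRHS]mulrA ler_wpM2r ?mulr_ge0 ?(ltW w0) ?(ltW rn0)//.
  by apply: (le_trans ts); rewrite ler_wpM2r.
by rewrite expRN ler_pdivrMl ?expR_gt0// [leRHS]mulrC; exact: S4.
Qed.

(** Greedily cover a fine net of [D] by slightly smaller balls, use the few remaining net points as
    centres too, and enlarge the balls to radius [r] to pass from the net to [D]. The greedy centres
    cost 8 n^2 + 1 times the ideal number and the remainder costs 1. *)
Lemma efficient_cover D X (W r : R) : measurable X -> lebn n X = W%:E -> 0 < r ->
  (forall p, D p -> eball p r `<=` X) ->
  exists xs : seq 'rV[R]_n, (size xs)%:R * (w * r ^+ n) <= 10 * n%:R ^+ 2 * W /\
    forall y, D y -> exists2 x, x \in xs & enorm (y - x) <= r.
Proof.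
move=> mX XW r0 DX.
have nR : (1 : R) <= n%:R by rewrite ler1n.
have n20 : 1 <= n%:R ^+ 2 :> R by rewrite exprn_ege1.
have n82 : 8 * n%:R ^+ 2 + 1 + 1 <= 10 * n%:R ^+ 2 :> R by lra.
have [[z Dz]|D0] := pselect (D !=set0); last first.
  exists [::]; split; last by move=> y Dy; case: D0; exists y.
  by rewrite mul0r !mulr_ge0// -lee_fin -XW.
have wW : w * r ^+ n <= W.
  rewrite -lee_fin -XW -(lebn_eball z r0); apply: lebn_le => //; first exact: measurable_eball.
  exact: DX.
have rn0 : 0 < r ^+ n by rewrite exprn_gt0.
have W0 : 0 < W by apply: lt_le_trans wW; rewrite mulr_gt0.
(* Shrinking the radius by the factor 1 - e leaves room for the mesh e r and still keeps half of the
   volume of the ball. *)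
pose e : R := (2 * n%:R)^-1.
have e0 : 0 < e by rewrite invr_gt0 mulr_gt0// ltr0n.
have e1 : e <= 1 / 2 by case/andP: (@inv_double_nat_le R n n0).
pose r' := (1 - e) * r; have r'0 : 0 < r' by rewrite mulr_gt0//; lra.
have d0 : 0 < e * r by rewrite mulr_gt0.
have er1 : e * r <= r by rewrite ger_pMl//; lra.
have er2 : e * r / 2 <= r by lra.
have rE : e * r + r' = r by rewrite /r'; ring.
have r'r : r' <= r by rewrite /r'; lra.
have sub p (s : R) : s <= r -> eball p s `<=` eball p r by move=> sr v; rewrite /eball/= => /le_trans; apply.
have [|S [SD Sn Snet]] := separated_net mX XW d0 (D := D).
  move=> p Dp v /sub vp; apply: DX Dp _ _; exact: vp.
pose m := w * r' ^+ n.
have hm : w * r ^+ n <= 2 * m.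
  have := @half_le_exprn R n (1 - e) n0 (lexx _); rewrite /m /r' exprMn.
  have := mulr_gt0 w0 rn0; nra.
have m0 : 0 < m by rewrite mulr_gt0 ?exprn_gt0.
have mW : m <= W.
  by apply: le_trans wW; rewrite ler_pM2l// lerXn2r ?nnegrE ?(ltW r'0) ?(ltW r0).
pose u := W / m * (4 * n%:R ^+ 2).
have u0 : 0 <= u by rewrite !mulr_ge0 ?invr_ge0 ?(ltW m0) ?(ltW W0).
have [|xs [T [xst TS Tt ST]]] := greedy_cover (Num.truncn u).+1 mX XW r'0 mW (S := S).
  move=> p /SD Dp v /sub vp; apply: DX Dp _ _; exact: vp.
have tu : (Num.truncn u).+1%:R <= u + 1.
  by rewrite -natr1 lerD2r; case/andP: (truncn_itv u0).
have ut : u <= (Num.truncn u).+1%:R by apply/ltW; case/andP: (truncn_itv u0).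
exists (xs ++ T); split; last first.
  move=> y Dy; have [p pS yp] := Snet y Dy.
  case: (ST p pS) => [pT|[x xx xp]].
    by exists p; [rewrite mem_cat pT orbT|exact: le_trans er1].
  exists x; first by rewrite mem_cat xx.
  have px : enorm (p - x) <= r' by rewrite enormC; exact: xp.
  by apply: (le_trans (enormB y p x)); rewrite -rE; exact: lerD yp px.
have TW : (size T)%:R * (w * r ^+ n) <= W.
  exact: (@remainder_count_le (size S)%:R (size T)%:R W r m (Num.truncn u).+1 r0 m0 W0 mW ut Tt Sn (ler0n _ _)).
have xW : (size xs)%:R * (w * r ^+ n) <= (8 * n%:R ^+ 2 + 1) * W.
  apply: (@le_trans _ _ ((u + 1) * (w * r ^+ n))).
    rewrite ler_wpM2r ?mulr_ge0 ?(ltW w0) ?(ltW rn0)//; apply: le_trans tu.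
    by rewrite ler_nat.
  rewrite (mulrDl u) (mulrDl (8 * _)) !mul1r; apply: lerD; last exact: wW.
  apply: (@le_trans _ _ (u * (2 * m))); first by rewrite ler_wpM2l.
  by rewrite (_ : u * _ = 8 * n%:R ^+ 2 * W)// /u; field; rewrite lt0r_neq0.
rewrite size_cat natrD mulrDl; apply: (le_trans (lerD xW TW)).
by rewrite -[X in _ + X]mul1r -mulrDl ler_wpM2r ?(ltW W0)//.
Qed.

End covering.

(** * Hausdorff measure *)

Section hausdorff_measure.
Context {R : realType} (n : nat).
Implicit Types (A C D X : set 'rV[R]_n).

Lemma ediam_le C (d : R) : (forall x y, C x -> C y -> enorm (x - y) <= d) -> (ediam C <= d%:E)%E.
Proof. by move=> Cd; apply: ge_ereal_sup => _ [x Cx [y Cy <-]]; rewrite lee_fin; exact: Cd. Qed.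

Lemma le_ediam C x y : C x -> C y -> ((enorm (x - y))%:E <= ediam C)%E.
Proof. by move=> Cx Cy; apply: ereal_sup_ubound; exists x => //; exists y. Qed.

Lemma ediam_ge0 C : C !=set0 -> (0 <= ediam C)%E.
Proof. by move=> [x Cx]; have := le_ediam Cx Cx; rewrite subrr enorm0. Qed.

Lemma fine_ediam C (d : R) : C !=set0 -> (ediam C <= d%:E)%E -> 0 <= fine (ediam C) <= d.
Proof.
by move=> /ediam_ge0; case: (ediam C) => [r| |] //; rewrite !lee_fin /= => -> ->.
Qed.

Lemma hterm_ge0 k C : (0 <= hterm k C)%E.
Proof.
rewrite /hterm; case: asboolP => // /eqP/set0P C0; rewrite lee_fin mulr_ge0 ?(ltW (ball_vol_gt0 _))//.
rewrite exprn_ge0// divr_ge0//; have := ediam_ge0 C0; case: (ediam C) => [r| |]//=.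
Qed.

Lemma hterm_le k C (r : R) : 0 <= r -> (ediam C <= (2 * r)%:E)%E -> (hterm k C <= (ball_vol R k * r ^+ k)%:E)%E.
Proof.
move=> r0 Cr; rewrite /hterm; case: asboolP => [_|/eqP/set0P C0].
  by rewrite lee_fin mulr_ge0 ?exprn_ge0// ltW// ball_vol_gt0.
have /andP[d0 dr] := fine_ediam C0 Cr.
rewrite lee_fin ler_pM2l ?ball_vol_gt0// lerXn2r ?nnegrE ?divr_ge0//.
by rewrite ler_pdivrMr// mulrC.
Qed.

Lemma hausdorff_delta_le_cover k A (r : R) (xs : seq 'rV[R]_n) : 0 < r ->
  (forall y, A y -> exists2 x, x \in xs & enorm (y - x) <= r) ->
  (hausdorff_delta k (2 * r) A <= ((size xs)%:R * (ball_vol R k * r ^+ k))%:E)%E.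
Proof.
(* The sequence is padded with empty sets, which [hterm] counts as 0 even for k = 0, where the power
   would be 1. *)
move=> r0 Ax; pose C i := if (i < size xs)%N then eball (nth 0 xs i) r else set0.
have Cd i : (ediam (C i) <= (2 * r)%:E)%E.
  apply: ediam_le => x y; rewrite /C; case: ifP => // _ hx hy.
  by have := enormB x (nth 0 xs i) y; move: hx hy; rewrite /eball/= (enormC y); lra.
apply: (@le_trans _ _ (\sum_(0 <= i <oo) hterm k (C i))%E).
  apply: ereal_inf_lbound; exists C => //; split=> // y /Ax[x xxs yx].
  by exists (index x xs) => //; rewrite /C index_mem xxs nth_index.
rewrite (@nneseries_split _ _ 0 (size xs)); last by move=> i _; exact: hterm_ge0.
rewrite add0n eseries0; last first.
  move=> i hi _; rewrite /C ltnNge hi/= /hterm; case: asboolP => //.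
rewrite adde0; apply: (@le_trans _ _ (\sum_(0 <= i < size xs) (ball_vol R k * r ^+ k)%:E)%E).
  by apply: lee_sum => i _; apply: hterm_le (Cd i); exact: ltW.
by rewrite sumEFin big_const_nat subn0 iter_addr_0 mulr_natl.
Qed.

Lemma hausdorff_delta_antimono k A (d e : R) : d <= e -> (hausdorff_delta k e A <= hausdorff_delta k d A)%E.
Proof.
move=> de; apply: le_ereal_inf_tmp => _ [C [AC Cd] <-]; apply: ereal_inf_lbound; exists C => //; split=> // i.
by apply: (le_trans (Cd i)); rewrite lee_fin.
Qed.

Lemma hausdorff_le k A (B : \bar R) (r0 : R) : 0 < r0 ->
  (forall r, 0 < r -> r <= r0 -> (hausdorff_delta k (2 * r) A <= B)%E) -> (hausdorff k A <= B)%E.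
Proof.
move=> r00 H; apply: ge_ereal_sup => _ [d /= d0 <-].
have m0 : 0 < Num.min r0 (d / 2) by rewrite lt_min r00 divr_gt0.
apply: le_trans (H _ m0 _); last by rewrite ge_min lexx.
apply: hausdorff_delta_antimono; rewrite -ler_pdivlMl// mulrC ge_min lexx orbT//.
Qed.

Lemma hausdorff_delta_le k A (d : R) : 0 < d -> (hausdorff_delta k d A <= hausdorff k A)%E.
Proof. by move=> d0; apply: ereal_sup_ubound; exists d. Qed.

(** If neighbourhoods of radius r have volume at most K r, efficient coverings need about K r / (w
    r^n) balls of radius r. Replacing the weight of a ball in dimension n by that in dimension n - 1
    costs 1 / r and one more factor n. *)
Lemma hausdorff_le_minkowski D (K r0 : R) : (0 < n)%N -> 0 < r0 ->
  (forall r, 0 < r -> r <= r0 -> exists X (W : R),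
    [/\ measurable X, lebn n X = W%:E, W <= K * r & forall p, D p -> eball p r `<=` X]) ->
  (hausdorff n.-1 D <= (10 * n%:R ^+ 3 * K)%:E)%E.
Proof.
move=> n0 r00 H; apply: (hausdorff_le r00) => r rp rr0.
have [X [W [mX XW WK DX]]] := H r rp rr0.
have [xs [xsW Dxs]] := efficient_cover n0 mX XW rp DX.
apply: (le_trans (hausdorff_delta_le_cover _ rp Dxs)); rewrite lee_fin.
have w1 : ball_vol R n.-1 <= n%:R * ball_vol R n by have := @ball_vol_recl R n.-1; rewrite prednK.
have rE : r ^+ n = r ^+ n.-1 * r by rewrite -exprSr prednK.
apply: (@le_trans _ _ ((size xs)%:R * (n%:R * ball_vol R n * r ^+ n.-1))).
  by rewrite ler_wpM2l// ler_wpM2r// exprn_ge0// ltW.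
rewrite -(ler_pM2r rp).
rewrite (_ : _ * r = n%:R * ((size xs)%:R * (ball_vol R n * r ^+ n))); last by rewrite rE; ring.
apply: (@le_trans _ _ (n%:R * (10 * n%:R ^+ 2 * (K * r)))); last by rewrite le_eqVlt; apply/orP; left; apply/eqP; ring.
rewrite ler_wpM2l//; apply: (le_trans xsW); rewrite ler_wpM2l// mulr_ge0// exprn_ge0//.
Qed.

(** Sets in a Hausdorff covering are arbitrary; the closure is measurable and satisfies the same
    diameter bound. *)
Lemma isodiametric_outer A (d : R) : 0 < d -> (forall x y, A x -> A y -> enorm (x - y) <= d) ->
  exists E, [/\ measurable E, A `<=` E & (lebn n E <= (ball_vol R n * (d / 2) ^+ n)%:E)%E].
Proof.
move=> d0 Ad; exists (closure A); split; [|exact: subset_closure|].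
  by apply: closed_measurable_mx; exact: closed_closure.
have sub (B C : set 'rV[R]_n) : closed C -> B `<=` C -> closure B `<=` C.
  by move=> cC BC; rewrite (closure_id C).1//; exact: closure_subset.
apply: isodiametric => //; first by apply: closed_measurable_mx; exact: closed_closure.
have h y : A y -> closure A `<=` eball y d.
  by move=> Ay; apply: sub; [exact: closed_eball|move=> x Ax; exact: Ad].
move=> x y cx cy; suff : closure A `<=` eball y d by move=> /(_ x cx).
apply: sub; first exact: closed_eball.
by move=> z Az; have := h z Az y cy; rewrite /eball/= enormC.
Qed.

Lemma finite_union_outer (A : nat -> set 'rV[R]_n) (B : R) (M : nat) : 0 <= B ->
  (forall j, exists E, [/\ measurable E, A j `<=` E & (lebn n E <= B%:E)%E]) ->
  exists E, [/\ measurable E, forall j, (j < M)%N -> A j `<=` E & (lebn n E <= (M%:R * B)%:E)%E].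
Proof.
move=> B0 H; elim: M => [|M [E [mE AE EB]]].
  by exists set0; split=> //; rewrite measure0 mul0r.
have [F [mF AF FB]] := H M; exists (E `|` F); split; first exact: measurableU.
  move=> j; rewrite ltnS leq_eqVlt => /orP[/eqP->|/AE jE]; first by apply: (subset_trans AF); exact: subsetUr.
  by apply: (subset_trans jE); exact: subsetUl.
apply: (le_trans (measureU2 _ _ _)) => //; rewrite -natr1 mulrDl mul1r EFinD; exact: leeD.
Qed.

Section cone.
Variables (J0 : 'rV[R]_n) (T tau : R).
Hypotheses (n0 : (0 < n)%N) (T0 : 0 < T) (tau0 : 0 < tau).

Definition cone D := [set J | exists x s, [/\ D x, 1 <= s <= 1 + tau & J = J0 + s *: (x - J0)]].

(** Number of slices times half their diameter, (tau n T + 2) / 2, times 2 from the comparison of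
    unit ball volumes in dimensions n and n - 1, times a bound for (1 + tau + 1 / n)^n. *)
Definition cone_const : R := (tau * n%:R * T + 2) * expR (n%:R * tau + 1).

(* The cone over a piece of diameter d is cut into slabs of width d / n, so that cutting costs a factor e in volume. *)
Lemma cone_cell C (d : R) : 0 < d -> d <= 2 -> (forall x, C x -> enorm (x - J0) <= T) ->
  (forall x y, C x -> C y -> enorm (x - y) <= d) ->
  exists E, [/\ measurable E, cone C `<=` E &
    (lebn n E <= (cone_const * (ball_vol R n.-1 * (d / 2) ^+ n.-1))%:E)%E].
Proof.
move=> d0 d2 CT Cd; have nR : (0 : R) < n%:R by rewrite ltr0n.
pose eta := d / (n%:R * T); have eta0 : 0 < eta by rewrite divr_gt0// mulr_gt0.
pose A (j : nat) := [set J | exists x s, [/\ C x, 1 <= s <= 1 + tau,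
  1 + j%:R * eta <= s <= 1 + j.+1%:R * eta & J = J0 + s *: (x - J0)]].
pose L := d * (1 + tau + n%:R^-1).
have L0 : 0 < L by rewrite mulr_gt0// addr_gt0 ?addr_gt0// invr_gt0.
pose B := ball_vol R n * (L / 2) ^+ n.
have B0 : 0 <= B by rewrite mulr_ge0 ?exprn_ge0 ?divr_ge0 ?(ltW L0)// ltW// ball_vol_gt0.
have HA j : exists E, [/\ measurable E, A j `<=` E & (lebn n E <= B%:E)%E].
  apply: isodiametric_outer => // J J' [x [s [Cx /andP[s1 st] /andP[sl su] ->]]] [y [t [Cy /andP[t1 tt] /andP[tl tu] ->]]].
  have -> : J0 + s *: (x - J0) - (J0 + t *: (y - J0)) = s *: (x - y) + (s - t) *: (y - J0).
    by apply/rowP => i; rewrite !mxE; ring.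
  apply: (le_trans (enormD _ _)); rewrite !enormZ.
  have st' : `|s - t| <= eta by rewrite ler_norml; rewrite -natr1 in su tu; lra.
  apply: (@le_trans _ _ ((1 + tau) * d + eta * T)).
    have s0 : 0 <= s by lra.
    apply: lerD; apply: ler_pM; rewrite ?enorm_ge0//; last exact: CT.
      by rewrite ger0_norm.
    exact: Cd.
  rewrite /L /eta le_eqVlt; apply/orP; left; apply/eqP; field; rewrite !lt0r_neq0//.
have u0 : 0 <= tau / eta by rewrite divr_ge0 ?ltW.
pose M := (Num.truncn (tau / eta)).+1.
have [E [mE AE EB]] := finite_union_outer M B0 HA; exists E; split=> //.
  move=> J [x [s [Cx s1 ->]]].
  have v0 : 0 <= (s - 1) / eta by rewrite divr_ge0 ?(ltW eta0)// subr_ge0; case/andP: s1.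
  have /andP[jl ju] := truncn_itv v0.
  apply: (AE (Num.truncn ((s - 1) / eta))).
    rewrite ltnS; apply: le_truncn; rewrite ler_pM2r ?invr_gt0//; lra.
  exists x, s; split=> //; rewrite ler_pdivlMr// in jl; rewrite ltr_pdivrMr// in ju.
  by apply/andP; split; lra.
apply: (le_trans EB); rewrite lee_fin.
have w2 : ball_vol R n <= 2 * ball_vol R n.-1 by have := @ball_vol_recr R n.-1; rewrite prednK.
have w1 := @ball_vol_gt0 R n.-1.
have dE : (d / 2) ^+ n = (d / 2) ^+ n.-1 * (d / 2) by rewrite -exprSr prednK.
have dn : 0 < (d / 2) ^+ n.-1 by rewrite exprn_gt0// divr_gt0.
have e1 : (1 + tau + n%:R^-1) ^+ n <= expR (n%:R * tau + 1).
  apply: (@le_trans _ _ (expR (tau + n%:R^-1) ^+ n)).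
    rewrite lerXn2r ?nnegrE ?expR_ge0 ?addr_ge0 ?(ltW tau0) ?invr_ge0//.
    by have := expR_ge1Dx (tau + n%:R^-1); rewrite addrA.
  by rewrite -expRM_natl mulrDr divff ?lt0r_neq0.
have Md : M%:R * (d / 2) <= (tau * n%:R * T + 2) / 2.
  apply: (@le_trans _ _ ((tau / eta + 1) * (d / 2))).
    rewrite ler_wpM2r ?divr_ge0 ?(ltW d0)// /M -natr1 lerD2r.
    by case/andP: (truncn_itv u0).
  have -> : tau / eta = tau * n%:R * T / d by rewrite /eta; field; rewrite !lt0r_neq0.
  rewrite mulrDl mul1r (_ : tau * n%:R * T / d * (d / 2) = tau * n%:R * T / 2); last by field; rewrite lt0r_neq0.
  lra.
rewrite /B /cone_const.
have -> : (L / 2) ^+ n = (d / 2) ^+ n.-1 * (d / 2) * (1 + tau + n%:R^-1) ^+ n.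
  by rewrite -dE -exprMn /L; congr (_ ^+ _); ring.
rewrite (_ : M%:R * _ = (M%:R * (d / 2)) * ((1 + tau + n%:R^-1) ^+ n) * (ball_vol R n * (d / 2) ^+ n.-1)); last by ring.
rewrite (_ : _ * (ball_vol R n.-1 * _) = ((tau * n%:R * T + 2) / 2 * expR (n%:R * tau + 1)) * (2 * ball_vol R n.-1 * (d / 2) ^+ n.-1)); last by field.
have a0 : 0 <= M%:R * (d / 2) by rewrite mulr_ge0 ?divr_ge0 ?(ltW d0).
have b0 : 0 <= (1 + tau + n%:R^-1) ^+ n by rewrite exprn_ge0// !addr_ge0 ?(ltW tau0) ?invr_ge0.
apply: ler_pM; [exact: mulr_ge0|by rewrite mulr_ge0 ?(ltW dn)// ltW// ball_vol_gt0| |by rewrite ler_pM2r].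
exact: ler_pM.
Qed.

(** A piece may have diameter 0, while the cells of the cone are built from a positive d. By
    continuity d can be taken slightly larger than the diameter at an arbitrarily small cost. *)
Lemma hterm_approx (k : nat) C (e : R) : C !=set0 -> (ediam C <= 1%:E)%E -> 0 < e ->
  exists d, [/\ 0 < d, d <= 2, forall x y, C x -> C y -> enorm (x - y) <= d &
    ((ball_vol R k * (d / 2) ^+ k)%:E <= hterm k C + e%:E)%E].
Proof.
move=> C0 C1 e0; rewrite /hterm; case: asboolP => [E|_]; first by move: C0; rewrite E => -[].
have /andP[] := fine_ediam C0 C1; set d := fine _ => d0 d1.
have cf : {for d, continuous (fun t : R => ball_vol R k * (t / 2) ^+ k)}.
  apply: cvgM; first exact: cvg_cst.
  by apply: (@continuous_comp _ _ _ (fun t : R => t / 2) (fun t => t ^+ k)); [exact: mulrr_continuous|exact: exprn_continuous].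
have [t t0 Ht] : exists2 t, 0 < t & forall y, `|d - y| < t -> ball_vol R k * (y / 2) ^+ k < ball_vol R k * (d / 2) ^+ k + e.
  have := cf [set y | y < ball_vol R k * (d / 2) ^+ k + e].
  move=> /(_ _)[]; first by apply: open_nbhs_nbhs; split; [exact: open_lt|rewrite /= ltrDl].
  by move=> t /= t0 H; exists t => // y; exact: H.
pose s := Num.min (t / 2) 1.
have s0 : 0 < s by rewrite lt_min ltr01 divr_gt0.
have st : s <= t / 2 by rewrite ge_min lexx.
have s1 : s <= 1 by rewrite ge_min lexx orbT.
exists (d + s); split; [by lra|by lra| |].
  move=> x y Cx Cy; have := le_ediam Cx Cy; rewrite -(@fineK _ (ediam C)) ?lee_fin -/d; first by lra.
  have := ediam_ge0 C0; move: C1; case: (ediam C) => //.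
rewrite -EFinD lee_fin; apply/ltW/Ht; rewrite opprD addrA subrr add0r normrN gtr0_norm//; lra.
Qed.

(** Any covering of [D] by pieces of diameter at most 1 yields a covering of the cone by cells whose
    volumes are at most [cone_const] times the terms of the Hausdorff sum. *)
Lemma hausdorff_cone_ge D X (V : R) : measurable X -> lebn n X = V%:E ->
  (forall x, D x -> enorm (x - J0) <= T) -> X `<=` cone D ->
  (V%:E <= cone_const%:E * hausdorff n.-1 D)%E.
Proof.
move=> mX XV DT XD; have nR : (0 : R) < n%:R by rewrite ltr0n.
have P0 : 0 < cone_const.
  by rewrite mulr_gt0 ?expR_gt0// addr_gt0// !mulr_gt0.
suff H : ((V / cone_const)%:E <= hausdorff_delta n.-1 1 D)%E.
  have := le_trans H (hausdorff_delta_le n.-1 D ltr01).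
  by rewrite mulrC EFinM; move=> h; rewrite -[X in (X%:E <= _)%E](divfK (lt0r_neq0 P0)) mulrC EFinM lee_pmul2l// mulrC EFinM.
apply: le_ereal_inf_tmp => _ [C [DC C1] <-].
apply/lee_addgt0Pr => e e0.
(* The pieces are cut down to [D], since the distance to [J0] is bounded only there; the errors e /
   2^(i+1) sum to e. *)
have HE (i : nat) : exists E, [/\ measurable E, cone (C i `&` D) `<=` E &
    (lebn n E <= cone_const%:E * (hterm n.-1 (C i) + (e / (2 ^ i.+1)%:R)%:E))%E].
  have [Ci0|Ci0] := pselect (C i !=set0); last first.
    exists set0; split=> //; first by move=> J [x [s [[Cx _] _ _]]]; case: Ci0; exists x.
    by rewrite measure0 mule_ge0 ?lee_fin ?(ltW P0)// adde_ge0 ?hterm_ge0// lee_fin divr_ge0 ?(ltW e0).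
  have ei : 0 < e / (2 ^ i.+1)%:R by rewrite divr_gt0 ?ltr0n ?expn_gt0.
  have [d [d0 d2 Cd hd]] := hterm_approx n.-1 Ci0 (C1 i) ei.
  have [||E [mE CE Ed]] := @cone_cell (C i `&` D) d d0 d2.
  - by move=> x [_ /DT].
  - by move=> x y [Cx _] [Cy _]; exact: Cd.
  exists E; split=> //; apply: (le_trans Ed); rewrite EFinM lee_pmul2l//.
have [E HE'] := choice HE.
have mE i : measurable (E i) by case: (HE' i).
have XE : X `<=` \bigcup_i E i.
  move=> J /XD[x [s [Dx s1 JE]]]; have [i _ Cx] := DC x Dx; exists i => //.
  by case: (HE' i) => _ + _; apply; exists x, s.
have h : (V%:E <= \sum_(0 <= i <oo) lebn n (E i))%E.
  by rewrite -XV; exact: (measure_sigma_subadditive (lebn n) mE mX XE).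
rewrite -(@lee_pmul2l _ cone_const%:E) ?lte_fin// -EFinM mulrCA divff ?lt0r_neq0// mulr1; apply: (le_trans h).
apply: (@le_trans _ _ (\sum_(0 <= i <oo) (cone_const%:E * (hterm n.-1 (C i) + (e / (2 ^ i.+1)%:R)%:E)))%E).
  by apply: lee_nneseries => // i _; case: (HE' i).
rewrite nneseriesZl; last first.
  by move=> i _; rewrite adde_ge0 ?hterm_ge0// lee_fin divr_ge0 ?(ltW e0).
apply: lee_wpmul2l; first by rewrite lee_fin ltW.
by apply: epsilon_trick; [move=> i; exact: hterm_ge0|exact: ltW].
Qed.

End cone.

End hausdorff_measure.

(** * The area of a level surface *)

Section level_surface.
Context {R : realType} (n : nat) (G : set 'rV[R]_n) (f : 'rV[R]_n -> R) (a b : R).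
Hypotheses (n0 : (0 < n)%N).
Hypotheses (oG : open G) (cG : Defs.convex_set G) (cf : continuous f) (vf : convex_fun f).
Hypotheses (a0 : 0 < a) (growth : forall J, a * dotp J J - b <= f J).
Variables (c : R) (J0 : 'rV[R]_n).
Hypotheses (GJ0 : G J0) (J0c : f J0 < c).

Let growthG (A : set 'rV[R]_n) J : A J -> a * dotp J J - b <= f J. Proof. by move=> _; exact: growth. Qed.

Let nR : (0 : R) < n%:R. Proof. by rewrite ltr0n. Qed.

Let gap0 : 0 < c - f J0. Proof. by rewrite subr_gt0. Qed.

Let V0 := lvol G f c.

(** Since f J0 < c, convexity makes [f] exceed c immediately beyond a point of {f = c} on the ray
    from [J0]; so such a point is not interior to the sublevel set. *)
Lemma bdry_sublevel : bdry [set J | f J <= c] = [set J | f J = c].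
Proof.
have cl : closed [set J | f J <= c].
  by apply: (@preimage_closed _ _ f [set z | z <= c]); [move=> x _; exact: cf|exact: closed_le].
have op : open [set J | f J < c].
  by apply: (@open_comp _ _ f [set z | z < c]); [move=> x _; exact: cf|exact: open_lt].
rewrite /bdry -(closure_id _).1//; apply/seteqP; split => J /=.
  move=> [fJ nJ]; apply/eqP; rewrite eq_le fJ/= leNgt; apply/negP => h; apply: nJ.
  have hn : nbhs J [set K | f K < c] by apply: open_nbhs_nbhs; split.
  by apply: (filterS _ hn) => K /= /ltW.
move=> fJ; split; first by rewrite fJ.
move=> /nbhs_eball[r r0 Jr].
pose u := J - J0; pose e := r / (enorm u + 1).
have u1 : 0 < enorm u + 1 by rewrite ltr_wpDl ?enorm_ge0.
have e0 : 0 < e by rewrite divr_gt0.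
have e1 : 0 < 1 + e by rewrite addr_gt0.
have : f (J + e *: u) <= c.
  apply: Jr; rewrite /eball/= [J + _]addrC addrK enormZ gtr0_norm// /e mulrAC ler_pdivrMr//.
  by rewrite ler_pM2l// lerDl.
have t01 : 0 <= (1 + e)^-1 <= 1 by rewrite invr_ge0 ltW//= invf_le1// lerDl ltW.
have := vf (J + e *: u) J0 t01.
have -> : (1 + e)^-1 *: (J + e *: u) + (1 - (1 + e)^-1) *: J0 = J.
  by apply/rowP => i; rewrite /u !mxE; field; rewrite lt0r_neq0.
rewrite fJ => h1 h2; have i0 : 0 < (1 + e)^-1 by rewrite invr_gt0.
have i1 : (1 + e)^-1 < 1 by rewrite invf_lt1// ltrDl.
have p1 : (1 + e)^-1 * f (J + e *: u) <= (1 + e)^-1 * c by rewrite ler_pM2l.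
have p2 : (1 - (1 + e)^-1) * f J0 < (1 - (1 + e)^-1) * c by rewrite ltr_pM2l// subr_gt0.
lra.
Qed.

Let D := G `&` [set J | f J = c].

(** The segment from [J0] to [J] meets {f = c} at a parameter t, inside [G] by convexity. Convexity
    along the segment gives t >= (c - f J0) / (c - f J0 + 1), so 1 / t is at most 1 + 1 / (c - f
    J0). *)
Lemma slab_sub_cone : slab G f c (c + 1) `<=` cone J0 (c - f J0)^-1 D.
Proof.
move=> J [GJ /= /andP[h1 h2]].
have [|t /andP[t0 t1] ft] := @segment_crossing R n f J0 J c cf; first by rewrite ltW//= ltW.
have tE : J0 + t *: (J - J0) = t *: J + (1 - t) *: J0 by apply/rowP => i; rewrite !mxE; ring.
have t01 : 0 <= t <= 1 by rewrite t0.
have tp : 0 < t.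
  rewrite lt0r t0 andbT; apply/eqP => z; move: ft; rewrite z scale0r addr0.
  by move: J0c => + E; rewrite E ltxx.
exists (J0 + t *: (J - J0)), t^-1; split.
- by split; [rewrite tE; exact: cG|].
- apply/andP; split; first by rewrite invf_ge1.
  have := vf J J0 t01; rewrite -tE ft => h.
  have : c - f J0 <= t * (c - f J0 + 1).
    have : t * f J <= t * (c + 1) by rewrite ler_pM2l.
    lra.
  move=> h3; rewrite invf_ple ?posrE//; last by rewrite addr_gt0// invr_gt0.
  rewrite -[X in X + _](mulfV (lt0r_neq0 gap0)) -{2}[(c - f J0)^-1]mul1r -mulrDl invf_div.
  by rewrite ler_pdivrMr// addr_gt0.
by rewrite addrAC subrr add0r scalerA mulVf ?lt0r_neq0// scale1r addrC subrK.
Qed.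

Lemma level_area_ge (T : R) : 0 < T -> (forall J, D J -> enorm (J - J0) <= T) ->
  ((lvol G f (c + 1) - V0)%:E <= (cone_const n T (c - f J0)^-1)%:E * hausdorff n.-1 D)%E.
Proof.
move=> T0 DT; have c1 : c <= c + 1 by rewrite lerDl.
apply: (hausdorff_cone_ge n0 T0 _ (measurable_slab oG cf c (c + 1))) slab_sub_cone => //.
  by rewrite invr_gt0.
by rewrite (lebn_slab oG cf a0 (growthG (A := G))).
Qed.

Variables (L rho : R).
Hypotheses (df : forall J, differentiable f J) (L0 : 0 <= L) (rho0 : 0 < rho).
Hypothesis gradL : forall J, f J <= c + 1 -> enorm (grad f J) <= L.
Hypothesis ballG : eball J0 rho `<=` G.

(** The tangent inequality with the gradient bound. That bound holds only up to energy c + 1; a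
    nearby point of higher energy would force the level c + 1 to be crossed within distance [r],
    where f <= c + L r < c + 1. *)
Let near_level (r : R) J K : D J -> enorm (K - J) <= r -> L * r < 1 -> c - L * r <= f K <= c + L * r.
Proof.
move=> [GJ /= fJ] KJ Lr; have J1 : f J <= c + 1 by rewrite fJ lerDl.
have grad_lt X Y : f X <= c + 1 -> enorm (Y - X) <= r -> f X - L * r <= f Y.
  move=> Xc XY; apply: le_trans (convex_grad_le Y vf (df X)); rewrite lerD2l.
  have := cauchy_schwarz (grad f X) (X - Y).
  have : enorm (grad f X) * enorm (X - Y) <= L * r.
    by rewrite ler_pM ?enorm_ge0 ?gradL// enormC.
  by rewrite -(opprB X Y) dotpNr; lra.
apply/andP; split; first by rewrite -{1}fJ; exact: grad_lt.
have low Y : f Y <= c + 1 -> enorm (J - Y) <= r -> f Y <= c + L * r.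
  by move=> Yc YJ; have := grad_lt Y J Yc YJ; rewrite fJ; lra.
have [K1|K1] := leP (f K) (c + 1); first by apply: low => //; rewrite enormC.
have [|t /andP[t0 t1] ft] := @segment_crossing R n f J K (c + 1) cf; first by rewrite J1 ltW.
have := low (J + t *: (K - J)); rewrite ft lexx => /(_ isT) h.
suff : c + 1 <= c + L * r by lra.
apply: h; rewrite opprD addrA subrr add0r enormN enormZ ger0_norm//.
by apply: le_trans KJ; rewrite ler_piMl ?enorm_ge0.
Qed.

Let gap_scale (e : R) : 0 < e -> e <= (c - f J0) / (2 * n%:R) ->
  forall A, open A -> Defs.convex_set A -> A J0 -> lvol A f (c + e) <= 2 * lvol A f c.
Proof.
move=> e0 eg A oA cA AJ0; have g1 : 0 < c - f J0 + e by rewrite addr_gt0.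
pose t := 1 - e / (c - f J0 + e).
have et : e / (c - f J0 + e) <= (2 * n%:R)^-1.
  rewrite ler_pdivrMr//; apply: (le_trans eg); rewrite [leRHS]mulrC ler_wpM2r ?invr_ge0 ?mulr_ge0//.
  by rewrite lerDl ltW.
have tn : 1 / 2 <= t ^+ n by apply: half_le_exprn => //; rewrite /t lerD2l lerN2.
have t0 : 0 < t by rewrite /t subr_gt0 ltr_pdivrMr// mul1r ltrDr.
have t1 : t <= 1 by rewrite /t gerBl divr_ge0 ?ltW.
have := lvol_scale oA cA cf vf a0 (growthG (A := A)) (v := c) (w := c + e) AJ0 t0 t1.
have -> : f J0 + t * (c + e - f J0) = c.
  rewrite /t (_ : c + e - f J0 = c - f J0 + e); last by ring.
  by rewrite mulrBl divfK ?lt0r_neq0//; ring.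
move=> /(_ (lexx _)) h; have := lvol_ge0 oA cf a0 (growthG (A := A)) (c + e) => p.
have := ler_wpM2r p tn; lra.
Qed.

(* A neighbourhood of the surface lies in a thin slab of a slight dilation of G about J0. *)
Lemma level_area_le : (hausdorff n.-1 D <= (80 * n%:R ^+ 4 * (L + 1) / (c - f J0) * V0)%:E)%E.
Proof.
(* The three conditions: the energy half-width e = (L + 1) r is at most gap / (2 n), the dilation r
   / rho is at most 1 / (2 n), and (L + 1) r <= 1 as [near_level] needs. *)
pose r0 := Num.min ((c - f J0) / (2 * n%:R) / (L + 1)) (Num.min (rho / (2 * n%:R)) (L + 1)^-1).
have L1 : 0 < L + 1 by rewrite ltr_wpDl.
have n2 : (0 : R) < 2 * n%:R by rewrite mulr_gt0.
have r00 : 0 < r0 by rewrite !lt_min !divr_gt0//= invr_gt0.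
have -> : 80 * n%:R ^+ 4 * (L + 1) / (c - f J0) * V0 = 10 * n%:R ^+ 3 * (8 * n%:R * (L + 1) / (c - f J0) * V0) by ring.
apply: (hausdorff_le_minkowski n0 r00) => r rp; rewrite !le_min => /andP[r1 /andP[r2 r3]].
pose e := (L + 1) * r; have e0 : 0 < e by rewrite mulr_gt0.
have eg : e <= (c - f J0) / (2 * n%:R) by rewrite /e mulrC -ler_pdivlMr.
have Lr : L * r < 1.
  have : (L + 1) * r <= 1 by rewrite mulrC -ler_pdivlMr// mul1r.
  by rewrite mulrDl mul1r; lra.
have Lre : L * r < e by rewrite /e mulrDl mul1r ltrDl.
pose lam := r / rho; have lam0 : 0 < lam by rewrite divr_gt0.
have lam1 : lam <= (2 * n%:R)^-1 by rewrite ler_pdivrMr// mulrC.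
pose s := (1 + lam)^-1; have l1 : 0 < 1 + lam by rewrite addr_gt0.
have s0 : 0 < s by rewrite invr_gt0.
have s1 : s <= 1 by rewrite invf_le1// lerDl ltW.
have s01 : 0 <= s <= 1 by rewrite ltW.
(* The dilation of [G] about [J0] by 1 + lam. It contains every ball of radius r centred in [G],
   because [G] is convex and contains the ball of radius rho = r / lam about [J0]. *)
pose G' := [set y | G (s *: y + (1 - s) *: J0)].
have oG' : open G' by apply: open_comp => // y _; exact: (@continuous_affine R 'rV[R]_n).
have cG' : Defs.convex_set G'.
  move=> x y t Gx Gy t01; rewrite /G'/=.
  rewrite (_ : _ + _ = t *: (s *: x + (1 - s) *: J0) + (1 - t) *: (s *: y + (1 - s) *: J0)).
    exact: cG.
  by apply/rowP => i; rewrite !mxE; ring.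
have GG' : G' J0 by rewrite /G'/= -scalerDl addrC subrK scale1r.
have gG' := growthG (A := G').
exists (slab G' f (c - e) (c + e)), (lvol G' f (c + e) - lvol G' f (c - e)); split.
- exact: measurable_slab.
- by apply: (lebn_slab oG' cf a0 gG'); lra.
(* Both the dilation of [G] and the raising of the level from c to c + e at most double the
   volume. *)
- have v4 : lvol G' f (c + e) <= 4 * V0.
    apply: (@le_trans _ _ (2 * lvol G f (c + e))); last by have := gap_scale e0 eg oG cG GJ0; rewrite -/V0; lra.
    rewrite -lee_fin (lvolE oG' cf a0 gG') (lebn_affine_set (- (lam *: J0)) l1); last exact: measurable_level.
    rewrite EFinM (lvolE oG cf a0 (growthG (A := G))); apply: lee_pmul => //.
    + by rewrite lee_fin exprn_ge0// ltW.
    + have : 1 / 2 <= s ^+ n.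
        apply: half_le_exprn => //; apply: (@le_trans _ _ (1 - lam)); first by rewrite lerD2l lerN2.
        by rewrite /s -[_^-1]mul1r ler_pdivlMr//; have := sqr_ge0 lam; lra.
      rewrite /s exprVn lee_fin => h; have p : 0 < (1 + lam) ^+ n by rewrite exprn_gt0.
      by move: h; rewrite mul1r lef_pV2 ?posrE.
    apply: lebn_le; [|exact: measurable_level|].
      have mm : measurable_fun setT (fun v : 'rV[R]_n => (1 + lam) *: v + - (lam *: J0)).
        by apply: continuous_mx_measurable_mx; exact: (@continuous_affine R 'rV[R]_n).
      by rewrite -[X in measurable X]setTI; apply: mm => //; exact: measurable_level.
    move=> v [/=]; rewrite /G'/=.
    have vE : s *: ((1 + lam) *: v + - (lam *: J0)) + (1 - s) *: J0 = v.
      by apply/rowP => i; rewrite /s !mxE; field; rewrite lt0r_neq0.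
    rewrite vE => Gv fv; split=> //=; rewrite -vE; apply: (le_trans (vf _ _ s01)).
    have q : 0 <= 1 - s by rewrite subr_ge0.
    have q1 : s * f ((1 + lam) *: v + - (lam *: J0)) <= s * (c + e) by rewrite ler_pM2l.
    have q2 : (1 - s) * f J0 <= (1 - s) * (c + e) by rewrite ler_wpM2l//; move: J0c; lra.
    lra.
  have g1 : 0 < c - f J0 + e by rewrite addr_gt0.
  (* The contraction towards [J0] that lowers the level from c + e to c - e; by Bernoulli the slab
     is at most the fraction 2 n e / (c - f J0) of the volume. *)
  pose t := 1 - 2 * e / (c - f J0 + e).
  have egap : e <= (c - f J0) / 2.
    apply: (le_trans eg); rewrite ler_pM2l// lef_pV2 ?posrE//.
    by rewrite -[leLHS]mulr1 ler_pM2l// ler1n.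
  have u1 : 2 * e / (c - f J0 + e) < 1 by rewrite ltr_pdivrMr// mul1r; move: e0; lra.
  have u0 : 0 <= 2 * e / (c - f J0 + e) by apply: divr_ge0; [rewrite mulr_ge0 ?(ltW e0)|exact: ltW].
  have t0 : 0 < t by rewrite subr_gt0.
  have t1 : t <= 1 by rewrite gerBl.
  have := lvol_scale oG' cG' cf vf a0 gG' (v := c - e) (w := c + e) GG' t0 t1.
  have -> : f J0 + t * (c + e - f J0) = c - e.
    rewrite /t (_ : c + e - f J0 = c - f J0 + e); last by ring.
    by rewrite mulrBl divfK ?lt0r_neq0//; ring.
  move=> /(_ (lexx _)) h.
  have u01 : 0 <= 2 * e / (c - f J0 + e) <= 1 by rewrite u0 ltW.
  have bn := bernoulli_le n u01.
  have p := lvol_ge0 oG' cf a0 gG' (c + e).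
  have ug : 2 * e / (c - f J0 + e) <= 2 * e / (c - f J0).
    apply: ler_wpM2l; first by apply: mulr_ge0 => //; exact: ltW.
    by rewrite lef_pV2 ?posrE// lerDl ltW.
  have tn : 1 - t ^+ n <= n%:R * (2 * e / (c - f J0)).
    have : n%:R * (2 * e / (c - f J0 + e)) <= n%:R * (2 * e / (c - f J0)) by rewrite ler_wpM2l.
    by move: bn; rewrite -/t; lra.
  apply: (@le_trans _ _ ((1 - t ^+ n) * lvol G' f (c + e))); first by rewrite mulrBl mul1r; lra.
  apply: (@le_trans _ _ (n%:R * (2 * e / (c - f J0)) * (4 * V0))); last first.
    by rewrite le_eqVlt; apply/orP; left; apply/eqP; rewrite /e; ring.
  apply: (@le_trans _ _ (n%:R * (2 * e / (c - f J0)) * lvol G' f (c + e))); first by rewrite ler_wpM2r.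
  apply: ler_wpM2l v4; apply: mulr_ge0 => //; apply: divr_ge0; last exact: ltW.
  by apply: mulr_ge0 => //; exact: ltW.
move=> x Dx y yx; have yr : enorm (y - x) <= r by [].
have /andP[y1 y2] := near_level Dx yr Lr.
split; last by rewrite /=; apply/andP; split; lra.
have [Gx _] := Dx; rewrite /G'/=.
have -> : s *: y + (1 - s) *: J0 = s *: x + (1 - s) *: (J0 + lam^-1 *: (y - x)).
  by apply/rowP => i; rewrite /s !mxE; field; rewrite !lt0r_neq0.
apply: cG => //; apply: ballG; rewrite /eball/= [J0 + _]addrC addrK enormZ gtr0_norm ?invr_gt0//.
by rewrite mulrC ler_pdivrMr// /lam mulrC divfK ?lt0r_neq0.
Qed.

End level_surface.

(** * The gap between the mean and the minimal energy *)

Section gauss_bounds.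
Context {R : realType} (n : nat).

Lemma gauss_dominated_le (A : set 'rV[R]_n) (F : 'rV[R]_n -> R) (k K : R) : measurable A ->
  measurable_fun setT F -> 0 < k -> 0 <= K -> (forall J, A J -> 0 <= F J <= K * expR (- (k * dotp J J))) ->
  (\int[lebn n]_(J in A) (F J)%:E <= (K * Num.sqrt (pi / k) ^+ n)%:E)%E.
Proof.
move=> mA mF k0 K0 FK.
have mg : measurable_fun setT (fun J : 'rV[R]_n => expR (- (k * dotp J J))).
  by have /integrableP[/measurable_EFinP] := @gauss_integrable R n k k0.
apply: (@le_trans _ _ (\int[lebn n]_(J in A) (K * expR (- (k * dotp J J)))%:E)%E).
  apply: ge0_le_integral => //.
  - by move=> J /FK/andP[F0 _]; rewrite lee_fin.
  - by apply/measurable_EFinP; exact: measurable_funTS.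
  - by apply/measurable_EFinP; apply: measurable_funTS; exact: measurable_funM.
  by move=> J /FK/andP[_ h]; rewrite lee_fin.
apply: (@le_trans _ _ (\int[lebn n]_J (K * expR (- (k * dotp J J)))%:E)%E).
  apply: ge0_subset_integral => //; first by apply/measurable_EFinP; exact: measurable_funM.
  by move=> J _; rewrite lee_fin mulr_ge0 ?expR_ge0.
under eq_integral do rewrite EFinM.
rewrite ge0_integralZl//; last by apply/measurable_EFinP.
by rewrite gauss_lebn// -EFinM.
Qed.

(** On the ball, 1 <= exp(n) exp(- n |J|^2 / r^2); the Gaussian integral gives the decay like
    n^(-n/2) that makes balls of radius a small multiple of sqrt n exponentially small. *)
Lemma ball_vol_gauss (r : R) : (0 < n)%N -> 0 < r ->
  ball_vol R n * r ^+ n <= (expR 1 * Num.sqrt (pi * r ^+ 2 / n%:R)) ^+ n.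
Proof.
move=> n0 r0; have nR : (0 : R) < n%:R by rewrite ltr0n.
have r20 : 0 < r ^+ 2 by rewrite exprn_gt0.
have k0 : 0 < n%:R / r ^+ 2 by rewrite divr_gt0.
rewrite -lee_fin -(lebn_eball (0 : 'rV[R]_n) r0) lebnE; last exact: measurable_eball.
have -> : (\int[lebn n]_v (\1_(eball 0 r) v)%:E = \int[lebn n]_(v in eball (0 : 'rV[R]_n) r) (cst (1 : R) v)%:E)%E.
  rewrite [RHS]integral_mkcond; apply: eq_integral => v _; rewrite patchE indicE.
  by case: (_ \in _).
have := @gauss_dominated_le (eball 0 r) (cst 1) _ (expR n%:R) (measurable_eball _ _) (measurable_cst _) k0 (expR_ge0 _).
rewrite exprMn -expRM_natl mulr1 invf_div mulrA; apply=> J; rewrite /eball/= subr0 => Jr.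
rewrite ler01 -expRD -[leLHS]expR0 ler_expR subr_ge0 -enorm_sqr mulrAC ler_pdivrMr// ler_pM2l//.
by rewrite ler_sqr ?nnegrE ?enorm_ge0// ltW.
Qed.

Lemma Rintegral_le_where_pos (A B : set 'rV[R]_n) (F : 'rV[R]_n -> R) : measurable B -> measurable A ->
  A `<=` B -> (lebn n).-integrable B (fun J => (F J)%:E) -> (forall J, (B `\` A) J -> F J <= 0) ->
  \int[lebn n]_(J in B) F J <= \int[lebn n]_(J in A) F J.
Proof.
move=> mB mA AB iF F0; have mD : measurable (B `\` A) by exact: measurableD.
rewrite -{1}(setDUK AB) Rintegral_setU//; last 2 first.
- by rewrite setDUK.
- by apply/disj_setPS => J [AJ [_]].
rewrite gerDl; have := Rintegral_cst (lebn n) mD (0 : R); rewrite mul0r => {1}<-; apply: le_Rintegral => //.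
- by apply: (integrableS mB) => // J [].
- exact: integrable0.
Qed.

End gauss_bounds.

Section a_priori.
Context {R : realType} (n : nat) (G : set 'rV[R]_n) (f : 'rV[R]_n -> R) (C1 R0 C3 : R).
Hypotheses (n0 : (0 < n)%N) (oG : open G) (GN0 : G !=set0) (vf : convex_fun f).
Hypotheses (df : forall J, differentiable f J) (C10 : 0 < C1) (R00 : 0 < R0).
Hypothesis far : forall J, n%:R * R0 ^+ 2 < dotp J J -> C1 * dotp J J <= f J.
Notation Z := (\int[lebn n]_(J in G) expR (- f J)).

Let cf : continuous f. Proof. by move=> J; exact: differentiable_continuous. Qed.

Let mG : measurable G. Proof. exact: open_measurable_mx. Qed.

Let mf : measurable_fun setT f. Proof. exact: continuous_measurable_mx. Qed.

Let nR : (0 : R) < n%:R. Proof. by rewrite ltr0n. Qed.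

Let rr0 : 0 <= Num.sqrt n%:R * R0. Proof. by rewrite mulr_ge0 ?sqrtr_ge0 ?ltW. Qed.

Let rrE : (Num.sqrt n%:R * R0) ^+ 2 = n%:R * R0 ^+ 2. Proof. by rewrite exprMn sqr_sqrtr. Qed.

Lemma quadratic_growth (b : R) : 0 <= b -> (forall J, - b <= f J) ->
  forall J, C1 * dotp J J - (b + C1 * (n%:R * R0 ^+ 2)) <= f J.
Proof.
move=> b0 fb J; have q0 : 0 <= C1 * (n%:R * R0 ^+ 2) by rewrite !mulr_ge0 ?sqr_ge0 ?ltW.
have [h|/far h] := leP (dotp J J) (n%:R * R0 ^+ 2); last by lra.
have : C1 * dotp J J <= C1 * (n%:R * R0 ^+ 2) by rewrite ler_pM2l.
by have := fb J; lra.
Qed.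

(** This bound depends on [f] and serves integrability only; the one linear in [n] comes from
    [grad_lower_bound]. *)
Lemma exists_lower_bound : exists2 b, 0 <= b & forall J, - b <= f J.
Proof.
pose g := grad f 0; exists (`|f 0| + enorm g * (Num.sqrt n%:R * R0)).
  by rewrite addr_ge0// mulr_ge0// enorm_ge0.
move=> J; have [h|/far h] := leP (dotp J J) (n%:R * R0 ^+ 2); last first.
  apply: le_trans h; apply: (@le_trans _ _ 0); last by rewrite mulr_ge0 ?dotp_ge0// ltW.
  by rewrite oppr_le0 addr_ge0// mulr_ge0// enorm_ge0.
have := convex_grad_le J vf (df 0); rewrite subr0; apply: le_trans.
have Jr : enorm J <= Num.sqrt n%:R * R0 by rewrite enorm_le// rrE.
have := cauchy_schwarz g (- J); rewrite dotpNr enormN -/g.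
have : enorm g * enorm J <= enorm g * (Num.sqrt n%:R * R0) by rewrite ler_wpM2l// enorm_ge0.
have := ler_norm (- f 0); rewrite normrN; lra.
Qed.

Let itf : (lebn n).-integrable G (fun J => (expR (- f J))%:E).
Proof.
have [b b0 fb] := exists_lower_bound; have gr := quadratic_growth b0 fb.
exact: (@boltzmann_integrable R n G f C1 _ mG cf C10 (fun J _ => gr J)).
Qed.

Hypothesis HZ : expR (- (C3 * n%:R)) <= Z.

(* If f exceeded n * low_energy + 1 on all of G, comparing exp(-f) with a Gaussian would contradict HZ. *)
Definition low_energy := `|2 * (C3 + ln (Num.sqrt (pi / (C1 / 2)))) + C1 * R0 ^+ 2|.

Lemma low_energy_point : exists2 J, G J & f J <= n%:R * low_energy + 1.
Proof.
apply: contrapT => H; pose m := n%:R * low_energy + 1.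
have e0 : 0 <= low_energy by exact: normr_ge0.
have m0 : 0 <= m by rewrite addr_ge0// mulr_ge0.
have fm J : G J -> m <= f J.
  by move=> GJ; rewrite leNgt; apply/negP => h; apply: H; exists J => //; exact: ltW.
have k0 : 0 < C1 / 2 by rewrite divr_gt0.
pose S := Num.sqrt (pi / (C1 / 2)); have S0 : 0 < S by rewrite sqrtr_gt0 divr_gt0// pi_gt0.
have : Z <= expR (- m / 2 + C1 / 2 * (n%:R * R0 ^+ 2)) * S ^+ n.
  rewrite -lee_fin EFin_Rint//; apply: gauss_dominated_le => //.
    by apply: measurableT_comp => //; exact: measurableT_comp.
  move=> J GJ; rewrite expR_ge0/= -expRD ler_expR; have := fm J GJ.
  (* Half of [f] is bounded below by [m] and the other half by the quadratic growth, so exp(- f) is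
     below exp(- m / 2) times a Gaussian of coefficient C1 / 2. The maximum with 0 covers small [J],
     where the quadratic bound is nonpositive and f >= m >= 0. *)
  have q : C1 * dotp J J - C1 * (n%:R * R0 ^+ 2) <= Num.max 0 (f J).
    have [h|/far h] := leP (dotp J J) (n%:R * R0 ^+ 2).
      by rewrite le_max -mulrBr pmulr_rle0// subr_le0 h.
    rewrite le_max; apply/orP; right; apply: le_trans h; rewrite gerBl.
    by rewrite !mulr_ge0 ?sqr_ge0 ?ltW.
  move=> h; have : Num.max 0 (f J) = f J by apply/max_idPr; apply: le_trans h.
  by move=> E; rewrite E in q; lra.
move=> /(le_trans HZ); rewrite -{1}(lnK S0) -expRM_natl -expRD ler_expR.
have := ler_norm (2 * (C3 + ln S) + C1 * R0 ^+ 2); rewrite -/low_energy => h.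
have := ler_wpM2l (ltW nR) h; rewrite /m; lra.
Qed.

(** A point with f < 0 lies within sqrt n R0 of the origin, and f >= 0 at a point at distance sqrt n
    (R0 + 1). On the segment between them f vanishes somewhere; the gradient is bounded there, and
    the tangent inequality bounds f from below. *)
Lemma grad_lower_bound (u L : R) : 0 <= u -> 0 <= L -> (forall J, f J <= u -> enorm (grad f J) <= L) ->
  forall J, - (L * (Num.sqrt n%:R * (2 * R0 + 1))) <= f J.
Proof.
move=> u0 L0 gL J; have s0 : 0 <= Num.sqrt (n%:R : R) by exact: sqrtr_ge0.
have B0 : 0 <= L * (Num.sqrt n%:R * (2 * R0 + 1)) by rewrite !mulr_ge0// addr_ge0// mulr_ge0// ltW.
have [f0|f0] := leP 0 (f J); first by apply: le_trans f0; rewrite oppr_le0.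
have Jr : enorm J <= Num.sqrt n%:R * R0.
  rewrite enorm_le// rrE leNgt; apply/negP => /far h.
  have : 0 <= C1 * dotp J J by rewrite mulr_ge0 ?dotp_ge0// ltW.
  by lra.
pose K : 'rV[R]_n := const_mx (R0 + 1).
have dK : dotp K K = n%:R * (R0 + 1) ^+ 2.
  rewrite /dotp (eq_bigr (fun=> (R0 + 1) ^+ 2)) => [|i _]; last by rewrite !mxE expr2.
  by rewrite sumr_const card_ord mulr_natl.
have eK : enorm K = Num.sqrt n%:R * (R0 + 1).
  by rewrite /enorm dK sqrtrM// sqrtr_sqr ger0_norm// addr_ge0// ltW.
have fK : 0 <= f K.
  apply: le_trans (far _); first by rewrite mulr_ge0 ?dotp_ge0// ltW.
  by rewrite dK ltr_pM2l// ltr_sqr ?nnegrE ?ltrDl ?addr_ge0// ltW.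
have [|t /andP[t0 t1] ft] := @segment_crossing R n f J K 0 cf; first by rewrite ltW.
set z := J + t *: (K - J) in ft.
have := convex_grad_le J vf (df z); rewrite ft add0r; apply: le_trans.
have gz : enorm (grad f z) <= L by apply: gL; rewrite ft.
have zJ : enorm (z - J) <= Num.sqrt n%:R * (2 * R0 + 1).
  rewrite /z [J + _]addrC addrK enormZ ger0_norm//.
  apply: (@le_trans _ _ (enorm (K - J))); first by rewrite ler_piMl ?enorm_ge0.
  by apply: (le_trans (enormD _ _)); rewrite enormN eK; move: Jr; lra.
have := cauchy_schwarz (grad f z) (z - J); rewrite -(opprB z J) dotpNr lerN2 => /le_trans; apply.
by apply: ler_pM; rewrite ?enorm_ge0.
Qed.

Variables (c r B C0 kap : R).
Hypotheses (meanE : gibbs G f f = c * Z) (fB : forall J, - (B * n%:R) <= f J).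
Hypothesis levelr : forall J, f J <= c + n%:R -> enorm J <= r.
Hypotheses (C00 : 0 < C0) (kap0 : 0 < kap) (kap1 : kap <= 1) (cG : Defs.convex_set G).
Hypothesis midf : forall x y, enorm x <= r -> enorm y <= r ->
  f (2^-1 *: (x + y)) <= (f x + f y) / 2 - C0 / 8 * dotp (x - y) (x - y).
Hypothesis kapE : 4 * pi * kap / C0 <= (expR (- (C3 + B + 2)) / 4) ^+ 2.

(* If f were above c - kap n on all of G, then by Markov's inequality half of the mass would lie where f is within
   kap n of c; by strong convexity this set is small, and its volume is too small to carry that mass. *)
Lemma energy_gap : exists2 J, G J & f J <= c - kap * n%:R.
Proof.
apply: contrapT => H; pose g := kap * n%:R; have g0 : 0 < g by rewrite mulr_gt0.
have gn : g <= n%:R by rewrite ger_pMl.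
have fg J : G J -> c - g <= f J.
  by move=> GJ; rewrite leNgt; apply/negP => h; apply: H; exists J => //; exact: ltW.
have Z0 : 0 < Z by apply: lt_le_trans HZ; exact: expR_gt0.
have [b b0 fb] := exists_lower_bound; have gr := quadratic_growth b0 fb.
have grG J : G J -> C1 * dotp J J - (b + C1 * (n%:R * R0 ^+ 2)) <= f J by move=> _; exact: gr.
have bb0 : 0 <= b + C1 * (n%:R * R0 ^+ 2) by rewrite addr_ge0// !mulr_ge0 ?sqr_ge0 ?ltW.
have iE := energy_integrable mG cf C10 bb0 grG.
have cB : - (B * n%:R) <= c.
  rewrite -(ler_pM2r Z0) -meanE -(gibbs1 mG cf C10 grG); apply: gibbs_le => //.
  by apply: integrable_scale.
have mL := measurable_level oG cf (c + g).
have Lr J : level G f (c + g) J -> enorm J <= r by move=> [_ /= h]; apply: levelr; apply: (le_trans h); rewrite lerD2l.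
(* Two points of energy at most c + g whose midpoint has energy at least c - g satisfy C0 |x - y|^2
   <= 16 g, that is |x - y| <= 2 rho. *)
pose rho := 2 * Num.sqrt (g / C0); have gC : 0 < g / C0 by rewrite divr_gt0.
have rho0 : 0 < rho by rewrite mulr_gt0// sqrtr_gt0.
have rho2 : rho ^+ 2 = 4 * (g / C0) by rewrite exprMn sqr_sqrtr ?(ltW gC)// expr2; congr (_ * _); ring.
have diam x y : level G f (c + g) x -> level G f (c + g) y -> enorm (x - y) <= 2 * rho.
  move=> Lx Ly; rewrite enorm_le ?mulr_ge0 ?(ltW rho0)// exprMn rho2.
  have Gm : G (2^-1 *: (x + y)).
    rewrite (_ : _ *: _ = 2^-1 *: x + (1 - 2^-1) *: y).
      by apply: cG; [case: Lx|case: Ly|lra].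
    by apply/rowP => i; rewrite !mxE; field.
  have := le_trans (fg _ Gm) (midf (Lr _ Lx) (Lr _ Ly)).
  case: Lx Ly => _ /= fx [_ /= fy] h.
  have : C0 * dotp (x - y) (x - y) <= 16 * g by lra.
  by rewrite (_ : 2 ^+ 2 * _ = 16 * g / C0); [rewrite ler_pdivlMr// mulrC|field; rewrite lt0r_neq0].
have vol : lvol G f (c + g) <= (expR 1 * Num.sqrt (pi * rho ^+ 2 / n%:R)) ^+ n.
  apply: le_trans (ball_vol_gauss n0 rho0).
  rewrite -lee_fin (lvolE oG cf C10 grG).
  have := isodiametric mL (mulr_gt0 (ltr0n _ 2) rho0) diam.
  by rewrite (_ : 2 * rho / 2 = rho)//; field.
have half : Z / 2 <= expR (g - c) * lvol G f (c + g).
  (* Markov's inequality in affine form: h = 1 - (f - (c - g)) / (2 g) has mean 1 / 2, is at most 1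
     on [G], and is negative where f > c + g. *)
  pose h J := (1 - (c - g) * - (2 * g)^-1) + - (2 * g)^-1 * f J.
  have hE J : h J = 1 - (2 * g)^-1 * (f J - (c - g)) by rewrite /h; ring.
  have i0 : 0 < (2 * g)^-1 by rewrite invr_gt0 mulr_gt0.
  have ih : (lebn n).-integrable G (fun J => (h J * expR (- f J))%:E).
    have -> : (fun J => (h J * expR (- f J))%:E) = (fun J => ((1 - (c - g) * - (2 * g)^-1) * expR (- f J))%:E +
        (- (2 * g)^-1 * (f J * expR (- f J)))%:E)%E by apply/funext => J; rewrite -EFinD /h; congr (_%:E); ring.
    by apply: integrableD => //; exact: integrable_scale.
  have -> : Z / 2 = gibbs G f h.
    rewrite /h (gibbsD mG); last 2 first.
    - by apply: integrable_scale.
    - by under eq_fun do rewrite -mulrA; exact: integrable_scale.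
    rewrite (gibbs1 mG cf C10 grG) (gibbsZ mG)// meanE; field.
    by rewrite lt0r_neq0.
  apply: (le_trans (Rintegral_le_where_pos mG mL _ ih _)); first by move=> J [].
    move=> J [GJ nL]; have : c + g < f J by rewrite ltNge; apply/negP => q; apply: nL; split.
    move=> q; rewrite mulr_le0_ge0 ?expR_ge0// hE subr_le0 ler_pdivlMl ?mulr_gt0//; lra.
  apply: (@le_trans _ _ (\int[lebn n]_(J in level G f (c + g)) expR (g - c))).
    apply: le_Rintegral => //.
    - by apply: (integrableS mG) => // J [].
    - apply/integrableP; split; first exact: measurable_cst.
      rewrite integral_cst//=; apply: lte_mul_pinfty => //.
      by apply: (le_lt_trans _ (ltry (lvol G f (c + g)))); rewrite (lvolE oG cf C10 grG).
    move=> J [GJ /= fJ]; have q := fg J GJ; have g20 : 0 < 2 * g by rewrite mulr_gt0.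
    rewrite -[leRHS]mul1r; apply: ler_pM; rewrite ?expR_ge0// ?hE.
    - by rewrite subr_ge0 ler_pdivrMl// mulr1; lra.
    - by rewrite gerBl mulr_ge0 ?(ltW i0)// subr_ge0.
    - by rewrite ler_expR; lra.
  rewrite Rintegral_cst//.
(* [kapE] is calibrated so that the volume bound, multiplied by exp(g - c) <= exp((1 + B) n), is at
   most (exp(- C3) / 4)^n. Against Z >= exp(- C3 n) this would give 1 / 2 <= 4^(-n). *)
have : expR (- (C3 * n%:R)) / 2 <= (expR (- C3) / 4) ^+ n.
  apply: (@le_trans _ _ (Z / 2)); first by rewrite ler_pM2r.
  apply: (le_trans half).
  apply: (@le_trans _ _ (expR (1 + B) ^+ n * (expR 1 * (expR (- (C3 + B + 2)) / 4)) ^+ n)).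
    apply: ler_pM; [exact: expR_ge0|exact: (lvol_ge0 oG cf C10 grG)| |].
      by rewrite -expRM_natl ler_expR; lra.
    apply: (le_trans vol); rewrite lerXn2r ?nnegrE ?mulr_ge0 ?expR_ge0 ?sqrtr_ge0//.
    rewrite ler_pM2l ?expR_gt0//.
    rewrite -[leRHS]ger0_norm ?divr_ge0 ?expR_ge0// -sqrtr_sqr ler_wsqrtr// rho2.
    apply: le_trans kapE; rewrite /g le_eqVlt; apply/orP; left; apply/eqP; field.
    by rewrite !lt0r_neq0.
  rewrite -exprMn le_eqVlt; apply/orP; left; apply/eqP; congr (_ ^+ _).
  by rewrite !mulrA -!expRD; congr (expR _ / _); ring.
rewrite exprMn -expRM_natl mulrN (mulrC n%:R) ler_pM2l ?expR_gt0// => h.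
have : (4^-1 : R) ^+ n <= 4^-1.
  by rewrite -(prednK n0) exprS ler_piMr// exprn_ile1//; lra.
lra.
Qed.

End a_priori.

(** * Partition function and surface area *)

Lemma hausdorff_ge0 {R : realType} (n k : nat) (A : set 'rV[R]_n) : (0 <= hausdorff k A)%E.
Proof.
apply: le_trans (hausdorff_delta_le k A ltr01).
by apply: le_ereal_inf_tmp => _ [C _ <-]; apply: nneseries_ge0 => i _ _; exact: hterm_ge0.
Qed.

Section surface_energy.
Context {R : realType} (n : nat) (G : set 'rV[R]_n) (f : 'rV[R]_n -> R) (a b : R).
Hypotheses (n0 : (0 < n)%N).
Hypotheses (oG : open G) (cG : Defs.convex_set G) (vf : convex_fun f) (df : forall J, differentiable f J).
Hypotheses (a0 : 0 < a) (b0 : 0 <= b) (growth : forall J, a * dotp J J - b <= f J).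
Notation Z := (\int[lebn n]_(J in G) expR (- f J)).
Variables (c kap R1 L : R) (J0 : 'rV[R]_n).
Hypotheses (Z0 : 0 < Z) (meanE : gibbs G f f = c * Z).
Hypotheses (GJ0 : G J0) (kap0 : 0 < kap) (kap1 : kap <= 1) (gap : kap * n%:R <= c - f J0).
Hypotheses (R10 : 0 < R1) (levelR : forall J, f J <= c + 1 -> enorm J <= Num.sqrt n%:R * R1).
Hypotheses (L0 : 0 <= L) (gradL : forall J, f J <= c + 1 -> enorm (grad f J) <= Num.sqrt n%:R * L).

Let cf : continuous f. Proof. by move=> J; exact: differentiable_continuous. Qed.

Let growthG J : G J -> a * dotp J J - b <= f J. Proof. by move=> _; exact: growth. Qed.

Let n1 : (1 : R) <= n%:R. Proof. by rewrite ler1n. Qed.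

Let nR : (0 : R) < n%:R. Proof. by rewrite ltr0n. Qed.

Let sn : Num.sqrt n%:R <= n%:R :> R.
Proof.
by rewrite -[leRHS]ger0_norm// -sqrtr_sqr ler_wsqrtr// expr2 ler_peMl.
Qed.

Let g0 : 0 < kap * n%:R. Proof. exact: mulr_gt0. Qed.

Let gap0 : 0 < c - f J0. Proof. exact: lt_le_trans gap. Qed.

Let fJ0 : f J0 < c. Proof. by rewrite -subr_gt0. Qed.

Let D := G `&` [set J | f J = c].

Let V0 := lvol G f c.

Let V00 : 0 < V0. Proof. exact: (mean_level_vol_gt0 oG cf a0 growthG GJ0 g0 gap). Qed.

(** The first factor bounds 4 + 2 M + 2 M / kap divided by n^2, where M <= 144 n^2; the second is
    the inverse of the relative volume increment kap / 36; the third bounds [cone_const] divided by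
    n. *)
Definition upper_const := (292 + 288 / kap) * (36 / kap) * ((2 * R1 / kap + 2) * expR (kap^-1 + 1)).

Definition lower_const := 80 * ((L + 1) / kap).

Let tau := (c - f J0)^-1.

Let tau0 : 0 < tau. Proof. by rewrite invr_gt0. Qed.

Let taun : tau * n%:R <= kap^-1.
Proof.
rewrite -ler_pdivlMr// -invfM lef_pV2 ?posrE//.
Qed.

Let level_le_area : (V0%:E <= (n%:R * (36 / kap) * ((2 * R1 / kap + 2) * expR (kap^-1 + 1)))%:E * hausdorff n.-1 D)%E.
Proof.
pose T := 2 * (Num.sqrt n%:R * R1).
have sn0 : 0 < Num.sqrt (n%:R : R) by rewrite sqrtr_gt0.
have T0 : 0 < T by rewrite !mulr_gt0.
have DT J : D J -> enorm (J - J0) <= T.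
  move=> [_ /= fJ]; apply: (le_trans (enormD _ _)); rewrite enormN.
  have h1 : enorm J <= Num.sqrt n%:R * R1 by apply: levelR; rewrite fJ lerDl.
  have h2 : enorm J0 <= Num.sqrt n%:R * R1 by apply: levelR; move: fJ0; lra.
  by rewrite /T; lra.
have H := level_area_ge n0 oG cG cf vf a0 growth GJ0 fJ0 T0 DT.
have I := mean_level_vol_increment n0 oG cG cf vf a0 b0 growthG meanE GJ0 g0 gap.
have kE : kap * n%:R / (36 * n%:R) = kap / 36 by field; rewrite lt0r_neq0.
rewrite kE (_ : Num.min _ _ = kap / 36) in I; last by apply/min_idPr; move: kap1; lra.
have A0 := hausdorff_ge0 n.-1 D.
have cc : cone_const n T tau <= n%:R * ((2 * R1 / kap + 2) * expR (kap^-1 + 1)).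
  rewrite /cone_const mulrA; apply: ler_pM; rewrite ?expR_ge0//.
  - by apply: addr_ge0 => //; apply: mulr_ge0; [apply: mulr_ge0 => //; exact: ltW|exact: ltW].
  - apply: (@le_trans _ _ (kap^-1 * (2 * (n%:R * R1)) + 2)).
      rewrite lerD2r; apply: ler_pM => //; [by apply: mulr_ge0 => //; exact: ltW|exact: ltW|].
      by rewrite ler_pM2l// ler_pM2r.
    rewrite mulrDr (_ : n%:R * (2 * R1 / kap) = kap^-1 * (2 * (n%:R * R1))); last by ring.
    by rewrite lerD2l -[leLHS]mul1r ler_pM2r.
  - by rewrite ler_expR lerD2r mulrC.
have k36 : 0 < kap / 36 by rewrite divr_gt0.
rewrite -(@lee_pmul2l _ (kap / 36)%:E) ?lte_fin//.
apply: (@le_trans _ _ (lvol G f (c + 1) - V0)%:E); first by rewrite -EFinM lee_fin.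
apply: (le_trans H); rewrite muleA -EFinM; apply: lee_wpmul2r => //; rewrite lee_fin.
rewrite (_ : kap / 36 * _ = n%:R * ((2 * R1 / kap + 2) * expR (kap^-1 + 1)))//.
by set X := (2 * R1 / kap + 2) * _; field; rewrite lt0r_neq0.
Qed.

Let area_le_level : (hausdorff n.-1 D <= (n%:R ^+ 4 * lower_const * V0)%:E)%E.
Proof.
have [r r0 rG] : exists2 r, 0 < r & eball J0 r `<=` G by apply/nbhs_eball; exact: open_nbhs_nbhs.
have Ln0 : 0 <= Num.sqrt n%:R * L by rewrite mulr_ge0 ?sqrtr_ge0.
apply: (le_trans (level_area_le n0 oG cG cf vf a0 growth GJ0 fJ0 df Ln0 r0 gradL rG)).
rewrite lee_fin (_ : _ / (c - f J0) = n%:R ^+ 4 * (80 * ((Num.sqrt n%:R * L + 1) * tau))); last by rewrite /tau; ring.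
rewrite ler_pM2r//; apply: ler_wpM2l; first exact: exprn_ge0.
rewrite /lower_const ler_pM2l//; apply: (@le_trans _ _ ((n%:R * (L + 1)) * tau)).
  by rewrite ler_pM2r// mulrDr mulr1; apply: lerD => //; rewrite ler_wpM2r.
rewrite (_ : n%:R * (L + 1) * tau = (L + 1) * (tau * n%:R)); last by ring.
by apply: ler_wpM2l taun; rewrite addr_ge0.
Qed.

Lemma surface_energy_bounds : exists A : R,
  [/\ hausdorff n.-1 D = A%:E, 0 < A, expR c * Z <= n%:R ^+ 3 * upper_const * A &
      A <= n%:R ^+ 4 * lower_const * (expR c * Z)].
Proof.
pose P := n%:R * (36 / kap) * ((2 * R1 / kap + 2) * expR (kap^-1 + 1)).
have P0 : 0 < P.
  by rewrite !mulr_gt0 ?expR_gt0 ?invr_gt0// addr_gt0// !mulr_gt0 ?invr_gt0.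
have := level_le_area; rewrite -/P; have := area_le_level; have := hausdorff_ge0 n.-1 D.
(* The upper estimate excludes an infinite area and the lower one a zero area, so [fine] and [ln] in
   [fstar] do not fall back on default values. *)
case: (hausdorff n.-1 D) => [A| |] //; rewrite -EFinM !lee_fin => A0 AV VA.
have Ap : 0 < A by rewrite -(pmulr_rgt0 _ P0); exact: lt_le_trans VA.
exists A; split=> //; last first.
  apply: (le_trans AV); rewrite ler_wpM2l ?mulr_ge0 ?exprn_ge0// /lower_const.
  - by rewrite addr_ge0.
  - by rewrite invr_ge0 ltW.
  exact: (mean_level_vol_le oG cf a0 growthG c).
pose M : R := 9 * (2 * n%:R + 2) ^+ 2.
have := partition_le_mean_level_vol n0 oG cG cf vf a0 b0 growthG Z0 meanE GJ0 g0 gap (erefl M).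
move=> /le_trans; apply.
have n2 : 1 <= n%:R ^+ 2 :> R by rewrite exprn_ege1.
have M144 : M <= 144 * n%:R ^+ 2.
  rewrite /M (_ : 144 * _ = 9 * (4 * n%:R) ^+ 2); last by ring.
  rewrite ler_pM2l// ler_sqr ?nnegrE ?addr_ge0 ?mulr_ge0//; have := n1; lra.
have M0 : 0 <= M by rewrite mulr_ge0// sqr_ge0.
have kE : 2 * n%:R / (kap * n%:R) = 2 / kap by field; rewrite !lt0r_neq0.
rewrite kE; have k2 : 0 <= 2 / kap by rewrite divr_ge0 ?ltW.
have q : 4 + 2 * M + M * (2 / kap) <= n%:R ^+ 2 * (292 + 288 / kap).
  have := ler_wpM2r k2 M144; rewrite (_ : 144 * n%:R ^+ 2 * (2 / kap) = n%:R ^+ 2 * (288 / kap)); last by ring.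
  by rewrite mulrDr; lra.
have q0 : 0 <= 4 + 2 * M + M * (2 / kap) by rewrite !addr_ge0// mulr_ge0.
rewrite (_ : n%:R ^+ 3 * upper_const * A = n%:R ^+ 2 * (292 + 288 / kap) * (P * A)); last first.
  by rewrite /P /upper_const; ring.
by apply: ler_pM => //; exact: ltW.
Qed.

End surface_energy.

(** * Gibbs averages as integrals, and moments of centred linear forms *)

Section moments.
Context {R : realType} (n : nat) (G : set 'rV[R]_n) (f : 'rV[R]_n -> R) (a b : R).
Hypotheses (mG : measurable G) (cf : continuous f) (a0 : 0 < a) (b0 : 0 <= b).
Hypothesis growth : forall J, G J -> a * dotp J J - b <= f J.
Notation Z := (\int[lebn n]_(J in G) expR (- f J)).

Let mf : measurable_fun setT f. Proof. exact: continuous_measurable_mx. Qed.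

Let mexp : measurable_fun setT (fun J => expR (- f J)).
Proof. by apply: measurableT_comp => //; exact: measurableT_comp. Qed.

Lemma SigmaE : Sigma G f = Z.
Proof. by apply: gintE => //; exact: (boltzmann_integrable mG cf a0 growth). Qed.

Lemma gavgE (F : 'rV[R]_n -> R) : measurable_fun setT F ->
  (lebn n).-integrable G (fun J => (F J * expR (- f J))%:E) -> gavg G f F = Z^-1 * gibbs G f F.
Proof. by move=> mF iF; rewrite /gavg SigmaE gintE//; exact: measurable_funM. Qed.

Lemma gavg_energy : gavg G f f = Z^-1 * gibbs G f f.
Proof. by apply: gavgE => //; exact: (energy_integrable mG cf a0 b0 growth). Qed.

Let dotp_delta (J : 'rV[R]_n) i : dotp J (delta_mx 0 i) = J ord0 i.
Proof.
rewrite /dotp (bigD1 i)//= !mxE !eqxx mulr1 big1 ?addr0// => j ji.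
by rewrite !mxE (negbTE ji) andbF mulr0.
Qed.

Let icoord i : (lebn n).-integrable G (fun J => (J ord0 i * expR (- f J))%:E).
Proof.
have d1 : enorm (delta_mx 0 i : 'rV[R]_n) = 1 by rewrite /enorm dotp_delta mxE !eqxx sqrtr1.
have := linear_integrable mG cf a0 growth d1; congr (_.-integrable _ _).
by apply/funext => J; rewrite dotp_delta.
Qed.

Let mcoord i : measurable_fun setT (fun J : 'rV[R]_n => J ord0 i).
Proof.
have := @measurable_dotp R n (delta_mx 0 i); congr (measurable_fun _ _).
by apply/funext => J; rewrite dotp_delta.
Qed.

Lemma dotp_gavg (e : 'rV[R]_n) :
  dotp (\row_(i < n) gavg G f (fun K => K ord0 i)) e = Z^-1 * gibbs G f (fun J => dotp J e).
Proof.
have S (s : seq 'I_n) : (lebn n).-integrable G (fun J => ((\sum_(i <- s) J ord0 i * e ord0 i) * expR (- f J))%:E) /\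
    gibbs G f (fun J => \sum_(i <- s) J ord0 i * e ord0 i) = \sum_(i <- s) gibbs G f (fun J => J ord0 i) * e ord0 i.
  elim: s => [|i s [IHi IHe]].
    split.
      under eq_fun do rewrite big_nil mul0r; exact: integrable0.
    rewrite big_nil (_ : (fun _ => _) = fun=> 0); last by apply/funext => J; rewrite big_nil.
    by rewrite (gibbs1 mG cf a0 growth) mul0r.
  have ii : (lebn n).-integrable G (fun J => (e ord0 i * J ord0 i * expR (- f J))%:E).
    by under eq_fun do rewrite -mulrA; exact: integrable_scale.
  have E : (fun J : 'rV[R]_n => \sum_(j <- i :: s) J ord0 j * e ord0 j) =
      (fun J => e ord0 i * J ord0 i + \sum_(j <- s) J ord0 j * e ord0 j).
    by apply/funext => J; rewrite big_cons mulrC.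
  split.
    have -> : (fun J : 'rV[R]_n => ((\sum_(j <- i :: s) J ord0 j * e ord0 j) * expR (- f J))%:E) =
      (fun J => (e ord0 i * J ord0 i * expR (- f J))%:E + ((\sum_(j <- s) J ord0 j * e ord0 j) * expR (- f J))%:E)%E.
      by apply/funext => J; rewrite -EFinD -mulrDl big_cons (mulrC (J ord0 i)).
    exact: integrableD.
  by rewrite E (gibbsD mG)// (gibbsZ mG)// IHe big_cons mulrC.
have [_] := S (index_enum 'I_n); rewrite /dotp => ->.
rewrite mulr_sumr; apply: eq_bigr => i _; rewrite mxE gavgE// mulrA//.
Qed.

Lemma gavg_centred_pow_le (e : 'rV[R]_n) (p : nat) (C : R) : enorm e = 1 -> 0 < Z ->
  gibbs G f (fun J => expR (dotp J e)) * gibbs G f (fun J => expR (- dotp J e)) <= C * Z ^+ 2 ->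
  gavg G f (fun J => dotp (J - \row_(i < n) gavg G f (fun K => K ord0 i)) e ^+ p) <= p`!%:R * (2 * C).
Proof.
move=> e1 Z0 HC; pose m := Z^-1 * gibbs G f (fun J => dotp J e).
have -> : (fun J => dotp (J - \row_(i < n) gavg G f (fun K => K ord0 i)) e ^+ p) = (fun J => (dotp J e - m) ^+ p).
  by apply/funext => J; rewrite dotpDl dotpNl dotp_gavg.
rewrite gavgE; last 2 first.
- by apply: measurable_funX; apply: measurable_funB => //; exact: measurable_dotp.
- exact: (power_integrable mG cf a0 growth).
exact: (gibbs_moment_le mG cf a0 growth p e1 Z0 HC (erefl m)).
Qed.

End moments.

(** * Explicit constants for a single system *)

Lemma ln_dist_le {R : realType} (n k : nat) (x y K : R) : (0 < n)%N -> 0 < x -> 0 < y -> 0 < K ->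
  x <= K * n%:R ^+ k * y -> y <= K * n%:R ^+ k * x -> `|ln x - ln y| <= ln K + k%:R * ln n%:R.
Proof.
move=> n0 x0 y0 K0 xy yx; have nk : 0 < n%:R ^+ k :> R by rewrite exprn_gt0// ltr0n.
have H u v : 0 < u -> 0 < v -> u <= K * n%:R ^+ k * v -> ln u <= ln K + k%:R * ln n%:R + ln v.
  move=> u0 v0 uv; have P : 0 < K * n%:R ^+ k by rewrite mulr_gt0.
  have PV : 0 < K * n%:R ^+ k * v by rewrite mulr_gt0.
  have : ln u <= ln (K * n%:R ^+ k * v) by rewrite ler_ln ?posrE.
  move=> /le_trans; apply.
  by rewrite !lnM ?posrE// lnXn ?ltr0n// mulr_natl.
have := H x y x0 y0 xy; have := H y x y0 x0 yx.
by rewrite ler_norml => h1 h2; apply/andP; split; lra.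
Qed.

Section single_system.
Context {R : realType} (n : nat) (G : set 'rV[R]_n) (f : 'rV[R]_n -> R) (C1 R0 C3 : R).
Hypotheses (n0 : (0 < n)%N) (oG : open G) (GN0 : G !=set0) (cG : Defs.convex_set G) (vf : convex_fun f).
Hypothesis dfs : forall (ds : seq 'rV[R]_n) J, (size ds <= 2)%N -> differentiable (Defs.iterD ds f) J.
Hypotheses (C10 : 0 < C1) (R00 : 0 < R0).
Hypothesis far : forall J, n%:R * R0 ^+ 2 < dotp J J -> C1 * dotp J J <= f J.
Hypothesis freeE : - C3 <= free_energy G f.
Notation Z := (\int[lebn n]_(J in G) expR (- f J)).

Let df J : differentiable f J. Proof. exact: (@dfs [::]). Qed.

Let cf : continuous f. Proof. by move=> J; exact: differentiable_continuous. Qed.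

Let mG : measurable G. Proof. exact: open_measurable_mx. Qed.

Let nR : (0 : R) < n%:R. Proof. by rewrite ltr0n. Qed.

Let n1 : (1 : R) <= n%:R. Proof. by rewrite ler1n. Qed.

Lemma exists_growth : exists2 b, 0 <= b & forall J, C1 * dotp J J - b <= f J.
Proof.
have [b b0 fb] := exists_lower_bound vf df C10 R00 far.
exists (b + C1 * (n%:R * R0 ^+ 2)); last exact: (quadratic_growth n0 C10 R00 far b0 fb).
by rewrite addr_ge0// !mulr_ge0 ?sqr_ge0 ?ltW.
Qed.

Lemma partition_pos : 0 < Z.
Proof.
have [b b0 gr] := exists_growth.
exact: (partition_gt0 mG cf C10 (fun J _ => gr J) oG GN0).
Qed.

Lemma partition_ge : expR (- (C3 * n%:R)) <= Z.
Proof.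
have [b b0 gr] := exists_growth; have Z0 := partition_pos.
move: freeE; rewrite /free_energy (SigmaE mG cf C10 (fun J _ => gr J)) ler_pdivlMr// mulNr => h.
by rewrite -[leRHS](lnK Z0) ler_expR.
Qed.

Let c := gavg G f f.

Let meanE : gibbs G f f = c * Z.
Proof.
have [b b0 gr] := exists_growth; have Z0 := partition_pos.
rewrite /c (gavg_energy mG cf C10 b0 (fun J _ => gr J)) mulrAC mulVf ?mul1r// lt0r_neq0//.
Qed.

Let E0 := low_energy C1 R0 C3.

(** The 4 collects the additive 1 of [low_energy_point], the 2 n of [mean_energy_gap_le] and the n
    on the left, using 1 <= n. *)
Lemma mean_energy_le : c + n%:R <= n%:R * (E0 + 4).
Proof.
have [b b0 gr] := exists_growth.
have [J GJ fJ] := low_energy_point n0 oG vf df C10 R00 far partition_ge.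
have := mean_energy_gap_le n0 oG cG cf vf C10 b0 (fun J _ => gr J) partition_pos meanE GJ.
by rewrite -/E0 in fJ; have := n1; lra.
Qed.

(** Makes the energy [E0 + 4] admissible for the gradient assumption in every dimension. *)
Lemma inf_energy_lt : inf [set f J / n%:R | J in G] < E0 + 4.
Proof.
have [b b0 fb] := exists_lower_bound vf df C10 R00 far.
have [J GJ fJ] := low_energy_point n0 oG vf df C10 R00 far partition_ge.
apply: (@le_lt_trans _ _ (f J / n%:R)).
  apply: inf_lbound; last by exists J.
  by exists (- b / n%:R) => _ [K _ <-]; rewrite ler_pM2r ?invr_gt0.
rewrite ltr_pdivrMr//; apply: (le_lt_trans fJ); rewrite -/E0; have := n1; lra.
Qed.

Variables (L C0 : R).
Hypotheses (L0 : 0 <= L) (C00 : 0 < C0).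
Hypothesis gradL : forall J, f J <= n%:R * (E0 + 4) -> enorm (grad f J) <= Num.sqrt n%:R * L.

(** - [floor_const] per dimension is the lower bound of [f] supplied by [grad_lower_bound]. *)
Definition floor_const := L * (2 * R0 + 1).

(** In units of sqrt n, the radius that quadratic growth and the floor allow at energies up to n (E0
    + 4). *)
Definition radius_const := Num.sqrt ((low_energy C1 R0 C3 + 4 + floor_const + C1 * R0 ^+ 2) / C1).

(* The largest relative gap for which energy_gap applies. *)
Definition gap_const := Num.min 1 (C0 / (4 * pi) * (expR (- (C3 + floor_const + 2)) / 4) ^+ 2).

Hypothesis hess : forall e J : 'rV[R]_n, enorm e = 1 -> enorm J <= Num.sqrt n%:R * radius_const ->
  C0 <= derive1n 2 (fun t : R => f (J + t *: e)) 0.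

Definition ratio_const := upper_const gap_const radius_const + lower_const gap_const L.

Let E00 : 0 <= E0. Proof. exact: normr_ge0. Qed.

Let B0 : 0 <= floor_const. Proof. by rewrite mulr_ge0// addr_ge0// mulr_ge0// ltW. Qed.

Let radius2 : 0 < (E0 + 4 + floor_const + C1 * R0 ^+ 2) / C1.
Proof.
rewrite divr_gt0//; have : 0 <= C1 * R0 ^+ 2 by rewrite mulr_ge0 ?sqr_ge0// ltW.
have := E00; have := B0; lra.
Qed.

Lemma radius_const_gt0 : 0 < radius_const. Proof. by rewrite sqrtr_gt0. Qed.

Let radius0 := radius_const_gt0.

Let gap0 : 0 < gap_const.
Proof.
rewrite lt_min ltr01/=; apply: mulr_gt0; first by rewrite divr_gt0// mulr_gt0// pi_gt0.
by rewrite exprn_gt0// divr_gt0 ?expR_gt0.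
Qed.

Let gap1 : gap_const <= 1. Proof. by rewrite ge_min lexx. Qed.

Lemma ratio_const_gt0 : 0 < upper_const gap_const radius_const /\ 0 < lower_const gap_const L.
Proof.
have i0 : 0 < gap_const^-1 by rewrite invr_gt0.
have d0 (x : R) : 0 < x -> 0 < x / gap_const by move=> x0; exact: mulr_gt0.
split; last by apply: mulr_gt0 => //; apply: d0; rewrite ltr_wpDl.
have N m : (0 : R) < m.+1%:R by rewrite ltr0n.
apply: mulr_gt0; first by apply: mulr_gt0; [apply: addr_gt0; [exact: (N 291%N)|apply: d0; exact: (N 287%N)]|apply: d0; exact: (N 35%N)].
apply: mulr_gt0; last exact: expR_gt0.
by apply: addr_gt0 => //; apply: d0; exact: mulr_gt0.
Qed.

Let floorE J : - (floor_const * n%:R) <= f J.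
Proof.
have u0 : 0 <= n%:R * (E0 + 4) by rewrite mulr_ge0// addr_ge0.
have sL : 0 <= Num.sqrt n%:R * L by rewrite mulr_ge0// sqrtr_ge0.
have := grad_lower_bound n0 vf df C10 R00 far u0 sL gradL J.
by rewrite (_ : Num.sqrt n%:R * L * _ = Num.sqrt n%:R ^+ 2 * floor_const); [rewrite sqr_sqrtr// mulrC|rewrite /floor_const; ring].
Qed.

Let levelR J : f J <= c + n%:R -> enorm J <= Num.sqrt n%:R * radius_const.
Proof.
move=> fJ; rewrite enorm_le ?mulr_ge0 ?sqrtr_ge0// exprMn !sqr_sqrtr ?(ltW radius2)//.
rewrite mulrA ler_pdivlMr// (mulrC (dotp J J)); have h := mean_energy_le.
have bn : 0 <= floor_const * n%:R by rewrite mulr_ge0.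
have := quadratic_growth n0 C10 R00 far bn floorE J.
by rewrite /E0 in h; lra.
Qed.

Lemma free_energy_fstar_le :
  `|free_energy G f - fstar G f (c / n%:R)| <= (ln ratio_const + 4 * ln n%:R) / n%:R.
Proof.
have [b b0 gr] := exists_growth; have Z0 := partition_pos.
have mid := strongly_convex_midpoint dfs hess.
have kE : 4 * pi * gap_const / C0 <= (expR (- (C3 + floor_const + 2)) / 4) ^+ 2.
  have p4 : 0 < 4 * pi :> R by rewrite mulr_gt0// pi_gt0.
  have : gap_const <= C0 / (4 * pi) * (expR (- (C3 + floor_const + 2)) / 4) ^+ 2 by rewrite ge_min lexx orbT.
  rewrite ler_pdivrMr// -ler_pdivlMl// => /le_trans; apply.
  by rewrite le_eqVlt; apply/orP; left; apply/eqP; rewrite mulrC; ring.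
have [J0 GJ0 fJ0] := energy_gap n0 oG vf df C10 R00 far partition_ge meanE floorE levelR C00 gap0 gap1 cG mid kE.
have gJ0 : gap_const * n%:R <= c - f J0 by lra.
have c1n : c + 1 <= c + n%:R by rewrite lerD2l.
have lR J : f J <= c + 1 -> enorm J <= Num.sqrt n%:R * radius_const.
  by move=> h; apply: levelR; apply: le_trans c1n.
have gR J : f J <= c + 1 -> enorm (grad f J) <= Num.sqrt n%:R * L.
  by move=> h; apply: gradL; apply: (le_trans h); apply: (le_trans c1n); exact: mean_energy_le.
have [A [AE A0 ZA AZ]] := surface_energy_bounds n0 oG cG vf df C10 b0 gr Z0 meanE GJ0 gap0 gap1 gJ0 radius0 lR L0 gR.
have fJ0c : f J0 < c by rewrite -subr_gt0; apply: lt_le_trans gJ0; rewrite mulr_gt0.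
have nc : n%:R * (c / n%:R) = c by rewrite mulrCA divff ?mulr1// lt0r_neq0.
have DE : Dset G f (c / n%:R) = G `&` [set J | f J = c].
  by rewrite /Dset /tOmega nc (bdry_sublevel cf vf fJ0c) setIC.
rewrite /fstar DE AE nc -EFinM /= /free_energy (SigmaE mG cf C10 (fun J _ => gr J)) -mulrBl normrM.
rewrite [X in _ * X]ger0_norm ?invr_ge0// ler_pM2r ?invr_gt0//.
have [U0 W0] := ratio_const_gt0.
have n4 : 0 < n%:R ^+ 4 :> R by rewrite exprn_gt0.
have e0 := expR_gt0 c; have ec : expR (- c) * expR c = 1 by rewrite -expRD addNr expR0.
(* [surface_energy_bounds] compares exp(c) Z with the area; dividing by exp(c) gives Z against the
   integral inside [fstar]. *)
have ZE : Z = expR (- c) * (expR c * Z) by rewrite mulrA ec mul1r.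
apply: ln_dist_le => //.
- by rewrite mulr_gt0 ?expR_gt0.
- exact: addr_gt0.
- have -> : ratio_const * n%:R ^+ 4 * (expR (- c) * A) = expR (- c) * (ratio_const * n%:R ^+ 4 * A) by ring.
  rewrite {1}ZE; apply: ler_wpM2l; first exact: expR_ge0.
  apply: (le_trans ZA); apply: ler_wpM2r; first exact: ltW.
  rewrite mulrC; apply: ler_pM; [exact: ltW|exact: exprn_ge0|by rewrite /ratio_const lerDl ltW|].
  by rewrite ler_weXn2l.
apply: (@le_trans _ _ (expR (- c) * (n%:R ^+ 4 * lower_const gap_const L * (expR c * Z)))).
  by apply: ler_wpM2l AZ; exact: expR_ge0.
rewrite mulrCA (mulrA (expR (- c))) ec mul1r; apply: ler_wpM2r; first exact: ltW.
by rewrite mulrC; apply: ler_wpM2r; [exact: exprn_ge0|rewrite /ratio_const lerDr ltW].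
Qed.

End single_system.

(** * Moment constants independent of the dimension *)

Section single_system_moments.
Context {R : realType} (n : nat) (G : set 'rV[R]_n) (f : 'rV[R]_n -> R) (C1 R0 C3 : R).
Hypotheses (n0 : (0 < n)%N) (oG : open G) (GN0 : G !=set0) (cG : Defs.convex_set G) (vf : convex_fun f).
Hypothesis dfs : forall (ds : seq 'rV[R]_n) J, (size ds <= 2)%N -> differentiable (Defs.iterD ds f) J.
Hypotheses (C10 : 0 < C1) (R00 : 0 < R0).
Hypothesis far : forall J, n%:R * R0 ^+ 2 < dotp J J -> C1 * dotp J J <= f J.
Hypothesis freeE : - C3 <= free_energy G f.
Notation Z := (\int[lebn n]_(J in G) expR (- f J)).

Let df J : differentiable f J. Proof. exact: (@dfs [::]). Qed.

Let cf : continuous f. Proof. by move=> J; exact: differentiable_continuous. Qed.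

Let mG : measurable G. Proof. exact: open_measurable_mx. Qed.

Let n1 : (1 : R) <= n%:R. Proof. by rewrite ler1n. Qed.

Let S := Num.sqrt (pi / (C1 / 4)).

(* With r = sqrt n * tail_radius, the Gaussian tail beyond r is smaller than exp(- C3 n) by the factor exp(- r). *)
Definition tail_radius := R0 + 1 + 4 / C1 * (1 + `|C3 + ln (Num.sqrt (pi / (C1 / 4)))|).

Lemma tail_radius_gt0 : 0 < tail_radius.
Proof.
by rewrite addr_gt0 ?addr_gt0// mulr_gt0 ?divr_gt0.
Qed.

Variable C0 : R.
Hypotheses (C00 : 0 < C0).
Hypothesis hess : forall e J : 'rV[R]_n, enorm e = 1 -> enorm J <= Num.sqrt n%:R * tail_radius ->
  C0 <= derive1n 2 (fun t : R => f (J + t *: e)) 0.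

Lemma gavg_moment_le (e : 'rV[R]_n) (p : nat) : enorm e = 1 ->
  gavg G f (fun J => dotp (J - \row_(i < n) gavg G f (fun K => K ord0 i)) e ^+ p) <=
  p`!%:R * (2 * (expR C0^-1 + 2 * expR (2 * C1)^-1 + expR (2 * C1)^-1 ^+ 2)).
Proof.
move=> e1; have [b b0 gr] := exists_growth n0 vf dfs C10 R00 far.
have grG J : G J -> C1 * dotp J J - b <= f J by move=> _; exact: gr.
have Z0 := partition_pos n0 oG GN0 vf dfs C10 R00 far.
have ZC := partition_ge n0 oG GN0 vf dfs C10 R00 far freeE.
have T0 := tail_radius_gt0.
have s0 : 0 <= Num.sqrt (n%:R : R) by exact: sqrtr_ge0.
have r0 : 0 <= Num.sqrt n%:R * tail_radius by rewrite mulr_ge0// ltW.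
apply: (gavg_centred_pow_le mG cf C10 grG p e1 Z0).
apply: (gibbs_exp_product_le mG cf C10 grG e1 r0 C00 cG).
- move=> J _ rJ; apply: far.
  rewrite -enorm_sqr; apply: (@le_lt_trans _ _ ((Num.sqrt n%:R * tail_radius) ^+ 2)).
    rewrite exprMn sqr_sqrtr// ler_wpM2l// ler_sqr ?nnegrE ?(ltW R00) ?(ltW T0)//.
    by rewrite /tail_radius -addrA lerDl addr_ge0// mulr_ge0 ?divr_ge0 ?(ltW C10).
  by rewrite ltr_sqr ?nnegrE ?enorm_ge0.
- by move=> x y xr yr; exact: (strongly_convex_midpoint dfs hess xr yr).
have S0 : 0 < S by rewrite sqrtr_gt0 divr_gt0 ?pi_gt0// divr_gt0.
apply: (@le_trans _ _ (expR (2 * C1)^-1 * expR (- (C3 * n%:R)))); last by rewrite ler_pM2l ?expR_gt0.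
rewrite -/S -{1}(lnK S0) -expRM_natl -!expRD ler_expR exprMn sqr_sqrtr//.
have sn : Num.sqrt n%:R <= n%:R :> R.
  by rewrite -[leRHS]ger0_norm// -sqrtr_sqr ler_wsqrtr// expr2 ler_peMl.
have h1 : Num.sqrt n%:R * tail_radius <= n%:R * tail_radius by rewrite ler_pM2r.
(* Per dimension, the exponents of exp(r), of the tail and of the Gaussian integral together must
   not exceed - C3. [tail_radius] is large enough for its quadratic term to outweigh the rest, and
   sqrt n <= n takes care of exp(r). *)
have h2 : tail_radius - C1 / 4 * tail_radius ^+ 2 + ln S <= - C3.
  have t1 : 1 <= tail_radius.
    by rewrite /tail_radius -addrA addrCA lerDl addr_ge0 ?(ltW R00)// mulr_ge0 ?divr_ge0 ?(ltW C10).
  have q : 1 + `|C3 + ln S| <= C1 / 4 * tail_radius.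
    rewrite /tail_radius mulrDr -/S mulrA (_ : C1 / 4 * (4 / C1) = 1); last by field; rewrite lt0r_neq0.
    by rewrite mul1r lerDr mulr_ge0 ?divr_ge0 ?(ltW C10)// addr_ge0 ?(ltW R00).
  have := ler_wpM2r (ltW T0) q; have := ler_norm (C3 + ln S); have := normr_ge0 (C3 + ln S).
  have : `|C3 + ln S| <= `|C3 + ln S| * tail_radius by rewrite ler_peMr.
  rewrite expr2 mulrA mulrDl mul1r; lra.
have := ler_wpM2l (ler0n R n) h2; lra.
Qed.

End single_system_moments.

(** * Uniformity in the dimension *)

Theorem theorem1 (R : realType)
  (Phi : forall N : nat, 'rV[R]_N -> R) (Gam : forall N : nat, set 'rV[R]_N)
  (Hconv : forall N : nat, (0 < N)%N -> convex_fun (Phi N))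
  (Hder : forall N : nat, (0 < N)%N -> third_derivs_bounded (Phi N))
  (Hdom : forall N : nat, (0 < N)%N -> convex_domain_pw_smooth (Gam N))
  (* (i) *)
  (Hi : forall R1 : R, 0 < R1 -> exists C0 : R, 0 < C0 /\
     forall (N : nat) (e J : 'rV[R]_N), (0 < N)%N -> enorm e = 1 ->
       enorm J <= Num.sqrt N%:R * R1 ->
       C0 <= derive1n 2 (fun t : R => Phi N (J + t *: e)) 0)
  (* (ii) *)
  (Hii : exists C1 R0 : R, 0 < C1 /\ 0 < R0 /\
     forall (N : nat) (J : 'rV[R]_N), (0 < N)%N ->
       N%:R * R0 ^+ 2 < dotp J J -> C1 * dotp J J <= Phi N J)
  (* (iii) *)
  (Hiii : exists C2 : R -> R,
     (forall U : R, (exists N : nat, (0 < N)%N /\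
          inf [set Phi N J / N%:R | J in Gam N] < U) ->
        0 < C2 U /\ {for U, continuous C2}) /\
     forall (N : nat) (U : R), (0 < N)%N ->
       inf [set Phi N J / N%:R | J in Gam N] < U ->
       forall J : 'rV[R]_N, tOmega (Phi N) U J ->
         enorm (grad (Phi N) J) <= Num.sqrt N%:R * C2 U)
  (* (iv) *)
  (Hiv : exists C3 : R, forall N : nat, (0 < N)%N ->
     - C3 <= free_energy (Gam N) (Phi N)) :
  (exists (C : R) (N0 : nat), forall N : nat, (N0 <= N)%N -> (0 < N)%N ->
     `| free_energy (Gam N) (Phi N)
        - fstar (Gam N) (Phi N) (gavg (Gam N) (Phi N) (Phi N) / N%:R) |
       <= C * (ln N%:R / N%:R))
  /\
  (forall p : nat, exists Cp : R, 0 < Cp /\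
     forall (N : nat) (e : 'rV[R]_N), (0 < N)%N -> enorm e = 1 ->
       gavg (Gam N) (Phi N)
         (fun J => dotp (J - \row_(i < N) gavg (Gam N) (Phi N) (fun K => K ord0 i)) e ^+ p)
       <= Cp).
Proof.
have {Hii} [C1 [R0 [C10 [R00 far]]]] := Hii.
have {Hiii} [C2 [C2pos C2grad]] := Hiii.
have {Hiv} [C3 freeE] := Hiv.
have dfs N : (0 < N)%N -> forall (ds : seq 'rV[R]_N) J, (size ds <= 2)%N -> differentiable (Defs.iterD ds (Phi N)) J.
  by move=> N0; case: (Hder N N0).
have farN N : (0 < N)%N -> forall J : 'rV[R]_N, N%:R * R0 ^+ 2 < dotp J J -> C1 * dotp J J <= Phi N J.
  by move=> N0 J; exact: far.
split; last first.
  move=> p; have [C0 [C00 hess]] := Hi (tail_radius C1 R0 C3) (tail_radius_gt0 C3 C10 R00).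
  exists (p`!%:R * (2 * (expR C0^-1 + 2 * expR (2 * C1)^-1 + expR (2 * C1)^-1 ^+ 2))); split.
    apply: mulr_gt0; first by rewrite ltr0n fact_gt0.
    apply: mulr_gt0 => //; apply: addr_gt0; last by rewrite exprn_gt0// expR_gt0.
    by apply: addr_gt0; [exact: expR_gt0|apply: mulr_gt0 => //; exact: expR_gt0].
  move=> N e N0 e1; have [GN oG cG _] := Hdom N N0.
  have hessN : forall d J : 'rV[R]_N, enorm d = 1 -> enorm J <= Num.sqrt N%:R * tail_radius C1 R0 C3 ->
      C0 <= derive1n 2 (fun t : R => Phi N (J + t *: d)) 0.
    by move=> d J d1 Jr; exact: hess.
  exact: (gavg_moment_le N0 oG GN cG (Hconv N N0) (dfs N N0) C10 R00 (farN N N0) (freeE N N0) C00 hessN p e1).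
(* A single energy serves all dimensions, so the function [C2] of the gradient assumption is
   evaluated at one point only. *)
pose U := low_energy C1 R0 C3 + 4; pose L := C2 U.
have infU N : (0 < N)%N -> inf [set Phi N J / N%:R | J in Gam N] < U.
  move=> N0; have [GN oG cG _] := Hdom N N0.
  exact: (inf_energy_lt N0 oG GN (Hconv N N0) (dfs N N0) C10 R00 (farN N N0) (freeE N N0)).
(* Positivity of [C2] is granted only above the minimal energy of some dimension; dimension 1 serves
   as witness. *)
have L0 : 0 <= L by apply/ltW; case: (C2pos U (ex_intro _ 1%N (conj (ltn0Sn 0) (infU 1%N (ltn0Sn 0))))).
have [C0 [C00 hess]] := Hi _ (radius_const_gt0 C3 C10 R00 L0).
pose K := ratio_const C1 R0 C3 L C0.
have ln2 : 0 < ln (2 : R) by rewrite ln_gt0// ltr1n.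
(* The additive constant ln K is absorbed through ln 2 <= ln N. The range starts at 2 because ln 1 =
   0. *)
exists (`|ln K| / ln 2 + 4), 2%N => N N2 N0; have [GN oG cG _] := Hdom N N0.
have gradN J : Phi N J <= N%:R * U -> enorm (grad (Phi N) J) <= Num.sqrt N%:R * L.
  by move=> h; exact: (C2grad N U N0 (infU N N0)).
have hessN : forall d J : 'rV[R]_N, enorm d = 1 -> enorm J <= Num.sqrt N%:R * radius_const C1 R0 C3 L ->
    C0 <= derive1n 2 (fun t : R => Phi N (J + t *: d)) 0.
  by move=> d J d1 Jr; exact: hess.
have H := free_energy_fstar_le N0 oG GN cG (Hconv N N0) (dfs N N0) C10 R00 (farN N N0) (freeE N N0) L0 C00 gradN hessN.
apply: (le_trans H); rewrite -/K mulrA; apply: ler_wpM2r; first by rewrite invr_ge0.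
have lnN : ln 2 <= ln (N%:R : R) by rewrite ler_ln ?posrE ?ltr0n// ler_nat.
rewrite [leRHS]mulrDl; apply: lerD => //; apply: (le_trans (ler_norm _)).
rewrite mulrAC ler_pdivlMr//; exact: ler_wpM2l.
Qed.
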